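(* Let $g\ge 1$. Triangle cut-slide moves (CS moves) generate the chord slide groupoid $\mathfrak{CS}_{g,1}$; that is, every morphism of $\mathfrak{CS}_{g,1}$ is a finite composition of morphisms given by CS moves and their inverses.
   Context: $S_{g,1}$ is a compact connected oriented surface of genus $g\geq 1$ with one boundary component, $p\in\partial S_{g,1}$ is a basepoint, and $\pi=\pi_1(S_{g,1},p)$, a free group of rank $2g$. A bar denotes the inverse in $\pi$, or the reversal of the orientation of an arc. **CG sets and polygon domains.** A CG set is a generating set of $\pi$ with $2g$ elements that can be realized by $2g$ arcs (loops) in $S_{g,1}$ based at $p$ and disjoint except at $p$. Two CG sets are equivalent if they are realized by the same collection of arcs (up to isotopy and orientation). Cutting $S_{g,1}$ along the arcs of a CG set $\mathbf X$ gives a polygon $P_{\mathbf X}$ with $4g+1$ sides, called a polygon domain of $S_{g,1}$. One side is the boundary, and the other $4g$ sides are identified in pairs, each arc $x$ giving two sides labelled $x$ and $\bar x$. The sides are denoted $c_0,c_1,\dots,c_{4g}$, ordered and oriented by the clockwise cyclic order on the boundary of the polygon, with $c_0=\partial S_{g,1}$. Sides are identified with the elements of $\pi$ they represent, so that $c_0c_1\cdots c_{4g}=1$. Equivalence classes of CG sets correspond bijectively to polygon domains. The arcs of $\mathbf X$ are canonically ordered and oriented according to their first appearance among $c_1,\dots,c_{4g}$, so each equivalence class has a canonical ordered representative $(x_1,\dots,x_{2g})$. **The chord slide groupoid.** $\mathfrak{CS}_{g,1}$ is the groupoid whose objects are copies of $\pi$, one for each equivalence class of CG sets. Its morphisms are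 the automorphisms of $\pi$ taking one canonically ordered CG set to another: for classes with canonical representatives $(x_1,\dots,x_{2g})$ and $(y_1,\dots,y_{2g})$ there is exactly one morphism from the first to the second, given by the automorphism $x_i\mapsto y_i$. **CS moves.** Let $c_j,c_{j+1}$ (with $1\le j<j+1\le 4g$) be consecutive sides of a polygon domain $P$. Cut off the triangle bounded by $c_j$, $c_{j+1}$ and the diagonal representing $c_jc_{j+1}$, and reattach it to the rest of the polygon along one of the two sides $\bar c_j$ or $\bar c_{j+1}$ with which its sides $c_j$, $c_{j+1}$ are identified. The result is a new polygon domain $P'$. In terms of CG sets, the arc $c_j$ (when reattaching at $\bar c_j$), respectively $c_{j+1}$ (when reattaching at $\bar c_{j+1}$), is replaced by the arc $c_jc_{j+1}$, and the other arcs are unchanged. Such a move is called a triangle cut-slide move (CS move), and it is regarded as the morphism of $\mathfrak{CS}_{g,1}$ from the object of $P$ to the object of $P'$. *)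

(* Defs.v *)
From HB Require Import structures.
From mathcomp Require Import all_boot all_order all_algebra generic_quotient.
From mathcomp Require Import perm all_classical all_reals all_analysis.
From mathcomp Require Import ring lra.

Set Implicit Arguments.
Unset Strict Implicit.
Unset Printing Implicit Defensive.

Import Order.TTheory GRing.Theory Num.Theory.
Import numFieldNormedType.Exports.

Local Open Scope classical_set_scope.
Local Open Scope ring_scope.
Local Open Scope quotient_scope.

Lemma within_comp {T U V : topologicalType} (A : set T) (B : set U)
    (f : U -> V) (h : T -> U) :
    {within B, continuous f} -> {within A, continuous h} ->
  (forall x, A x -> B (h x)) -> {within A, continuous (f \o h)}.
Proof.
move=> /subspace_continuousP cf /subspace_continuousP ch hAB.
apply/subspace_continuousP => x Ax W Wfx.
have BW : nbhs (h x) [set y | B y -> W (f y)] by exact: cf (hAB _ Ax) W Wfx.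
have AW : nbhs x [set y | A y -> B (h y) -> W (f (h y))] by exact: ch Ax _ BW.
by apply: (filterS _ AW) => y Wy Ay; exact: Wy (hAB _ Ay).
Qed.

Lemma within_eq {T V : topologicalType} (A : set T) (f g : T -> V) :
  {within A, continuous f} -> (forall x, A x -> f x = g x) ->
  {within A, continuous g}.
Proof.
by move=> cf fg; apply: subspace_eq_continuous cf => x /set_mem /fg.
Qed.

Lemma within_if {R : realType} {T V : topologicalType} (C : set T)
    (a : T -> R) (f g : T -> V) :
    closed C -> continuous a ->
    {within C `&` [set x | a x <= 2^-1], continuous f} ->
    {within C `&` [set x | 2^-1 <= a x], continuous g} ->
    (forall x, C x -> a x = 2^-1 -> f x = g x) ->
  {within C, continuous (fun x => if a x <= 2^-1 then f x else g x)}.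
Proof.
move=> cC ca cf cg fg.
have -> : C = (C `&` [set x | a x <= 2^-1]) `|` (C `&` [set x | 2^-1 <= a x]).
  rewrite -setIUr; apply/esym/setIidl => x _ /=.
  by case: (leP (a x) 2^-1) => [|/ltW]; [left|right].
apply: withinU_continuous.
- by apply: closedI => //; move/continuous_closedP: ca => ca; exact: (ca _ (@closed_le R 2^-1)).
- by apply: closedI => //; move/continuous_closedP: ca => ca; exact: (ca _ (@closed_ge R 2^-1)).
- by apply: within_eq cf _ => x [_ /= ->].
- apply: within_eq cg _ => x [Cx /= ax]; case: ifPn => // ax'.
  by rewrite fg //; apply/le_anti/andP.
Qed.

Lemma continuous_minr {R : realType} (f g : R -> R) :
  continuous f -> continuous g -> continuous (fun x => Num.min (f x) (g x)).
Proof. by move=> cf cg x; apply: continuous_min; [exact: cf|exact: cg]. Qed.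

Lemma continuous_maxr {R : realType} (f g : R -> R) :
  continuous f -> continuous g -> continuous (fun x => Num.max (f x) (g x)).
Proof. by move=> cf cg x; apply: continuous_max; [exact: cf|exact: cg]. Qed.

Lemma continuous_pairing {T U V : topologicalType} (f : T -> U) (g : T -> V) :
  continuous f -> continuous g -> continuous (fun x => (f x, g x)).
Proof. by move=> cf cg x; apply: cvg_pair; [exact: cf|exact: cg]. Qed.

Lemma closed_unit_itv {R : realType} : closed (`[0, 1]%classic : set R).
Proof. exact: interval_closed. Qed.

Section FundamentalGroup.
Context {R : realType} {S : topologicalType} (p : S).

Record loop := Loop {
  loop_fun :> R -> S;
  loop_continuous : {within `[0, 1], continuous loop_fun};
  loop_start : loop_fun 0 = p;
  loop_end : loop_fun 1 = p }.

HB.instance Definition _ := gen_eqMixin loop.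
HB.instance Definition _ := gen_choiceMixin loop.

Definition homotopic (f g : loop) : Prop :=
  exists H : R * R -> S,
    {within `[0, 1] `*` `[0, 1], continuous H} /\
    (forall t, t \in `[0, 1] ->
      [/\ H (0, t) = f t, H (1, t) = g t, H (t, 0) = p & H (t, 1) = p]).

Local Notation I := (`[0, 1]%classic : set R).

Let closedII : closed (I `*` I).
Proof.
have -> : I `*` I = (fst @^-1` I) `&` (snd @^-1` I) :> set (R * R).
  by apply/seteqP; split=> -[].
have c1 : continuous (fst : R * R -> R) by move=> x; exact: cvg_fst.
have c2 : continuous (snd : R * R -> R) by move=> x; exact: cvg_snd.
move/continuous_closedP: c1 => c1; move/continuous_closedP: c2 => c2.
by apply: closedI; [exact: (c1 _ closed_unit_itv)|exact: (c2 _ closed_unit_itv)].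
Qed.

Lemma reparam_homotopic (h : R -> S) (phi psi : R -> R) (f g : loop) :
    {within `[0, 1], continuous h} -> continuous phi -> continuous psi ->
    (forall t : R, 0 <= t <= 1 -> 0 <= phi t <= 1 /\ 0 <= psi t <= 1) ->
    phi 0 = psi 0 -> phi 1 = psi 1 ->
    (forall t : R, 0 <= t <= 1 -> f t = h (phi t) /\ g t = h (psi t)) ->
  homotopic f g.
Proof.
move=> ch cphi cpsi phipsi e0 e1 fg.
exists (h \o (fun st : R * R => (1 - st.1) * phi st.2 + st.1 * psi st.2)).
have k0 : 0 <= (0 : R) <= 1 by rewrite lexx ler01.
have k1 : 0 <= (1 : R) <= 1 by rewrite lexx ler01.
split=> [|t].
  apply: within_comp ch _ _.
    apply: continuous_subspaceT => x.
    have c1 : (fst : R * R -> R) @ x --> x.1 by exact: cvg_fst.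
    have c2 : (fst : R * R -> R) @ x --> x.1 by exact: cvg_fst.
    apply: cvgD; apply: cvgM => //.
    + by apply: cvgB => //; exact: cvg_cst.
    + apply: continuous_comp; [exact: cvg_snd|exact: cphi].
    + apply: continuous_comp; [exact: cvg_snd|exact: cpsi].
  move=> [s t] [] /=; rewrite !in_itv /= => s01 t01.
  by have [] := phipsi t t01; nra.
rewrite in_itv /= => t01.
have [ft gt] := fg t t01; have [f0 g0] := fg 0 k0; have [f1 g1] := fg 1 k1.
split => /=.
- by rewrite subr0 mul1r mul0r addr0.
- by rewrite subrr mul1r mul0r add0r.
- by rewrite e0 -mulrDl subrK mul1r -g0 loop_start.
- by rewrite e1 -mulrDl subrK mul1r -g1 loop_end.
Qed.

Lemma homotopic_refl f : homotopic f f.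
Proof.
apply: (@reparam_homotopic f id id) => //; first exact: loop_continuous.
  by move=> x; exact: cvg_id.
by move=> x; exact: cvg_id.
Qed.

Lemma homotopic_sym f g : homotopic f g -> homotopic g f.
Proof.
move=> [H [cH fg]].
exists (H \o (fun st : R * R => (1 - st.1, st.2))); split=> [|t t01].
  apply: within_comp cH _ _.
    apply: continuous_subspaceT; apply: continuous_pairing => x; last exact: cvg_snd.
    by apply: cvgB; [exact: cvg_cst|exact: cvg_fst].
  by move=> [s t] []; rewrite /= !in_itv /= => s01 ->; split=> //; lra.
have [h0 h1 h2 h3] := fg _ t01.
have t01' : 1 - t \in `[0, 1] by move: t01; rewrite !in_itv /=; lra.
have [_ _ h2' h3'] := fg _ t01'.
by rewrite /= subr0 subrr.
Qed.

Lemma homotopic_trans f g h :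
  homotopic f g -> homotopic g h -> homotopic f h.
Proof.
move=> [H [cH fg]] [K [cK gh]].
exists (fun st => if st.1 <= 2^-1 then (H \o (fun st => (2 * st.1, st.2))) st
                  else (K \o (fun st => (2 * st.1 - 1, st.2))) st).
split=> [|t t01].
  apply: within_if => //.
  - by move=> x; exact: cvg_fst.
  - apply: within_comp cH _ _.
      apply: continuous_subspaceT; apply: continuous_pairing => x; last exact: cvg_snd.
      by apply: cvgM; [exact: cvg_cst|exact: cvg_fst].
    move=> [s t] [] [] /=; rewrite !in_itv /= => s01 -> s2; split=> //; lra.
  - apply: within_comp cK _ _.
      apply: continuous_subspaceT; apply: continuous_pairing => x; last exact: cvg_snd.
      apply: cvgB; last exact: cvg_cst.
      by apply: cvgM; [exact: cvg_cst|exact: cvg_fst].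
    move=> [s t] [] [] /=; rewrite !in_itv /= => s01 -> s2; split=> //; lra.
  - move=> [s t] [/= s01 t01] ->; rewrite divff// subrr.
    by have [_ -> _ _] := fg _ t01; have [-> _ _ _] := gh _ t01.
have [h0 h1 h2 h3] := fg _ t01; have [k0 k1 k2 k3] := gh _ t01.
rewrite /= ifT ?invr_ge0// mulr0 ifF; last by apply/negbTE; rewrite -ltNge; lra.
have -> : 2 * 1 - 1 = 1 :> R by ring.
split=> //; case: ifPn => ht.
- by have [|] := fg (2 * t); first by move: t01; rewrite !in_itv/=; lra.
- have [|//] := gh (2 * t - 1).
  by move: t01 ht; rewrite !in_itv/= -ltNge; lra.
- by have [|] := fg (2 * t); first by move: t01; rewrite !in_itv/=; lra.
- have [|//] := gh (2 * t - 1).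
  by move: t01 ht; rewrite !in_itv/= -ltNge; lra.
Qed.

Definition homotopicb (f g : loop) : bool := `[< homotopic f g >].

Lemma homotopicb_refl : reflexive homotopicb.
Proof. by move=> f; apply/asboolP; exact: homotopic_refl. Qed.

Lemma homotopicb_sym : symmetric homotopicb.
Proof. by move=> f g; apply/asboolP/asboolP; exact: homotopic_sym. Qed.

Lemma homotopicb_trans : transitive homotopicb.
Proof.
move=> g f h /asboolP fg /asboolP gh; apply/asboolP.
exact: homotopic_trans fg gh.
Qed.

Definition homotopic_rel :=
  EquivRel homotopicb homotopicb_refl homotopicb_sym homotopicb_trans.

Lemma concat_continuous (f g : loop) :
  {within `[0, 1], continuous
    (fun t : R => if t <= 2^-1 then f (2 * t) else g (2 * t - 1))}.
Proof.
apply: (@within_if _ _ _ _ id (f \o *%R 2) (g \o (fun t => 2 * t - 1))).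
- exact: closed_unit_itv.
- by move=> x; exact: cvg_id.
- apply: within_comp (@loop_continuous f) _ _.
    apply: continuous_subspaceT => x.
    by apply: cvgM; [exact: cvg_cst|exact: cvg_id].
  by move=> t []; rewrite /= !in_itv /=; lra.
- apply: within_comp (@loop_continuous g) _ _.
    apply: continuous_subspaceT => x; apply: cvgB; last exact: cvg_cst.
    by apply: cvgM; [exact: cvg_cst|exact: cvg_id].
  by move=> t []; rewrite /= !in_itv /=; lra.
- by move=> t /= _ ->; rewrite divff// subrr loop_start loop_end.
Qed.

Lemma concat_start (f g : loop) :
  (if (0 : R) <= 2^-1 then f (2 * 0) else g (2 * 0 - 1)) = p.
Proof. by rewrite invr_ge0 ler0n mulr0 loop_start. Qed.

Lemma concat_end (f g : loop) :
  (if (1 : R) <= 2^-1 then f (2 * 1) else g (2 * 1 - 1)) = p.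
Proof.
rewrite ifF; last by apply/negbTE; rewrite -ltNge; lra.
have -> : 2 * 1 - 1 = 1 :> R by ring.
exact: loop_end.
Qed.

Definition concat (f g : loop) : loop :=
  Loop (@concat_continuous f g) (concat_start f g) (concat_end f g).

Lemma reverse_continuous (f : loop) :
  {within `[0, 1], continuous (fun t : R => f (1 - t))}.
Proof.
apply: within_comp (@loop_continuous f) _ _.
  apply: continuous_subspaceT => x.
  by apply: cvgB; [exact: cvg_cst|exact: cvg_id].
by move=> t; rewrite /= !in_itv /=; lra.
Qed.

Lemma reverse_start (f : loop) : f (1 - 0) = p.
Proof. by rewrite subr0 loop_end. Qed.

Lemma reverse_end (f : loop) : f (1 - 1) = p.
Proof. by rewrite subrr loop_start. Qed.

Definition reverse (f : loop) : loop :=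
  Loop (@reverse_continuous f) (reverse_start f) (reverse_end f).

Lemma constant_continuous : {within `[0, 1], continuous (fun _ : R => p)}.
Proof. by apply: continuous_subspaceT => x; exact: cvg_cst. Qed.

Definition constant_loop : loop := Loop constant_continuous erefl erefl.

Lemma homotopic_concat f f' g g' :
  homotopic f f' -> homotopic g g' -> homotopic (concat f g) (concat f' g').
Proof.
move=> [H [cH fH]] [K [cK gK]].
exists (fun st => if st.2 <= 2^-1 then (H \o (fun st => (st.1, 2 * st.2))) st
                  else (K \o (fun st => (st.1, 2 * st.2 - 1))) st).
have k0 : (0 : R) \in `[0, 1] by rewrite in_itv /= lexx ler01.
have k1 : (1 : R) \in `[0, 1] by rewrite in_itv /= lexx ler01.
split=> [|t t01].
  apply: within_if => //.
  - by move=> x; exact: cvg_snd.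
  - apply: within_comp cH _ _.
      apply: continuous_subspaceT; apply: continuous_pairing => x; first exact: cvg_fst.
      by apply: cvgM; [exact: cvg_cst|exact: cvg_snd].
    move=> [s t] [] [] /=; rewrite !in_itv /= => -> s01 s2; split=> //; lra.
  - apply: within_comp cK _ _.
      apply: continuous_subspaceT; apply: continuous_pairing => x; first exact: cvg_fst.
      apply: cvgB; last exact: cvg_cst.
      by apply: cvgM; [exact: cvg_cst|exact: cvg_snd].
    move=> [s t] [] [] /=; rewrite !in_itv /= => -> s01 s2; split=> //; lra.
  - move=> [s t] [/= s01 t01] ->; rewrite divff// subrr.
    by have [_ _ _ ->] := fH _ s01; have [_ _ -> _] := gK _ s01.
have [h0 h1 h2 h3] := fH _ t01; have [j0 j1 j2 j3] := gK _ t01.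
split=> /=.
- case: ifPn => ht.
    by have [|] := fH (2 * t); first by move: t01; rewrite !in_itv/=; lra.
  have [|//] := gK (2 * t - 1).
  by move: t01 ht; rewrite !in_itv/= -ltNge; lra.
- case: ifPn => ht.
    by have [|] := fH (2 * t); first by move: t01; rewrite !in_itv/=; lra.
  have [|//] := gK (2 * t - 1).
  by move: t01 ht; rewrite !in_itv/= -ltNge; lra.
- by rewrite ifT ?invr_ge0// mulr0.
- rewrite ifF; last by apply/negbTE; rewrite -ltNge; lra.
  have -> : 2 * 1 - 1 = 1 :> R by ring.
  exact: j3.
Qed.

Lemma homotopic_reverse f f' :
  homotopic f f' -> homotopic (reverse f) (reverse f').
Proof.
move=> [H [cH fH]].
exists (H \o (fun st : R * R => (st.1, 1 - st.2))); split=> [|t t01].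
  apply: within_comp cH _ _.
    apply: continuous_subspaceT; apply: continuous_pairing => x; first exact: cvg_fst.
    by apply: cvgB; [exact: cvg_cst|exact: cvg_snd].
  by move=> [s t] []; rewrite /= !in_itv /= => -> s01; split=> //; lra.
have [_ _ h2 h3] := fH _ t01.
have t01' : 1 - t \in `[0, 1] by move: t01; rewrite !in_itv /=; lra.
have [h0 h1 _ _] := fH _ t01'.
by rewrite /= subr0 subrr.
Qed.

Lemma concatA f g h :
  homotopic (concat f (concat g h)) (concat (concat f g) h).
Proof.
pose phi (t : R) : R :=
  Num.min (2 * t) (Num.min (t + 4^-1) ((t + 1) / 2)).
have cphi : continuous phi.
  apply: continuous_minr => [x|]; last apply: continuous_minr => x.
  - by apply: cvgM; [exact: cvg_cst|exact: cvg_id].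
  - by apply: cvgD; [exact: cvg_id|exact: cvg_cst].
  - apply: cvgM; last exact: cvg_cst.
    by apply: cvgD; [exact: cvg_id|exact: cvg_cst].
have phiE t : phi t = if t <= 4^-1 then 2 * t
    else if t <= 2^-1 then t + 4^-1 else (t + 1) / 2.
  rewrite /phi !minEle; case: (leP (t + 4^-1) ((t + 1) / 2)) => ?;
    by do ![case: leP => ?]; lra.
apply: homotopic_sym.
apply: (@reparam_homotopic (concat f (concat g h)) phi id) => //.
- exact: loop_continuous.
- by move=> x; exact: cvg_id.
- move=> t t01; split=> //; rewrite phiE; case: ifPn => ?; last case: ifPn => ?; lra.
- by rewrite phiE ifT ?invr_ge0// mulr0.
- by rewrite phiE !ifF; [field|apply/negbTE; rewrite -ltNge; lra..].
move=> t t01; split=> //; rewrite phiE /=.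
have [t4|t4] := leP t 4^-1.
  by rewrite !ifT; [congr (f _); ring|lra..].
have [t2|t2] := leP t 2^-1.
  rewrite [in LHS]ifF; last by apply/negbTE; rewrite -ltNge; lra.
  rewrite [in RHS]ifF; last by apply/negbTE; rewrite -ltNge; lra.
  by rewrite ifT; [congr (g _); field|lra].
by rewrite !ifF; [congr (h _); field|apply/negbTE; rewrite -ltNge; lra..].
Qed.

Lemma concat_constl f : homotopic (concat constant_loop f) f.
Proof.
apply: (@reparam_homotopic f (fun t => Num.max 0 (2 * t - 1)) id) => //.
- exact: loop_continuous.
- apply: continuous_maxr => x; first exact: cvg_cst.
  apply: cvgB; last exact: cvg_cst.
  by apply: cvgM; [exact: cvg_cst|exact: cvg_id].
- by move=> x; exact: cvg_id.
- by move=> t t01; split=> //; case: (leP 0 (2 * t - 1)); lra.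
- by rewrite max_l //; lra.
- by rewrite max_r; lra.
move=> t t01; split=> //=; case: (leP t 2^-1) => t2.
  by rewrite max_l ?loop_start//; lra.
by rewrite max_r//; lra.
Qed.

Lemma concat_constr f : homotopic (concat f constant_loop) f.
Proof.
apply: (@reparam_homotopic f (fun t => Num.min 1 (2 * t)) id) => //.
- exact: loop_continuous.
- apply: continuous_minr => x; first exact: cvg_cst.
  by apply: cvgM; [exact: cvg_cst|exact: cvg_id].
- by move=> x; exact: cvg_id.
- by move=> t t01; split=> //; case: (leP 1 (2 * t)); lra.
- by rewrite min_r ?mulr0//; lra.
- by rewrite min_l; lra.
move=> t t01; split=> //=; case: (leP t 2^-1) => t2.
  by rewrite min_r//; lra.
by rewrite min_l ?loop_end//; lra.
Qed.

Lemma concat_reverser f : homotopic (concat f (reverse f)) constant_loop.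
Proof.
apply: (@reparam_homotopic f (fun t => Num.min (2 * t) (2 - 2 * t))
  (fun=> 0)) => //.
- exact: loop_continuous.
- apply: continuous_minr => x.
    by apply: cvgM; [exact: cvg_cst|exact: cvg_id].
  apply: cvgB; first exact: cvg_cst.
  by apply: cvgM; [exact: cvg_cst|exact: cvg_id].
- by move=> x; exact: cvg_cst.
- by move=> t t01; split=> //; case: (leP (2 * t) (2 - 2 * t)); lra.
- by rewrite min_l; lra.
- by rewrite min_r; lra.
move=> t t01; rewrite loop_start; split=> //=; case: (leP t 2^-1) => t2.
  by rewrite min_l//; lra.
by rewrite min_r//; [congr (f _); ring|lra].
Qed.

Lemma concat_reversel f : homotopic (concat (reverse f) f) constant_loop.
Proof.
apply: (@reparam_homotopic f (fun t => Num.max (1 - 2 * t) (2 * t - 1))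
  (fun=> 1)) => //.
- exact: loop_continuous.
- apply: continuous_maxr => x.
    apply: cvgB; first exact: cvg_cst.
    by apply: cvgM; [exact: cvg_cst|exact: cvg_id].
  apply: cvgB; last exact: cvg_cst.
  by apply: cvgM; [exact: cvg_cst|exact: cvg_id].
- by move=> x; exact: cvg_cst.
- by move=> t t01; split=> //; case: (leP (1 - 2 * t) (2 * t - 1)); lra.
- by rewrite max_l; lra.
- by rewrite max_r; lra.
move=> t t01; rewrite loop_end; split=> //=; case: (leP t 2^-1) => t2.
  by rewrite max_l//; lra.
by rewrite max_r//; lra.
Qed.

Definition pi1 : Type := {eq_quot homotopic_rel}.

HB.instance Definition _ := Choice.on pi1.
HB.instance Definition _ := EqQuotient.on pi1.

Definition pi1_class (f : loop) : pi1 := \pi_pi1 f.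

Lemma pi1_classP f g : pi1_class f = pi1_class g <-> homotopic f g.
Proof.
by split=> [/eqmodP /asboolP //|fg]; apply/eqmodP/asboolP.
Qed.

Lemma pi1_ind (P : pi1 -> Prop) : (forall f, P (pi1_class f)) -> forall x, P x.
Proof. by move=> Pf x; rewrite -[x]reprK; exact: Pf. Qed.

Definition pi1_mul (x y : pi1) : pi1 := pi1_class (concat (repr x) (repr y)).
Definition pi1_inv (x : pi1) : pi1 := pi1_class (reverse (repr x)).
Definition pi1_one : pi1 := pi1_class constant_loop.

Let homotopic_repr f : homotopic (repr (pi1_class f)) f.
Proof. by apply/pi1_classP; rewrite /pi1_class reprK. Qed.

Lemma pi1_mulE f g :
  pi1_mul (pi1_class f) (pi1_class g) = pi1_class (concat f g).
Proof. by apply/pi1_classP; apply: homotopic_concat. Qed.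

Lemma pi1_invE f : pi1_inv (pi1_class f) = pi1_class (reverse f).
Proof. by apply/pi1_classP; apply: homotopic_reverse. Qed.

Lemma pi1_mulA : associative pi1_mul.
Proof.
elim/pi1_ind=> f; elim/pi1_ind=> g; elim/pi1_ind=> h.
by rewrite !pi1_mulE; apply/pi1_classP/concatA.
Qed.

Lemma pi1_mul1 : left_id pi1_one pi1_mul.
Proof.
by elim/pi1_ind=> f; rewrite pi1_mulE; apply/pi1_classP/concat_constl.
Qed.

Lemma pi1_mulr1 : right_id pi1_one pi1_mul.
Proof.
by elim/pi1_ind=> f; rewrite pi1_mulE; apply/pi1_classP/concat_constr.
Qed.

Lemma pi1_mulV : left_inverse pi1_one pi1_inv pi1_mul.
Proof.
elim/pi1_ind=> f; rewrite pi1_invE pi1_mulE.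
exact/pi1_classP/concat_reversel.
Qed.

Lemma pi1_mulrV : right_inverse pi1_one pi1_inv pi1_mul.
Proof.
elim/pi1_ind=> f; rewrite pi1_invE pi1_mulE.
exact/pi1_classP/concat_reverser.
Qed.

HB.instance Definition _ :=
  isGroup.Build pi1 pi1_mulA pi1_mul1 pi1_mulr1 pi1_mulV pi1_mulrV.

End FundamentalGroup.

Section Polygons.
Context {R : realType}.
Implicit Types a b c z w : R * R.

Definition orient a b c : R :=
  (b.1 - a.1) * (c.2 - a.2) - (b.2 - a.2) * (c.1 - a.1).

(* Negative orientation of every increasing triple means that the vertices    *)
(* are in strictly convex position and listed clockwise. Side [k] joins       *)
(* [v k] to the cyclically next vertex [v (ordS k)].                          *)
Definition clockwise n (v : 'I_n -> R * R) : Prop :=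
  forall i j k : 'I_n, (i < j)%N -> (j < k)%N -> orient (v i) (v j) (v k) < 0.

Definition polygon n (v : 'I_n -> R * R) : set (R * R) :=
  [set z | forall k, orient (v k) (v (ordS k)) z <= 0].

Definition side_pt n (v : 'I_n -> R * R) (k : 'I_n) (t : R) : R * R :=
  ((1 - t) * (v k).1 + t * (v (ordS k)).1,
   (1 - t) * (v k).2 + t * (v (ordS k)).2).

Lemma side_pt0 n (v : 'I_n -> R * R) k : side_pt v k 0 = v k.
Proof. by rewrite /side_pt subr0 !mul1r !mul0r !addr0; case: (v k). Qed.

Lemma side_pt1 n (v : 'I_n -> R * R) k : side_pt v k 1 = v (ordS k).
Proof. by rewrite /side_pt subrr !mul1r !mul0r !add0r; case: (v _). Qed.

Lemma side_pt_continuous n (v : 'I_n -> R * R) k : continuous (side_pt v k).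
Proof.
apply: continuous_pairing => x; apply: cvgD; apply: cvgM;
  try exact: cvg_cst; try exact: cvg_id;
  by apply: cvgB; [exact: cvg_cst|exact: cvg_id].
Qed.

Lemma vertex_polygon n (v : 'I_n -> R * R) i : clockwise v -> polygon v (v i).
Proof.
move=> cv k.
have rot a b c : orient a b c = orient b c a by rewrite /orient; ring.
have o1 a b : orient a b a = 0 by rewrite /orient; ring.
have o2 a b : orient a b b = 0 by rewrite /orient; ring.
have [->|ik] := eqVneq i k; first by rewrite o1.
have [->|iSk] := eqVneq i (ordS k); first by rewrite o2.
have := ltn_ord i; have := ltn_ord k; set Sk := ordS k => kn ltin.
have Sk_val : Sk = (k.+1 %% n)%N :> nat by [].
have /= ik' : (i : nat) != k by [].
have /= iSk' : (i : nat) != Sk by [].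
have [Skn|nSk] := ltnP (k.+1)%N n.
  rewrite modn_small// in Sk_val.
  have [lik|lki] := ltnP i k.
    by rewrite -rot; apply/ltW/cv => //; rewrite Sk_val.
  apply/ltW/cv; first by rewrite Sk_val.
  rewrite ltn_neqAle eq_sym iSk' Sk_val /= ltn_neqAle eq_sym.
  by rewrite ik' lki.
have kE : (k.+1 = n)%N by apply/eqP; rewrite eqn_leq nSk kn.
have Sk0 : Sk = 0%N :> nat by rewrite Sk_val kE modnn.
rewrite rot; apply/ltW/cv; first by rewrite Sk0 lt0n -Sk0.
by rewrite ltn_neqAle ik' -ltnS kE.
Qed.

Lemma side_polygon n (v : 'I_n -> R * R) k t :
  clockwise v -> t \in `[0, 1] -> polygon v (side_pt v k t).
Proof.
rewrite in_itv /= => cv t01 m.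
have h1 := @vertex_polygon n v k cv m.
have h2 := @vertex_polygon n v (ordS k) cv m.
have -> : orient (v m) (v (ordS m)) (side_pt v k t) =
    (1 - t) * orient (v m) (v (ordS m)) (v k) +
    t * orient (v m) (v (ordS m)) (v (ordS k)).
  by rewrite /orient /side_pt /=; ring.
rewrite /= in h1 h2; move: h1 h2; move: (orient _ _ (v k)) => x.
by move: (orient _ _ (v (ordS k))) => y x0 y0; nra.
Qed.

(* Sides are numbered from 0 to 4g; side 0 is left free and the pairing       *)
(* fixes its index.                                                           *)
Definition side_pairing g (s : 'I_(4 * g).+1 -> 'I_(4 * g).+1) : Prop :=
  [/\ involutive s, s ord0 = ord0 & forall k, k != ord0 -> s k != k].

Definition glued g (v : 'I_(4 * g).+1 -> R * R)
    (s : 'I_(4 * g).+1 -> 'I_(4 * g).+1) (z w : R * R) : Prop :=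
  [\/ z = w,
      exists i j, z = v i /\ w = v j |
      exists k t, [/\ k != ord0, t \in `[0, 1],
        z = side_pt v k t & w = side_pt v (s k) (1 - t)]].

(* [f] presents [S] as the quotient of a clockwise convex (4g+1)-gon: paired  *)
(* sides are identified with reversed direction, and all vertices become one  *)
(* point. As the polygon is compact, for Hausdorff [S] the quotient topology  *)
(* is automatic.                                                              *)
Record polygon_quotient g (S : topologicalType) (v : 'I_(4 * g).+1 -> R * R)
    (s : 'I_(4 * g).+1 -> 'I_(4 * g).+1) (f : R * R -> S) : Prop := {
  pq_clockwise : clockwise v;
  pq_pairing : side_pairing s;
  pq_continuous : {within polygon v, continuous f};
  pq_surjective : forall x, exists2 z, polygon v z & f z = x;
  pq_fibers : forall z w, polygon v z -> polygon v w ->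
    (f z = f w <-> glued v s z w) }.

(* The boundary word of the classical model: sides 4m+1, 4m+2, 4m+3, 4m+4     *)
(* read a, b, a^-1, b^-1.                                                     *)
Definition std_pairing g (k : 'I_(4 * g).+1) : 'I_(4 * g).+1 :=
  if k == ord0 then ord0
  else inord (if (k.-1 %% 4 < 2)%N then k.+2 else k.-2).

End Polygons.

(* The compact connected oriented surface of genus g with one boundary        *)
(* component: a Hausdorff space with a chosen presentation as the standard    *)
(* (4g+1)-gon with sides 1, ..., 4g glued according to the product of g       *)
(* commutators; side 0 parametrizes the boundary and fixes the orientation.   *)
Record surface (R : realType) (g : nat) := Surface {
  carrier :> topologicalType;
  surface_hausdorff : hausdorff_space carrier;
  std_vertex : 'I_(4 * g).+1 -> R * R;
  std_map : R * R -> carrier;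
  std_quotient : polygon_quotient std_vertex (@std_pairing g) std_map }.

Section ChordSlides.
Context {R : realType} {g : nat} (S : surface R g).

Local Notation sides := 'I_(4 * g).+1.

Definition boundary (t : R) : S := std_map S (side_pt (@std_vertex R g S) ord0 t).

Definition basepoint : S := boundary 0.

Local Notation pi := (pi1 (R := R) basepoint).

Record polygon_domain := PolygonDomain {
  pd_vertex : sides -> R * R;
  pd_pairing : sides -> sides;
  pd_map : R * R -> S;
  pd_quotient : polygon_quotient pd_vertex pd_pairing pd_map;
  pd_boundary : forall t, t \in `[0, 1] ->
    pd_map (side_pt pd_vertex ord0 t) = boundary t }.

Section Sides.
Variables (P : polygon_domain) (k : sides).

Let cw := pq_clockwise (pd_quotient P).

Lemma pd_map_vertex i : pd_map P (pd_vertex P i) = basepoint.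
Proof.
rewrite -[basepoint](pd_boundary P); last by rewrite in_itv /= lexx ler01.
rewrite side_pt0; apply/(pq_fibers (pd_quotient P)); try exact: vertex_polygon.
by apply: Or32; exists i, ord0.
Qed.

Lemma side_continuous :
  {within `[0, 1], continuous (pd_map P \o side_pt (pd_vertex P) k)}.
Proof.
apply: within_comp (pq_continuous (pd_quotient P)) _ _.
  by apply: continuous_subspaceT => t; exact: side_pt_continuous.
by move=> t t01; exact: side_polygon.
Qed.

Lemma side_start : (pd_map P \o side_pt (pd_vertex P) k) 0 = basepoint.
Proof. by rewrite /= side_pt0 pd_map_vertex. Qed.

Lemma side_end : (pd_map P \o side_pt (pd_vertex P) k) 1 = basepoint.
Proof. by rewrite /= side_pt1 pd_map_vertex. Qed.

Definition side_loop : loop basepoint :=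
  Loop side_continuous side_start side_end.

Definition side : pi := pi1_class side_loop.

End Sides.

Definition generating (x : 'I_(2 * g) -> pi) : Prop :=
  forall H : set pi,
    H 1%g -> (forall u v, H u -> H v -> H (u * v)%g) ->
    (forall u, H u -> H u^-1%g) -> (forall i, H (x i)) ->
  forall u, H u.

Definition realized_by (a : 'I_(2 * g) -> loop (R := R) basepoint)
    (x : 'I_(2 * g) -> pi) : Prop :=
  [/\ forall i, pi1_class (a i) = x i,
      forall i s t, s \in `[0, 1[ -> t \in `[0, 1[ -> a i s = a i t -> s = t &
      forall i j s t, i != j -> s \in `[0, 1] -> t \in `[0, 1] ->
        a i s = a j t -> a i s = basepoint].

Definition CG_set (x : 'I_(2 * g) -> pi) : Prop :=
  [/\ injective x, generating x & exists a, realized_by a x].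

(* Being realized by the same arcs, up to order and orientation.              *)
Definition CG_equiv (x y : 'I_(2 * g) -> pi) : Prop :=
  exists s : {perm 'I_(2 * g)},
    forall i, y i = x (s i) \/ y i = (x (s i))^-1%g.

(* The sides that come before their partner, in increasing order; the i-th of *)
(* them is the first appearance of the i-th arc, with its canonical           *)
(* orientation.                                                               *)
Definition first_sides (P : polygon_domain) : seq sides :=
  [seq k : sides <- enum 'I_(4 * g).+1 | (k < pd_pairing P k)%N].

Definition arc_side (P : polygon_domain) (i : 'I_(2 * g)) : sides :=
  nth ord0 (first_sides P) i.

(* [P] is obtained by cutting along the arcs [a], which are moreover          *)
(* canonically ordered and oriented by [P].                                   *)
Definition canonical_cut (a : 'I_(2 * g) -> loop (R := R) basepoint)
    (P : polygon_domain) : Prop :=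
  forall i t, t \in `[0, 1] -> a i t = side_loop P (arc_side P i) t.

Definition has_polygon (x : 'I_(2 * g) -> pi) (P : polygon_domain) : Prop :=
  exists2 a, realized_by a x & canonical_cut a P.

(* An equivalence class of CG sets, given by its canonical representative.    *)
Record cs_object := CSObject {
  rep : 'I_(2 * g) -> pi;
  rep_CG : CG_set rep;
  rep_canonical : exists P, has_polygon rep P }.

Record cs_hom (X Y : cs_object) := CSHom {
  hom_fun :> pi -> pi;
  hom_inv : pi -> pi;
  hom_funK : cancel hom_fun hom_inv;
  hom_invK : cancel hom_inv hom_fun;
  hom_mul : {morph hom_fun : u v / (u * v)%g >-> (u * v)%g};
  hom_rep : forall i, hom_fun (rep X i) = rep Y i }.

Definition hom_id (X : cs_object) : cs_hom X X :=
  @CSHom X X id id (fun=> erefl) (fun=> erefl) (fun _ _ => erefl)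
    (fun=> erefl).

Section HomOps.
Variables (X Y Z : cs_object) (f : cs_hom X Y) (h : cs_hom Y Z).

Lemma comp_mul : {morph h \o f : u v / (u * v)%g >-> (u * v)%g}.
Proof. by move=> u v; rewrite /= !hom_mul. Qed.

Lemma comp_rep i : (h \o f) (rep X i) = rep Z i.
Proof. by rewrite /= !hom_rep. Qed.

Definition hom_comp : cs_hom X Z :=
  CSHom (can_comp (hom_funK h) (hom_funK f))
    (can_comp (hom_invK f) (hom_invK h)) comp_mul comp_rep.

Lemma inv_mul : {morph hom_inv f : u v / (u * v)%g >-> (u * v)%g}.
Proof.
by move=> u v; rewrite -[u in LHS](hom_invK f) -[v in LHS](hom_invK f)
  -hom_mul hom_funK.
Qed.

Lemma inv_rep i : hom_inv f (rep Y i) = rep X i.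
Proof. by rewrite -(hom_rep f) hom_funK. Qed.

Definition hom_opp : cs_hom Y X :=
  CSHom (hom_invK f) (hom_funK f) inv_mul inv_rep.

End HomOps.

(* In a polygon domain [P] of [X], with consecutive sides j and j+1, the arc  *)
(* i lying on side [k] (one of these two sides) is replaced by the diagonal.  *)
(* The case [k = j] is reattaching the triangle along the partner of side j,  *)
(* and [k = j'] along the partner of side j+1.                                *)
Definition cs_move (X Y : cs_object) : Prop :=
  exists (P : polygon_domain) (j j' k : sides) (i : 'I_(2 * g)),
    [/\ has_polygon (rep X) P,
        (0 < j)%N /\ j' = j.+1 :> nat,
        k = j \/ k = j',
        arc_side P i = k \/ arc_side P i = pd_pairing P k &
        CG_equiv (fun m => if m == i then (side P j * side P j')%g
                           else rep X m) (rep Y)].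

Inductive cs_generated : forall X Y : cs_object, cs_hom X Y -> Prop :=
| cs_gen_id X : cs_generated (hom_id X)
| cs_gen_move X Y (f : cs_hom X Y) : cs_move X Y -> cs_generated f
| cs_gen_inv X Y (f : cs_hom X Y) : cs_move X Y -> cs_generated (hom_opp f)
| cs_gen_comp X Y Z (f : cs_hom X Y) (h : cs_hom Y Z) :
    cs_generated f -> cs_generated h -> cs_generated (hom_comp f h).

End ChordSlides.

(* Main.v *)
(* Fix the polygon of Y. Each of its sides is crossed by a band dual to its arc,
   and counting crossings (a non-abelian cocycle) gives the universal property
   making pi free on the arcs; hence morphisms between any two objects exist and
   are unique, and it suffices to connect the objects by moves.
   Write the sides c_1, ..., c_4g of another polygon as reduced words in the arcs
   of Y. Their product is the inverse of the boundary loop, a word of length at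
   most 4g, and a CS move at the corner between two consecutive sides replaces
   one of the two by their product. As in Nielsen reduction, whenever such a
   product is shorter than a factor, or a factor cancels to exactly half its
   length on both ends, some move decreases the total length or, at equal
   length, a lexicographic weight. When no move does, every side keeps exactly
   one uncancelled letter; since the corners of the polygon form a single cycle
   around the basepoint, nothing cancels at all, so the sides are the letters of
   the boundary word, in order, and the two objects agree.
   The corners form a single cycle because a further cycle would give a nonzero
   class in H^1(S; F_2) whose intersection with every class vanishes, whereas the
   standard polygon shows that the intersection form is nondegenerate; the form is
   read off by mapping the boundary word to the Heisenberg group over F_2.
   Geometrically, a move keeps the polygon with the triangle removed and glues
   the triangle by an affine map to a new one erected on the partner side. *)

From HB Require Import structures.
Require Import Defs.
From mathcomp Require Import all_boot all_order all_algebra.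
From mathcomp Require Import all_classical all_reals all_analysis.
From mathcomp Require Import perm ring lra zify.

Set Implicit Arguments.
Unset Strict Implicit.
Unset Printing Implicit Defensive.

Import Order.TTheory GRing.Theory Num.Theory.
Import numFieldNormedType.Exports.

Local Open Scope classical_set_scope.
Local Open Scope ring_scope.

(** The fundamental group here consists of homotopy classes of loops in a Hausdorff quotient of a
    polygon, so its freeness has to be earned. A cocycle with values in the self-maps of a mere set
    replaces covering spaces and van Kampen's theorem: it yields homomorphisms with prescribed
    values on the sides and, with reduced words as the set, normal forms. The main obstacle is that
    a polygon domain identifies all its vertices outright. Its definition does not prevent the
    corners from falling into several cycles under the side pairing, as for a surface with points
    pinched together; this is excluded by comparison with the standard polygon, using that the sides
    generate. The single cycle is used twice: at the end of the reduction, and to see that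
    consecutive sides are never partners, since then the triangle could not be reattached. The final
    count balances exactly: each of the 4g sides keeps at least one letter, and the boundary word of
    the target polygon has only 4g letters to offer. *)

(** * Continuous induction and lifts along paths *)

(** Compactness of the unit interval as an induction principle: the supremum of the points reachable
    from 0 can be passed, because [Q] holds on all small intervals that contain it. Existence and
    uniqueness of lifts and invariance under homotopy all follow this pattern. *)
Lemma cousin (R : realType) (Q : R -> R -> Prop) :
    (forall a b c, a <= b -> b <= c -> Q a b -> Q b c -> Q a c) ->
    (forall t, 0 <= t <= 1 -> exists2 e : R, 0 < e & forall a b,
      0 <= a -> a <= t -> t <= b -> b <= 1 -> t - e < a -> b < t + e -> Q a b) ->
  Q 0 1.
Proof.
move=> Qtrans Qloc.
pose A := [set b : R | 0 <= b <= 1 /\ Q 0 b].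
have A0 : A 0.
  split; first by rewrite lexx ler01.
  have [|e e0 He] := Qloc 0; first by rewrite lexx ler01.
  by apply: He => //; lra.
have supA : has_sup A.
  by split; [exists 0|exists 1 => x [] /andP[]].
have c0 : 0 <= sup A by apply: sup_upper_bound.
have c1 : sup A <= 1 by apply: ge_sup; [exists 0|move=> x [] /andP[]].
have [|e e0 He] := Qloc (sup A); first by rewrite c0 c1.
have [a [/andP[a0 a1] Qa] ca] := sup_adherent e0 supA.
have ac : a <= sup A by apply: sup_upper_bound => //; split=> //; rewrite a0 a1.
have [e1|e1] := ltP 1 (sup A + e).
  by apply: Qtrans Qa _ => //; apply: He.
suff : A (sup A + e / 2) by move=> /(sup_upper_bound supA); lra.
split; first by apply/andP; split; lra.
by apply: Qtrans Qa _ => //; [lra|apply: He; lra].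
Qed.

Lemma within_unit_continuous (R : realType) (S : topologicalType) (f : R -> S) (t : R)
    (U : set S) :
    {within `[0, 1], continuous f} -> 0 <= t <= 1 -> nbhs (f t) U ->
  exists2 e : R, 0 < e & forall t', 0 <= t' <= 1 -> `|t' - t| < e -> U (f t').
Proof.
move=> /subspace_continuousP cf t01 Ut.
have /= := cf t _ U Ut; rewrite in_itv /= => /(_ t01).
move=> /nbhs_ballP[e /= e0 He]; exists e => // t' t'01 tt'.
apply: He; last by rewrite in_itv.
by rewrite /ball /= distrC.
Qed.

Lemma within_square_continuous (R : realType) (S : topologicalType)
    (H : R * R -> S) (s t : R) (U : set S) :
    {within `[0, 1] `*` `[0, 1], continuous H} -> 0 <= s <= 1 -> 0 <= t <= 1 ->
    nbhs (H (s, t)) U ->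
  exists2 e : R, 0 < e & forall s' t', 0 <= s' <= 1 -> 0 <= t' <= 1 ->
    `|s' - s| < e -> `|t' - t| < e -> U (H (s', t')).
Proof.
move=> /subspace_continuousP cf s01 t01 Ut.
have /= := cf (s, t) _ U Ut; rewrite /= !in_itv /= => /(_ (conj s01 t01)).
move=> /nbhs_ballP[e /= e0 He]; exists e => // s' t' s'01 t'01 ss' tt'.
apply: He; last by rewrite /= !in_itv.
by split; rewrite /ball /= distrC.
Qed.

(* [tr] is a non-abelian Alexander-Spanier 1-cocycle with values in the self-maps
   of [T], required to be multiplicative only on small sets; no continuity is
   needed. A loop acts on [T] by the total transition of a lift. *)
Section Monodromy.
Context {R : realType} {S : topologicalType} {T : Type} (p : S).
Variable tr : S -> S -> T -> T.

Definition cocycle_on (U : set S) : Prop :=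
  forall a b c r, U a -> U b -> U c -> tr b c (tr a b r) = tr a c r.

Hypothesis tr_id : forall a r, tr a a r = r.
Hypothesis tr_loc : forall x : S, exists2 U, nbhs x U & cocycle_on U.

(** Near each time [t] the values are compared with the value at [t] alone; two other nearby times
    are related through the cocycle identity. *)
Definition is_lift (f : R -> S) (a b : R) (l : R -> T) : Prop :=
  forall t, a <= t <= b -> exists2 e : R, 0 < e & forall t', a <= t' <= b ->
    `|t' - t| < e -> l t' = tr (f t) (f t') (l t).

Let local_cocycle (f : R -> S) (t : R) :
    {within `[0, 1], continuous f} -> 0 <= t <= 1 ->
  exists2 U, cocycle_on U & exists2 e : R, 0 < e &
    forall t', 0 <= t' <= 1 -> `|t' - t| < e -> U (f t').
Proof.
move=> cf t01; have [U Ut cU] := tr_loc (f t); exists U => //.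
exact: within_unit_continuous.
Qed.

Lemma lift_unique (f : R -> S) (l l' : R -> T) :
    {within `[0, 1], continuous f} -> is_lift f 0 1 l -> is_lift f 0 1 l' ->
  l 0 = l' 0 -> l 1 = l' 1.
Proof.
move=> cf lf l'f; apply: (@cousin R (fun a b => l a = l' a -> l b = l' b)).
  by move=> a b c _ _ h1 h2 /h1 /h2.
move=> t t01; have [U cU [e e0 He]] := local_cocycle cf t01.
have [e1 e10 He1] := lf t t01; have [e2 e20 He2] := l'f t t01.
exists (Num.min e (Num.min e1 e2)); first by rewrite !lt_min e0 e10 e20.
move=> a b a0 at' tb b1 ea eb ll'.
have close x : a <= x -> x <= b ->
    [/\ 0 <= x <= 1, `|x - t| < e, `|x - t| < e1 & `|x - t| < e2].
  move=> ax xb; have : `|x - t| < Num.min e (Num.min e1 e2).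
    by rewrite ltr_norml; apply/andP; split; lra.
  by rewrite !lt_min => /and3P[-> -> ->]; split=> //; lra.
have [a01 ae ae1 ae2] : [/\ 0 <= a <= 1, `|a - t| < e, `|a - t| < e1 & `|a - t| < e2].
  by apply: close; lra.
have [b01 be be1 be2] : [/\ 0 <= b <= 1, `|b - t| < e, `|b - t| < e1 & `|b - t| < e2].
  by apply: close; lra.
have tt : `|t - t| < e by rewrite subrr normr0.
rewrite (He1 _ b01 be1) (He2 _ b01 be2); congr tr.
(* The cocycle identity makes the transition from [f a] to [f t] undo the one from [f t] to [f a],
   so agreement at [a] passes to the centre [t] and from there to [b]. *)
have key g eg (Hg : forall t', 0 <= t' <= 1 -> `|t' - t| < eg ->
    g t' = tr (f t) (f t') (g t)) : `|a - t| < eg -> g t = tr (f a) (f t) (g a).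
  by move=> aeg; rewrite (Hg _ a01 aeg) cU ?tr_id//; apply: He.
by rewrite (key _ _ He1 ae1) (key _ _ He2 ae2) ll'.
Qed.

Lemma lift_exists (f : R -> S) (r : T) : {within `[0, 1], continuous f} ->
  exists2 l, is_lift f 0 1 l & l 0 = r.
Proof.
move=> cf; move: r.
suff : 0 <= (0 : R) -> (1 : R) <= 1 -> forall r, exists2 l, is_lift f 0 1 l & l 0 = r.
  exact.
apply: (@cousin R (fun a b => 0 <= a -> b <= 1 -> forall r,
  exists2 l, is_lift f a b l & l a = r)).
  move=> a b c ab bc h1 h2 a0 c1 r.
  have [l1 l1f l1r] := h1 a0 (le_trans bc c1) r.
  have [l2 l2f l2r] := h2 (le_trans a0 ab) c1 (l1 b).
  exists (fun t => if t <= b then l1 t else l2 t); last by rewrite ab.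
  move=> t /andP[at' tc]; case: (ltgtP t b) => tb.
  - have [|e e0 He] := l1f t; first by rewrite at' ltW.
    exists (Num.min e (b - t)); first by rewrite lt_min e0 subr_gt0.
    move=> t' /andP[at'' t'c]; rewrite lt_min => /andP[t'e t'b].
    have t'b' : t' <= b by move: t'b; rewrite ltr_norml => /andP[]; lra.
    by rewrite t'b'; apply: He => //; rewrite at'' t'b'.
  - have [|e e0 He] := l2f t; first by rewrite tc ltW.
    exists (Num.min e (t - b)); first by rewrite lt_min e0 subr_gt0.
    move=> t' /andP[at'' t'c]; rewrite lt_min => /andP[t'e t'b].
    have t'b' : b < t' by move: t'b; rewrite ltr_norml => /andP[]; lra.
    by rewrite leNgt t'b' /=; apply: He => //; rewrite ltW.
  - have [|e1 e10 He1] := l1f b; first by rewrite ab lexx.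
    have [|e2 e20 He2] := l2f b; first by rewrite bc lexx.
    exists (Num.min e1 e2); first by rewrite lt_min e10.
    move=> t' /andP[at'' t'c]; rewrite lt_min tb => /andP[t'e t'b].
    case: ifPn => t'b'; first by apply: He1 => //; rewrite at''.
    rewrite -l2r; apply: He2 => //; rewrite t'c andbT; apply: ltW.
    by rewrite ltNge.
(* Locally, the transition from the left endpoint is itself a lift. *)
move=> t t01; have [U cU [e e0 He]] := local_cocycle cf t01.
exists e => // a b a0 at' tb b1 ea eb _ _ r.
exists (fun t' => tr (f a) (f t') r); last by rewrite tr_id.
have close x : a <= x -> x <= b -> U (f x).
  by move=> ax xb; apply: He; [lra|rewrite ltr_norml; apply/andP; split; lra].
move=> t1 /andP[at1 t1b]; exists 1 => // t2 /andP[at2 t2b] _.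
by rewrite cU //; apply: close => //; lra.
Qed.

(** Between two nearby rows of the homotopy the vertical transitions carry a lift of one row to a
    lift of the other, and they are trivial at both ends, where [H] stays at [p]. *)
Lemma lift_homotopy (H : R * R -> S) r r' :
    {within `[0, 1] `*` `[0, 1], continuous H} ->
    (forall s, 0 <= s <= 1 -> H (s, 0) = p /\ H (s, 1) = p) ->
    (exists l, [/\ is_lift (fun t => H (0, t)) 0 1 l, l 0 = r & l 1 = r']) ->
  exists l, [/\ is_lift (fun t => H (1, t)) 0 1 l, l 0 = r & l 1 = r'].
Proof.
move=> cH Hp.
apply: (@cousin R (fun s s' =>
  (exists l, [/\ is_lift (fun t => H (s, t)) 0 1 l, l 0 = r & l 1 = r']) ->
  exists l, [/\ is_lift (fun t => H (s', t)) 0 1 l, l 0 = r & l 1 = r'])).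
  by move=> a b c _ _ h1 h2 /h1 /h2.
move=> s0 s01.
(* A tube argument, by the same induction in the other variable: one width [d] in the first
   coordinate serves for all [t]. *)
have [d d0 Hd] : exists2 d : R, 0 < d & forall t, 0 <= t <= 1 ->
    exists2 U, cocycle_on U & exists2 e : R, 0 < e & forall s' t',
      0 <= s' <= 1 -> 0 <= t' <= 1 -> `|s' - s0| < d -> `|t' - t| < e ->
      U (H (s', t')).
  apply: (@cousin R (fun a b => exists2 d : R, 0 < d & forall t, a <= t <= b ->
    exists2 U, cocycle_on U & exists2 e : R, 0 < e & forall s' t',
      0 <= s' <= 1 -> 0 <= t' <= 1 -> `|s' - s0| < d -> `|t' - t| < e ->
      U (H (s', t')))).
    move=> a b c ab bc [d1 d10 h1] [d2 d20 h2].
    exists (Num.min d1 d2); first by rewrite lt_min d10.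
    move=> t /andP[at' tc]; have [tb|bt] := leP t b.
      have [|U cU [e e0 He]] := h1 t; first by rewrite at'.
      exists U => //; exists e => // s' t' s'01 t'01.
      by rewrite lt_min => /andP[s1 _]; apply: He.
    have [|U cU [e e0 He]] := h2 t; first by rewrite tc ltW.
    exists U => //; exists e => // s' t' s'01 t'01.
    by rewrite lt_min => /andP[_ s1]; apply: He.
  move=> t t01; have [U Ut cU] := tr_loc (H (s0, t)).
  have [e e0 He] := within_square_continuous cH s01 t01 Ut.
  exists e => // a b a0 at' tb b1 ea eb; exists e => // t1 /andP[at1 t1b].
  exists U => //; exists (e - `|t1 - t|).
    by rewrite subr_gt0 ltr_norml; apply/andP; split; lra.
  move=> s' t' s'01 t'01 s'e t'e; apply: He => //.
  have := ler_distD t1 t' t; lra.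
exists d => // a b a0 as0 s0b b1 ea eb [l [lf l0 l1]].
have a01 : 0 <= a <= 1 by lra.
have b01 : 0 <= b <= 1 by lra.
have ad : `|a - s0| < d by rewrite ltr_norml; apply/andP; split; lra.
have bd : `|b - s0| < d by rewrite ltr_norml; apply/andP; split; lra.
exists (fun t => tr (H (a, t)) (H (b, t)) (l t)); split.
- move=> t t01; have [U cU [e e0 He]] := Hd t t01.
  have [e1 e10 He1] := lf t t01.
  exists (Num.min e e1); first by rewrite lt_min e0.
  move=> t' t'01; rewrite lt_min => /andP[t'e t'e1].
  have tt : `|t - t| < e by rewrite subrr normr0.
  by rewrite (He1 _ t'01 t'e1) !cU //; apply: He.
- by have [-> _] := Hp _ a01; have [-> _] := Hp _ b01; rewrite tr_id.
- by have [_ ->] := Hp _ a01; have [_ ->] := Hp _ b01; rewrite tr_id.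
Qed.

Let transport_exists (f : loop (R := R) p) r : exists r', exists l,
  [/\ is_lift f 0 1 l, l 0 = r & l 1 = r'].
Proof.
have [l lf l0] := lift_exists r (@loop_continuous _ _ _ f).
by exists (l 1), l.
Qed.

Definition transport (f : loop (R := R) p) (r : T) : T :=
  projT1 (cid (transport_exists f r)).

Lemma transportP (f : loop (R := R) p) l :
  is_lift f 0 1 l -> transport f (l 0) = l 1.
Proof.
move=> lf; rewrite /transport; case: cid => r' /= [l' [l'f l'0 <-]].
exact: lift_unique (@loop_continuous _ _ _ f) l'f lf l'0.
Qed.

Lemma transport_homotopic (f f' : loop (R := R) p) r :
  homotopic f f' -> transport f r = transport f' r.
Proof.
move=> [H [cH Hff']].
have ext (g g' : R -> S) l : (forall t, 0 <= t <= 1 -> g t = g' t) ->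
    is_lift g 0 1 l -> is_lift g' 0 1 l.
  move=> gg' lg t t01; have [e e0 He] := lg t t01; exists e => // t' t'01 tt'.
  by rewrite -!gg' //; apply: He.
have Hff t : 0 <= t <= 1 ->
    [/\ H (0, t) = f t, H (1, t) = f' t, H (t, 0) = p & H (t, 1) = p].
  by move=> t01; apply: Hff'; rewrite in_itv.
rewrite {1}/transport; case: cid => r' /= [l [lf l0 l1]].
have [s s01||l' [l'f <- <-]] := @lift_homotopy H r r' cH.
- by have [] := Hff s s01.
- by exists l; split=> //; apply: ext lf => t t01; have [] := Hff t t01.
- apply/esym/transportP; apply: ext l'f => t t01; by have [] := Hff t t01.
Qed.

Lemma transport_constant r : transport (constant_loop p) r = r.
Proof.
by apply: (@transportP _ (fun=> r)) => t t01; exists 1 => // t1 _ _; rewrite /= tr_id.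
Qed.

Lemma transport_concat (f f' : loop (R := R) p) r :
  transport (concat f f') r = transport f' (transport f r).
Proof.
have [l lf l0] := lift_exists r (@loop_continuous _ _ _ f).
have [l' l'f l'0] := lift_exists (l 1) (@loop_continuous _ _ _ f').
rewrite -{2}l0 (transportP lf) -l'0 (transportP l'f).
pose L t := if t <= 2^-1 then l (2 * t) else l' (2 * t - 1).
have <- : L 0 = r by rewrite /L invr_ge0 ler0n mulr0 l0.
have <- : L 1 = l' 1.
  by rewrite /L ifF; [congr l'; lra|apply/negbTE; rewrite -ltNge; lra].
apply: transportP => t /andP[t0 t1]; rewrite /L; case: (ltgtP t 2^-1) => tb.
- have [|e e0 He] := lf (2 * t); first by lra.
  exists (Num.min (e / 2) (2^-1 - t)); first by rewrite lt_min subr_gt0 tb divr_gt0.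
  move=> t' /andP[t'0 t'1]; rewrite lt_min !ltr_norml => /andP[/andP[t'e1 t'e2] /andP[_ t'b]].
  have t'b' : t' <= 2^-1 by lra.
  rewrite /= t'b' (ltW tb).
  by apply: He => //; [lra|rewrite ltr_norml; apply/andP; split; lra].
- have [|e e0 He] := l'f (2 * t - 1); first by lra.
  exists (Num.min (e / 2) (t - 2^-1)); first by rewrite lt_min subr_gt0 tb divr_gt0.
  move=> t' /andP[t'0 t'1]; rewrite lt_min !ltr_norml => /andP[/andP[t'e1 t'e2] /andP[t'b _]].
  have t'b' : (t' <= 2^-1) = false by apply/negbTE; rewrite -ltNge; lra.
  have tb' : (t <= 2^-1) = false by apply/negbTE; rewrite -ltNge; lra.
  rewrite /= t'b' tb'.
  by apply: He => //; [lra|rewrite ltr_norml; apply/andP; split; lra].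
- have [|e1 e10 He1] := lf 1; first by lra.
  have [|e2 e20 He2] := l'f 0; first by lra.
  exists (Num.min (e1 / 2) (e2 / 2)); first by rewrite lt_min !divr_gt0.
  move=> t' /andP[t'0 t'1]; rewrite lt_min !ltr_norml => /andP[/andP[t'e1 t'e2] /andP[t'b1 t'b2]].
  have e1' : 2 * t = 1 by lra.
  rewrite /= (_ : t <= 2^-1); last by rewrite tb.
  rewrite e1'; case: ifPn => t'b'.
    by apply: He1; [lra|rewrite ltr_norml; apply/andP; split; lra].
  have -> : f 1 = f' 0 by rewrite loop_end loop_start.
  rewrite -l'0; move: t'b'; rewrite -ltNge => t'b'.
  by apply: He2; [lra|rewrite ltr_norml; apply/andP; split; lra].
Qed.

(** Concatenation reads from left to right, so this is a right action. The last clause carries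
    symmetries of the transitions over to the action; applied to right multiplications of a monoid
    it will show that the action is by left multiplication. *)
Lemma monodromy : exists act : pi1 (R := R) p -> T -> T,
  [/\ forall r, act 1%g r = r,
      forall (u v : pi1 (R := R) p) r, act (u * v)%g r = act v (act u r),
      forall (f : loop (R := R) p) l, is_lift f 0 1 l ->
        act (pi1_class f) (l 0) = l 1 &
      forall h : T -> T, (forall x y r, h (tr x y r) = tr x y (h r)) ->
        forall u r, act u (h r) = h (act u r)].
Proof.
pose act (u : pi1 (R := R) p) r := transport (repr u) r.
have actE f r : act (pi1_class f) r = transport f r.
  by apply: transport_homotopic; apply/pi1_classP; rewrite /pi1_class reprK.
exists act; split.
- by move=> r; rewrite -[1%g]/(pi1_class _) actE transport_constant.
- apply: (@pi1_ind R S p) => f; apply: (@pi1_ind R S p) => f' r.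
  by rewrite -[(_ * _)%g]/(pi1_mul _ _) pi1_mulE !actE transport_concat.
- by move=> f l lf; rewrite actE; exact: transportP.
- move=> h hC; apply: (@pi1_ind R S p) => f r; rewrite !actE.
  have [l lf <-] := lift_exists r (@loop_continuous _ _ _ f).
  rewrite (transportP lf).
  apply: (@transportP _ (h \o l)) => t t01; have [e e0 He] := lf t t01.
  by exists e => // t' t'01 tt'; rewrite /= (He _ t'01 tt') hC.
Qed.

End Monodromy.

(** * Orientation, triangles and strictly convex polygons *)

Section Plane.
Context {R : realType}.
Implicit Types a b c d q z : R * R.

Lemma orient_rot a b c : orient a b c = orient b c a.
Proof. by rewrite /orient; ring. Qed.

Lemma orient_swap a b c : orient b a c = - orient a b c.
Proof. by rewrite /orient; ring. Qed.

Lemma orient_aba a b : orient a b a = 0.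
Proof. by rewrite /orient; ring. Qed.

Lemma orient_abb a b : orient a b b = 0.
Proof. by rewrite /orient; ring. Qed.

Definition seg_pt a b (t : R) : R * R :=
  ((1 - t) * a.1 + t * b.1, (1 - t) * a.2 + t * b.2).

Lemma seg_pt0 a b : seg_pt a b 0 = a.
Proof. by rewrite /seg_pt subr0 !mul1r !mul0r !addr0; case: a. Qed.

Lemma seg_pt1 a b : seg_pt a b 1 = b.
Proof. by rewrite /seg_pt subrr !mul1r !mul0r !add0r; case: b. Qed.

Lemma seg_ptC a b t : seg_pt a b (1 - t) = seg_pt b a t.
Proof. by rewrite /seg_pt; congr pair; ring. Qed.

Lemma orient_seg a b c d t :
  orient a b (seg_pt c d t) = (1 - t) * orient a b c + t * orient a b d.
Proof. by rewrite /orient /seg_pt /=; ring. Qed.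

Lemma continuous_orient a b : continuous (orient a b : R * R -> R).
Proof.
move=> z; rewrite /orient; apply: cvgB; apply: cvgM; try exact: cvg_cst.
  by apply: cvgB; [exact: cvg_snd|exact: cvg_cst].
by apply: cvgB; [exact: cvg_fst|exact: cvg_cst].
Qed.

Lemma continuous_seg_pt a b : continuous (seg_pt a b).
Proof.
apply: continuous_pairing => x; apply: cvgD; apply: cvgM;
  try exact: cvg_cst; try exact: cvg_id;
  by apply: cvgB; [exact: cvg_cst|exact: cvg_id].
Qed.

(* The affine map taking the triangle [a b c] to [a' b' c'], in barycentric
   coordinates. *)
Definition triangle_map a b c a' b' c' z : R * R :=
  ((orient b c z * a'.1 + orient c a z * b'.1 + orient a b z * c'.1) / orient a b c,
   (orient b c z * a'.2 + orient c a z * b'.2 + orient a b z * c'.2) / orient a b c).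

Lemma continuous_triangle_map a b c a' b' c' :
  continuous (triangle_map a b c a' b' c').
Proof.
by apply: continuous_pairing => x; apply: cvgM; try exact: cvg_cst;
  (apply: cvgD; first apply: cvgD); apply: cvgM; try exact: cvg_cst;
  exact: continuous_orient.
Qed.

Lemma orient_triangle_map a b c a' b' c' x y z : orient a b c != 0 ->
  orient x y (triangle_map a b c a' b' c' z) * orient a b c =
  orient b c z * orient x y a' + orient c a z * orient x y b' +
  orient a b z * orient x y c'.
Proof.
move=> abc0; rewrite {1}/orient /=.
suff key (u v p : R) : (u * (p / orient a b c - v)) * orient a b c =
    u * (p - v * orient a b c).
  by rewrite mulrBl !key /orient; ring.
by field.
Qed.

Lemma triangle_map_seg a b c a' b' c' t : orient a b c != 0 ->
  [/\ triangle_map a b c a' b' c' (seg_pt a b t) = seg_pt a' b' t,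
      triangle_map a b c a' b' c' (seg_pt b c t) = seg_pt b' c' t &
      triangle_map a b c a' b' c' (seg_pt c a t) = seg_pt c' a' t].
Proof.
move=> abc0; rewrite /triangle_map !orient_seg !orient_aba !orient_abb.
rewrite -[orient c a b]orient_rot -![orient b c a]orient_rot.
by split; rewrite /seg_pt; congr pair; field.
Qed.

Lemma triangle_mapK a b c a' b' c' : orient a b c != 0 -> orient a' b' c' != 0 ->
  cancel (triangle_map a b c a' b' c') (triangle_map a' b' c' a b c).
Proof.
move=> abc0 abc0' z.
have E x y : orient x y (triangle_map a b c a' b' c' z) =
  (orient b c z * orient x y a' + orient c a z * orient x y b' +
  orient a b z * orient x y c') / orient a b c.
  by rewrite -orient_triangle_map // mulfK.
rewrite {1}/triangle_map !E !orient_aba !orient_abb.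
rewrite -[orient c' a' b']orient_rot -[orient b' c' a']orient_rot.
rewrite [RHS]surjective_pairing; congr pair.
  transitivity ((orient b c z * a.1 + orient c a z * b.1 + orient a b z * c.1) / orient a b c).
    by field; rewrite abc0 abc0'.
  by apply: (mulIf abc0); rewrite mulfVK // /orient; ring.
transitivity ((orient b c z * a.2 + orient c a z * b.2 + orient a b z * c.2) / orient a b c).
  by field; rewrite abc0 abc0'.
by apply: (mulIf abc0); rewrite mulfVK // /orient; ring.
Qed.

Section Clockwise.
Variables (n : nat) (v : 'I_n -> R * R).
Hypothesis cv : clockwise v.

Lemma clockwise_out (i j x : 'I_n) : (i < j)%N -> (x < i)%N || (j < x)%N ->
  orient (v i) (v j) (v x) < 0.
Proof.
move=> ij /orP[xi|jx]; last exact: cv.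
by rewrite -orient_rot; exact: cv.
Qed.

Lemma clockwise_in (i j x : 'I_n) : (i < x)%N -> (x < j)%N ->
  0 < orient (v i) (v j) (v x).
Proof.
by move=> ix xj; rewrite -orient_rot orient_swap oppr_gt0; apply: cv.
Qed.

Lemma ordS_cases (k : 'I_n) :
  (ordS k = k.+1 :> nat /\ (k.+1 < n)%N) \/ (ordS k = 0%N :> nat /\ k.+1 = n).
Proof.
have [kn|nk] := ltnP k.+1 n; first by left; rewrite /= modn_small.
by right; have kE : k.+1 = n; [apply/eqP; rewrite eqn_leq nk ltn_ord|rewrite /= kE modnn].
Qed.

Lemma clockwise_side (k i : 'I_n) : i != k -> i != ordS k ->
  orient (v k) (v (ordS k)) (v i) < 0.
Proof.
rewrite -!val_eqE /=; have := ltn_ord i.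
have [[kE kn]|[kE kn]] := ordS_cases k; rewrite /= in kE => ltin ik iSk.
  by apply: clockwise_out; rewrite /= kE in iSk *; lia.
by rewrite orient_rot; apply: cv; rewrite /= kE in iSk *; lia.
Qed.

Lemma ordS_neq (k : 'I_n) : (1 < n)%N -> ordS k != k.
Proof.
move=> n1; rewrite -val_eqE /=.
by have [[+ _]|[+ kn]] := ordS_cases k; rewrite /= => ->; lia.
Qed.

Lemma ordS2_neq (k : 'I_n) : (2 < n)%N -> ordS (ordS k) != k.
Proof.
move=> n2; rewrite -val_eqE /=.
by have [[+ kn]|[+ kn]] := ordS_cases (ordS k);
  have [[E _]|[E kn']] := ordS_cases k; rewrite /= in E kn *; rewrite !E in kn * => ->; lia.
Qed.

Lemma side_ptE k t : side_pt v k t = seg_pt (v k) (v (ordS k)) t.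
Proof. by []. Qed.

(** Along side [j] the functional of side [i] interpolates between its values at the ends of [j],
    and strict convexity makes these negative except at a common vertex. *)
Lemma side_pt_meet (i j : 'I_n) s t : (2 < n)%N -> i != j -> t \in `[0, 1] ->
  side_pt v i s = side_pt v j t -> t = 0 \/ t = 1.
Proof.
move=> n2 ij; rewrite in_itv /= => /andP[t0 t1] E.
have : orient (v i) (v (ordS i)) (side_pt v j t) = 0.
  by rewrite -E side_ptE orient_seg orient_aba orient_abb !mulr0 addr0.
rewrite side_ptE orient_seg.
have [jSi|jSi] := eqVneq j (ordS i).
  rewrite jSi orient_abb mulr0 add0r => /eqP; rewrite mulf_eq0 => /orP[/eqP->|]; first by left.
  rewrite lt_eqF //; apply: clockwise_side; first exact: ordS2_neq.
  by apply: ordS_neq; lia.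
have lt1 : orient (v i) (v (ordS i)) (v j) < 0 by apply: clockwise_side; rewrite // eq_sym.
have [Sji|Sji] := eqVneq (ordS j) i.
  rewrite Sji orient_aba mulr0 addr0 => /eqP; rewrite mulf_eq0 (lt_eqF lt1) orbF subr_eq0.
  by move=> /eqP <-; right.
have lt2 : orient (v i) (v (ordS i)) (v (ordS j)) < 0.
  apply: clockwise_side => //; apply: contra ij => /eqP /(can_inj (@ordSK _)) ->; exact: eqxx.
by move: lt1 lt2; move: (orient _ _ _) (orient _ _ _) => x y; nra.
Qed.

Lemma vertex_neq (i j : 'I_n) : (2 < n)%N -> i != j -> v i != v j.
Proof.
move=> n2 ij; apply/eqP => E.
have [jSi|jSi] := eqVneq j (ordS i).
  have : orient (v i) (v (ordS i)) (v (ordS (ordS i))) < 0.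
    by apply: clockwise_side; [exact: ordS2_neq|apply: ordS_neq; lia].
  by rewrite -jSi -E /orient !subrr !mul0r subr0 ltxx.
by have := @clockwise_side i j; rewrite eq_sym -E orient_aba ltxx => /(_ ij jSi).
Qed.

Lemma side_pt_vertex (i j : 'I_n) t : (2 < n)%N -> t \in `[0, 1] ->
  side_pt v i t = v j -> t = 0 \/ t = 1.
Proof.
move=> n2 t01 E.
have [ij|ij] := eqVneq j i.
  apply: (@side_pt_meet (ord_pred i) i 1 t) => //; last first.
    by rewrite side_pt1 ord_predK E ij.
  have : ordS (ord_pred i) != ord_pred i by apply: ordS_neq; lia.
  by rewrite ord_predK eq_sym.
by apply: (@side_pt_meet j i 0 t); rewrite // side_pt0.
Qed.

Lemma side_pt_inj (i : 'I_n) s t : (2 < n)%N ->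
  side_pt v i s = side_pt v i t -> s = t.
Proof.
move=> n2; set a := ordS (ordS i).
move=> /(congr1 (fun z => orient (v (ordS i)) (v a) z)).
rewrite !side_ptE !orient_seg !orient_aba !mulr0 !addr0 => E.
suff o0 : orient (v (ordS i)) (v a) (v i) != 0 by move: (mulIf o0 E); lra.
rewrite lt_eqF //; apply: clockwise_side; rewrite eq_sym.
  by apply: ordS_neq; lia.
exact: ordS2_neq.
Qed.

End Clockwise.
End Plane.

(** * Adding a vertex to a convex polygon *)

Section Insertion.
Context {R : realType} (n : nat).
Implicit Types (v : 'I_n -> R * R) (V : 'I_n.+1 -> R * R) (r : 'I_n).

(* The vertices [v] with [q] inserted between [v r] and [v (ordS r)]. *)
Definition insert_vertex r (q : R * R) v (i : 'I_n.+1) : R * R :=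
  if unlift (lift ord0 r) i is Some j then v j else q.

Lemma insert_vertex_lift r q v j : insert_vertex r q v (lift (lift ord0 r) j) = v j.
Proof. by rewrite /insert_vertex liftK. Qed.

Lemma insert_vertex_new r q v : insert_vertex r q v (lift ord0 r) = q.
Proof. by rewrite /insert_vertex unlift_none. Qed.

(** Dropping the vertex after [r] cuts off the triangle at that vertex. In this form the same lemmas
    serve for cutting a triangle off and for gluing one on. *)
Lemma insert_vertexE r V :
  V = insert_vertex r (V (lift ord0 r)) (V \o lift (lift ord0 r)).
Proof.
by apply/funext => i; rewrite /insert_vertex; case: unliftP => [j ->|->].
Qed.

Lemma ordS_lift r j : j != r ->
  ordS (lift (lift ord0 r) j) = lift (lift ord0 r) (ordS j).
Proof.
move=> jr; apply/val_inj => /=; have := ltn_ord r; have := ltn_ord j => ltj ltr.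
have {}jr : (j : nat) != r by [].
rewrite /bump leq0n add1n; case: (ltngtP j.+1 n) => [jn|jn|jn]; last first.
- have jr2 : (r < j)%N by lia.
  by rewrite jr2 add1n jn !modnn ltn0.
- by move: ltj; rewrite leqNgt jn.
rewrite (modn_small jn); case: (ltngtP r j) jr => [rj|rj|->] // _.
  have -> : (r < j.+1)%N by lia.
  by rewrite !add1n modn_small // ltnS.
have -> : (r < j.+1)%N = false by lia.
by rewrite !add0n modn_small // ltnS ltnW.
Qed.

Lemma ordS_lift_self r : ordS (lift (lift ord0 r) r) = lift ord0 r.
Proof.
apply/val_inj => /=; have := ltn_ord r => ltr.
rewrite /bump /= ?leq0n !add1n ltnn add0n modn_small //.
Qed.

Lemma ordS_lift0 r : ordS (lift ord0 r) = lift (lift ord0 r) (ordS r).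
Proof.
apply/val_inj => /=; have := ltn_ord r => ltr.
rewrite /bump /= ?leq0n !add1n.
have [rn|nr] := ltnP r.+1 n; first by rewrite !modn_small // ltnSn.
have -> : r.+1 = n by lia.
by rewrite !modnn leqNgt (leq_ltn_trans _ ltr).
Qed.

Lemma clockwise_remove r V : clockwise V -> clockwise (V \o lift (lift ord0 r)).
Proof.
by move=> cV i j k ij jk; apply: cV; rewrite /= ltnNge leq_bump2 -ltnNge.
Qed.

Lemma side_pt_insert r q v j t : j != r ->
  side_pt (insert_vertex r q v) (lift (lift ord0 r) j) t = side_pt v j t.
Proof. by move=> jr; rewrite !side_ptE ordS_lift // !insert_vertex_lift. Qed.

Lemma side_pt_insert_left r q v t :
  side_pt (insert_vertex r q v) (lift (lift ord0 r) r) t = seg_pt (v r) q t.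
Proof.
by rewrite side_ptE ordS_lift_self insert_vertex_lift insert_vertex_new.
Qed.

Lemma side_pt_insert_right r q v t :
  side_pt (insert_vertex r q v) (lift ord0 r) t = seg_pt q (v (ordS r)) t.
Proof.
by rewrite side_ptE ordS_lift0 insert_vertex_lift insert_vertex_new.
Qed.

Lemma polygon_insertP r q v z : polygon (insert_vertex r q v) z <->
  [/\ forall j, j != r -> orient (v j) (v (ordS j)) z <= 0,
      orient (v r) q z <= 0 & orient q (v (ordS r)) z <= 0].
Proof.
split=> [pz|[h1 h2 h3] k].
  split.
  - move=> j jr; have := pz (lift (lift ord0 r) j).
    by rewrite ordS_lift // !insert_vertex_lift.
  - have := pz (lift (lift ord0 r) r).
    by rewrite ordS_lift_self insert_vertex_lift insert_vertex_new.
  - have := pz (lift ord0 r).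
    by rewrite ordS_lift0 insert_vertex_lift insert_vertex_new.
case: (unliftP (lift ord0 r) k) => [j ->|->].
  have [->|jr] := eqVneq j r.
    by rewrite ordS_lift_self insert_vertex_lift insert_vertex_new.
  by rewrite ordS_lift // !insert_vertex_lift; exact: h1.
by rewrite ordS_lift0 insert_vertex_lift insert_vertex_new.
Qed.

Lemma polygon_of_insert r q v z : polygon (insert_vertex r q v) z ->
  orient (v r) (v (ordS r)) z <= 0 -> polygon v z.
Proof.
by move=> /polygon_insertP[h1 _ _] h j; have [->|] := eqVneq j r; last exact: h1.
Qed.

Section Convex.
Variables (r : 'I_n) (q : R * R) (v : 'I_n -> R * R).
Hypothesis n2 : (2 < n)%N.
Hypothesis cV : clockwise (insert_vertex r q v).

Lemma clockwise_of_insert : clockwise v.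
Proof.
have -> : v = insert_vertex r q v \o lift (lift ord0 r).
  by apply/funext => i; rewrite /= insert_vertex_lift.
exact: clockwise_remove.
Qed.

Lemma insert_new_left j : j != r -> orient (v r) q (v j) < 0.
Proof.
move=> jr; have := clockwise_side cV (i := lift (lift ord0 r) j)
  (k := lift (lift ord0 r) r).
rewrite ordS_lift_self !insert_vertex_lift insert_vertex_new; apply.
  by rewrite (inj_eq lift_inj).
by rewrite eq_sym neq_lift.
Qed.

Lemma insert_new_right j : j != ordS r -> orient q (v (ordS r)) (v j) < 0.
Proof.
move=> jr; have := clockwise_side cV (i := lift (lift ord0 r) j)
  (k := lift ord0 r).
rewrite ordS_lift0 !insert_vertex_lift insert_vertex_new; apply.
  by rewrite eq_sym neq_lift.
by rewrite (inj_eq lift_inj).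
Qed.

Lemma insert_outside : 0 < orient (v r) (v (ordS r)) q.
Proof.
rewrite -orient_rot orient_swap oppr_gt0.
apply: insert_new_left; apply: ordS_neq; lia.
Qed.

Lemma insert_new_other j : j != r -> orient (v j) (v (ordS j)) q < 0.
Proof.
move=> jr; have := clockwise_side cV (i := lift ord0 r) (k := lift (lift ord0 r) j).
by rewrite ordS_lift // !insert_vertex_lift insert_vertex_new; apply; rewrite neq_lift.
Qed.

(* Three affine functionals vanishing at a common vertex are linearly
   dependent. *)
Lemma polygon_insert z : polygon v z -> polygon (insert_vertex r q v) z.
Proof.
move=> pz; apply/polygon_insertP; split=> [j _||]; first exact: pz.
- set p0 := ord_pred r; have p0S : ordS p0 = r by rewrite /p0 ord_predK.
  have p0r : p0 != r by rewrite -p0S eq_sym; apply: ordS_neq; lia.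
  have rS : ordS r != r by apply: ordS_neq; lia.
  have pS : p0 != ordS r by rewrite -p0S eq_sym; exact: ordS2_neq.
  have h1 := insert_new_left rS; have h2 := insert_new_left p0r.
  have h3 := pz p0; have h4 := pz r; rewrite p0S in h3.
  have h5 : orient (v r) (v (ordS r)) (v p0) < 0.
    exact: (clockwise_side clockwise_of_insert).
  have E : orient (v r) q z * orient (v r) (v (ordS r)) (v p0) =
      orient (v r) q (v (ordS r)) * orient (v p0) (v r) z +
      orient (v r) q (v p0) * orient (v r) (v (ordS r)) z.
    by rewrite /orient; ring.
  rewrite leNgt; apply/negP => h6.
  have : orient (v r) q z * orient (v r) (v (ordS r)) (v p0) < 0.
    by rewrite pmulr_rlt0.
  by rewrite E ltNge addr_ge0 // mulr_le0 // ltW.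
- set e := ordS (ordS r); set d := ordS r.
  have eS : e != d by apply: ordS_neq; lia.
  have er : e != r by exact: ordS2_neq.
  have rS : r != d by rewrite eq_sym; apply: ordS_neq; lia.
  have h1 := insert_new_right eS; have h2 := insert_new_right rS.
  have h3 := pz d; have h4 := pz r.
  have h5 : orient (v r) (v d) (v e) < 0.
    exact: (clockwise_side clockwise_of_insert).
  have E : orient q (v d) z * orient (v r) (v d) (v e) =
      orient q (v d) (v e) * orient (v r) (v d) z +
      orient q (v d) (v r) * orient (v d) (v e) z.
    by rewrite /orient; ring.
  rewrite leNgt; apply/negP => h6.
  have : orient q (v d) z * orient (v r) (v d) (v e) < 0.
    by rewrite pmulr_rlt0.
  by rewrite E ltNge addr_ge0 // mulr_le0 // ltW.
Qed.

(** The point [z] is a combination of [v r], [q] and [v (ordS r)] with nonnegative barycentric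
    weights, and the functional of any other side is nonpositive at these three points. *)
Lemma triangle_insert z : 0 <= orient (v r) (v (ordS r)) z ->
  orient (v r) q z <= 0 -> orient q (v (ordS r)) z <= 0 ->
  polygon (insert_vertex r q v) z.
Proof.
move=> h1 h2 h3; apply/polygon_insertP; split=> // j jr.
have rS : ordS r != r by apply: ordS_neq; lia.
have D := insert_new_left rS.
set f := orient (v j) (v (ordS j)).
have fr : f (v r) <= 0 := vertex_polygon r clockwise_of_insert j.
have fd : f (v (ordS r)) <= 0 := vertex_polygon (ordS r) clockwise_of_insert j.
have fq := insert_new_other jr.
have E : f z * orient (v r) q (v (ordS r)) =
    f (v r) * orient q (v (ordS r)) z + f q * - orient (v r) (v (ordS r)) z +
    f (v (ordS r)) * orient (v r) q z.
  by rewrite /f /orient; ring.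
rewrite leNgt; apply/negP => h6.
have : f z * orient (v r) q (v (ordS r)) < 0 by rewrite pmulr_rlt0.
rewrite E ltNge !addr_ge0 // mulr_le0 //; first exact: ltW.
by rewrite oppr_le0.
Qed.

End Convex.

(** The midpoint of side [r] is pushed slightly outwards. Orientations that are nonzero at the
    midpoint keep their sign under a small displacement; the only pair of distinct vertices for
    which it vanishes is the side itself, and there the displacement gives the sign. *)
Lemma insert_exists r v : (2 < n)%N -> clockwise v ->
  exists q, clockwise (insert_vertex r q v).
Proof.
move=> n2 cv; set c := v r; set d := v (ordS r).
pose m : R * R := ((c.1 + d.1) / 2, (c.2 + d.2) / 2).
(* The displacement is along the outward normal, since orientation is negative inside a clockwise
   polygon. *)
pose Q (e : R) : R * R := (m.1 - e * (d.2 - c.2), m.2 + e * (d.1 - c.1)).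
have orQ i j e : orient (v i) (v j) (Q e) =
    (orient (v i) (v j) c + orient (v i) (v j) d) / 2 +
    e * ((v j).1 - (v i).1) * (d.1 - c.1) + e * ((v j).2 - (v i).2) * (d.2 - c.2).
  by rewrite /orient /Q /m /=; field.
have rS : ordS r != r by apply: ordS_neq; lia.
have cd : c != d by rewrite /c /d; apply: vertex_neq => //; rewrite eq_sym.
have nrm : 0 < (d.1 - c.1) * (d.1 - c.1) + (d.2 - c.2) * (d.2 - c.2).
  rewrite -!expr2 lt_neqAle addr_ge0 ?sqr_ge0 // andbT eq_sym.
  rewrite paddr_eq0 ?sqr_ge0 // !sqrf_eq0 !subr_eq0.
  by apply: contra cd => /andP[/eqP h1 /eqP h2]; apply/eqP/injective_projections.
have orcd e : orient c d (Q e) = e * ((d.1 - c.1) * (d.1 - c.1) + (d.2 - c.2) * (d.2 - c.2)).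
  by rewrite orQ orient_aba orient_abb; ring.
pose o i j := (orient (v i) (v j) c + orient (v i) (v j) d) / 2.
have [e e0 He] : exists2 e : R, 0 < e & forall i j : 'I_n,
    (o i j < 0 -> orient (v i) (v j) (Q e) < 0) /\
    (0 < o i j -> 0 < orient (v i) (v j) (Q e)).
  have H : \forall e \near (0 : R)^'+, forall i, forall j : 'I_n,
      (o i j < 0 -> orient (v i) (v j) (Q e) < 0) /\
      (0 < o i j -> 0 < orient (v i) (v j) (Q e)).
    apply: filter_forall => i; apply: filter_forall => j.
    have cQ : (fun e => orient (v i) (v j) (Q e)) e @[e --> (0 : R)^'+] --> o i j.
      have -> : o i j = orient (v i) (v j) (Q 0) by rewrite orQ /o; ring.
      apply: cvg_at_right_filter; apply: continuous_comp; last exact: continuous_orient.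
      apply: continuous_pairing => x.
        by apply: cvgB; [exact: cvg_cst|apply: cvgM; [exact: cvg_id|exact: cvg_cst]].
      by apply: cvgD; [exact: cvg_cst|apply: cvgM; [exact: cvg_id|exact: cvg_cst]].
    apply: filterI.
      have [ltx|lex] := ltP (o i j) 0; last by apply: nearW => e _ h; exfalso; move: (o i j) lex h => x; lra.
      by apply: filterS (cvgr_lt _ cQ _ ltx) => e.
    have [ltx|lex] := ltP 0 (o i j); last by apply: nearW => e _ h; exfalso; move: (o i j) lex h => x; lra.
    by apply: filterS (cvgr_gt _ cQ _ ltx) => e.
  near (0 : R)^'+ => e; exists e; first by near: e; exact: nbhs_right_gt.
  by near: e.
exists (Q e).
have Srv := ordS_cases r.
have out_lt (i j : 'I_n) : (i < j)%N -> (j <= r)%N || (r < i)%N ->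
    orient (v i) (v j) (Q e) < 0.
  move=> ij out.
  have [/andP[/eqP iS /eqP jr]|nS] := boolP ((i == ordS r) && (j == r)).
    rewrite iS jr -/c -/d orient_swap orcd oppr_lt0 mulr_gt0 //.
  have out_le (x : 'I_n) : (x <= i)%N || (j <= x)%N -> orient (v i) (v j) (v x) <= 0.
    move=> h; have [->|xi] := eqVneq x i; first by rewrite orient_aba.
    have [->|xj] := eqVneq x j; first by rewrite orient_abb.
    apply/ltW/clockwise_out => //; move: h xi xj; rewrite -!val_eqE /=; lia.
  have out_l (x : 'I_n) : (x < i)%N || (j < x)%N -> orient (v i) (v j) (v x) < 0.
    exact: clockwise_out.
  apply: (He i j).1; rewrite /o ltr_pdivrMr // mul0r.
  have rout : (r <= i)%N || (j <= r)%N by lia.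
  have Srout : (ordS r <= i)%N || (j <= ordS r)%N.
    by case: Srv => -[+ ?]; rewrite /= => ->; lia.
  have [r1|r1] := boolP ((r < i)%N || (j < r)%N).
    by have := out_l r r1; have := out_le _ Srout; rewrite /c /d; lra.
  have : (ordS r < i)%N || (j < ordS r)%N.
    move: nS; rewrite -!val_eqE /=.
    by case: Srv => -[+ ?]; rewrite /= => ->; lia.
  by move=> /out_l; have := out_le _ rout; rewrite /c /d; lra.
have in_gt (i j : 'I_n) : (i <= r)%N -> (r < j)%N -> 0 < orient (v i) (v j) (Q e).
  move=> ir rj; have [SE _] : ordS r = r.+1 :> nat /\ (r.+1 < n)%N.
    by case: Srv => // -[_ E]; have := ltn_ord j; lia.
  rewrite /= in SE.
  have [/andP[/eqP iE /eqP jE]|nS] := boolP ((i == r) && (j == ordS r)).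
    by rewrite iE jE -/c -/d orcd mulr_gt0.
  have in_ge (x : 'I_n) : (i <= x)%N -> (x <= j)%N -> 0 <= orient (v i) (v j) (v x).
    move=> h h'; have [->|xi] := eqVneq x i; first by rewrite orient_aba.
    have [->|xj] := eqVneq x j; first by rewrite orient_abb.
    apply/ltW/clockwise_in => //; move: h h' xi xj; rewrite -!val_eqE /=; lia.
  apply: (He i j).2; rewrite /o divr_gt0 //.
  have h1 : 0 <= orient (v i) (v j) c by apply: in_ge; lia.
  have h2 : 0 <= orient (v i) (v j) d by apply: in_ge; rewrite /= SE; lia.
  move: nS; rewrite negb_and -!val_eqE /= SE => /orP nS; case: nS => nS.
    have : 0 < orient (v i) (v j) c by apply: clockwise_in => //; lia.
    lra.
  have : 0 < orient (v i) (v j) d by apply: clockwise_in => //=; rewrite SE; lia.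
  lra.
move=> i j k ij jk.
case: (unliftP (lift ord0 r) i) ij => [i' ->|->] ij;
  case: (unliftP (lift ord0 r) j) ij jk => [j' ->|->] ij jk;
  case: (unliftP (lift ord0 r) k) jk => [k' ->|->] jk;
  rewrite ?insert_vertex_lift ?insert_vertex_new; rewrite /= /bump in ij jk.
- by apply: cv; move: ij jk; rewrite !(ltnNge (bump _ _)) !leq_bump2 -!ltnNge.
- by apply: out_lt; move: ij jk; rewrite !(ltnNge (bump _ _)) ?leq_bump2 -?ltnNge /bump; lia.
- rewrite -orient_rot orient_swap oppr_lt0; apply: in_gt; move: ij jk; rewrite /bump; lia.
- by move: ij jk; lia.
- by rewrite orient_rot; apply: out_lt; move: ij jk; rewrite /bump; lia.
- by move: ij jk; rewrite /bump; lia.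
- by move: ij jk; lia.
- by move: ij jk; lia.
Unshelve. all: by end_near.
Qed.

End Insertion.

(** * A coordinate along the boundary of a polygon *)

Section SideCoordinate.
Context {R : realType} (n : nat) (v : 'I_n.+1 -> R * R).
Hypothesis n2 : (1 < n)%N.
Hypothesis cv : clockwise v.

(** Vertex 0 counts as the last one, since it ends side n and the sides are traversed from 1 to
    n. *)
Let rank (i : 'I_n.+1) : nat := if i == ord0 then n.+1 else i.

Let rankS (i : 'I_n.+1) : i != ord0 -> rank (ordS i) = i.+1.
Proof.
move=> i0; rewrite /rank -val_eqE /=.
by have [[+ _]|[+ E]] := ordS_cases i; rewrite /= => ->.
Qed.

Let rank_neq0 (i : 'I_n.+1) : i != ord0 -> rank i = i.
Proof. by rewrite /rank => /negbTE ->. Qed.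

(* The sides 1, ..., n are parametrized through the pencil of lines at a point
   [q] slightly outside side 0, from which their vertices are seen in order. *)
Lemma side_coordinate : exists u : R * R -> R,
  {within polygon v, continuous u} /\
  forall (k : 'I_n.+1) t, k != ord0 -> t \in `[0, 1] ->
    u (side_pt v k t) = k%:R - 1 + t.
Proof.
have [q cq] := insert_exists ord0 n2 cv.
have left_lt (i : 'I_n.+1) : i != ord0 -> orient q (v i) (v ord0) < 0.
  by move=> i0; rewrite -orient_rot; exact: insert_new_left.
have rank_lt (i j : 'I_n.+1) : (rank i < rank j)%N -> orient q (v i) (v j) < 0.
  rewrite /rank; have [->|i0] := eqVneq i ord0; have [->|j0] := eqVneq j ord0 => //.
  - by rewrite ltnn.
  - by move=> h; have := ltn_ord j; rewrite ltnNge (ltnW h).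
  - by move=> _; exact: left_lt.
  move=> ij; have := cq (lift ord0 ord0) (lift (lift ord0 ord0) i) (lift (lift ord0 ord0) j).
  rewrite !insert_vertex_lift insert_vertex_new; apply.
    by rewrite /= /bump; move: i0; rewrite -val_eqE /=; lia.
  by rewrite /= /bump; move: i0 j0; rewrite -!val_eqE /=; lia.
have rank_gt (i j : 'I_n.+1) : (rank j < rank i)%N -> 0 < orient q (v i) (v j).
  have -> : orient q (v i) (v j) = - orient q (v j) (v i) by rewrite /orient; ring.
  by rewrite oppr_gt0; exact: rank_lt.
have rank_inj (i j : 'I_n.+1) : rank i = rank j -> i = j.
  rewrite /rank; case: eqP => [->|_]; case: eqP => [->|_] // E.
  - by have := ltn_ord j; rewrite -E ltnn.
  - by have := ltn_ord i; rewrite E ltnn.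
  - exact: val_inj.
have rank_le (i j : 'I_n.+1) : (rank i <= rank j)%N -> orient q (v i) (v j) <= 0.
  by rewrite leq_eqVlt => /orP[/eqP/rank_inj ->|/rank_lt/ltW //]; rewrite orient_abb.
have rank_ge (i j : 'I_n.+1) : (rank j <= rank i)%N -> 0 <= orient q (v i) (v j).
  by rewrite leq_eqVlt => /orP[/eqP/rank_inj ->|/rank_gt/ltW //]; rewrite orient_abb.
(* Seen from [q], [al k] is positive beyond vertex [k] and [be k] before the next vertex. Thus on
   the sides 1 to n, [la k] is 0 before side [k], 1 after it and exactly [t] on it, and the sum [u]
   counts the sides passed. *)
pose al (k : 'I_n.+1) z := - orient q (v k) z.
pose be (k : 'I_n.+1) z := orient q (v (ordS k)) z.
pose la k z := Num.max (al k z) 0 / (Num.max (al k z) 0 + Num.max (be k z) 0).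
have one0 : ordS ord0 != ord0 :> 'I_n.+1 by apply: ordS_neq; lia.
have ga_gt0 z : polygon v z -> 0 < - orient q (v (ordS ord0)) z - orient q z (v ord0).
  move=> pz; have := pz ord0; have := left_lt _ one0.
  by rewrite /orient /=; move: (v _) (v _) => [a1 a2] [b1 b2] /=; lra.
have den z k : polygon v z -> k != ord0 ->
    0 < Num.max (al k z) 0 + Num.max (be k z) 0.
  move=> pz k0.
  have d0 : 0 < al k (v (ordS k)).
    by rewrite /al oppr_gt0; apply: rank_lt; rewrite rankS // rank_neq0.
  have g1 := ga_gt0 _ (vertex_polygon k cv).
  have g2 := ga_gt0 _ (vertex_polygon (ordS k) cv).
  (* Three affine functionals vanishing at [q] are linearly dependent. As the one of [ga_gt0] is
     positive on the polygon, [al k] and [be k] are never both nonpositive there, which keeps the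
     denominator of [la k] positive. *)
  have E : al k (v (ordS k)) * (- orient q (v (ordS ord0)) z - orient q z (v ord0)) =
     (- orient q (v (ordS ord0)) (v (ordS k)) - orient q (v (ordS k)) (v ord0)) * al k z +
     (- orient q (v (ordS ord0)) (v k) - orient q (v k) (v ord0)) * be k z.
    by rewrite /al /be /orient; ring.
  have : 0 < al k z \/ 0 < be k z.
    have [|ale0] := ltP 0 (al k z); first by left.
    right; rewrite ltNge; apply/negP => be0.
    have : 0 < al k (v (ordS k)) * (- orient q (v (ordS ord0)) z - orient q z (v ord0)).
      by rewrite mulr_gt0 // ga_gt0.
    by rewrite E ltNge -oppr_ge0 opprD -!mulrN addr_ge0 // mulr_ge0 ?oppr_ge0 // ltW.
  case=> h.
    by apply: ltr_pwDl; rewrite ?lt_max ?le_max ?h ?lexx ?orbT.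
  by apply: ltr_wpDl; rewrite ?lt_max ?le_max ?h ?lexx ?orbT.
pose u z := \sum_(k < n) la (lift ord0 k) z.
have cont_max (f : R * R -> R) : continuous f -> continuous (fun z => Num.max (f z) 0).
  by move=> cf x; apply: continuous_max; [exact: cf|exact: cvg_cst].
exists u; split.
  apply: continuous_in_subspaceT => z /set_mem pz.
  apply: cvg_big => [|k _]; first exact: add_continuous.
  have cal : continuous (al (lift ord0 k)).
    by move=> x; apply: cvgN; exact: continuous_orient.
  have cbe : continuous (be (lift ord0 k)) by exact: continuous_orient.
  apply: cvgM; first exact: cont_max.
  apply: cvgV; first by rewrite gt_eqF // den.
  by apply: cvgD; apply: cont_max.
move=> k t k0 t01; move: (t01); rewrite in_itv /= => /andP[t0 t1].
have pz : polygon v (side_pt v k t) by exact: side_polygon.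
have al_seg i : al i (side_pt v k t) = (1 - t) * al i (v k) + t * al i (v (ordS k)).
  by rewrite side_ptE /al orient_seg; ring.
have be_seg i : be i (side_pt v k t) = (1 - t) * be i (v k) + t * be i (v (ordS k)).
  by rewrite side_ptE /be orient_seg; ring.
have laE (i : 'I_n.+1) : i != ord0 -> la i (side_pt v k t) =
    if (i < k)%N then 1 else if i == k then t else 0.
  move=> i0; have := den _ _ pz i0; rewrite /la.
  case: ltngtP => ik.
  - have -> : Num.max (be i (side_pt v k t)) 0 = 0.
      apply/max_idPr; rewrite be_seg.
      have h1 : be i (v k) <= 0.
        by apply: rank_le; rewrite rankS // rank_neq0.
      have h2 : be i (v (ordS k)) <= 0.
        by apply: rank_le; rewrite !rankS // ltnW.
      by nra.
    by rewrite addr0 => h; rewrite divff ?gt_eqF.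
  - have -> : Num.max (al i (side_pt v k t)) 0 = 0; last by rewrite mul0r -val_eqE gtn_eqF.
    apply/max_idPr; rewrite al_seg.
    have h1 : al i (v k) <= 0.
      by rewrite oppr_le0; apply: rank_ge; rewrite !rank_neq0 // ltnW.
    have h2 : al i (v (ordS k)) <= 0.
      by rewrite oppr_le0; apply: rank_ge; rewrite rankS // rank_neq0.
    by nra.
  - have {ik} -> : i = k by apply: val_inj.
    have d0 : 0 < al k (v (ordS k)).
      by rewrite oppr_gt0; apply: rank_lt; rewrite rankS // rank_neq0.
    have -> : al k (side_pt v k t) = t * al k (v (ordS k)).
      by rewrite al_seg {1}/al orient_abb oppr0 mulr0 add0r.
    have -> : be k (side_pt v k t) = (1 - t) * al k (v (ordS k)).
      by rewrite be_seg {2}/be orient_abb mulr0 addr0 /be /al /orient; ring.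
    rewrite eqxx !max_l ?mulr_ge0 ?subr_ge0 // ?(ltW d0) // => _.
    by rewrite -mulrDl addrC subrK mul1r mulfK // gt_eqF.
rewrite /u (eq_bigr (fun i : 'I_n => if (i.+1 < k)%N then 1 else if i.+1 == k :> nat then t else 0)); last first.
  by move=> i _; rewrite laE // -val_eqE /= /bump leq0n.
move: k0 (ltn_ord k) {pz al_seg be_seg laE}; rewrite -val_eqE /=.
case: (nat_of_ord k) => // m _; rewrite ltnS => mn.
rewrite -natr1 addrK.
have E i : (if (i.+1 < m.+1)%N then 1 else if i.+1 == m.+1 then t else 0) =
  (if (i < m)%N then 1 else 0) + (if i == m then t else 0) :> R.
  by rewrite ltnS eqSS; case: ltngtP; rewrite ?add0r ?addr0.
under eq_bigr do rewrite E.
rewrite big_split /= -!big_mkcond /=; congr +%R; last first.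
  rewrite (eq_bigl (fun i : 'I_n => i == Ordinal mn)) ?big_pred1_eq //.
by rewrite -(big_ord_widen n (fun=> 1)) ?(ltnW mn) // sumr_const card_ord.
Qed.

End SideCoordinate.

(** * Compactness of polygons and descent to the quotient *)

Lemma triangle_bounded (R : realType) (a b c z : R * R) :
    orient a b c < 0 -> orient a b z <= 0 -> orient b c z <= 0 ->
    orient c a z <= 0 ->
  `|z.1| <= `|a.1| + `|b.1| + `|c.1| /\ `|z.2| <= `|a.2| + `|b.2| + `|c.2|.
Proof.
set D := orient a b c => D0 h1 h2 h3.
have hs : orient a b z + orient b c z + orient c a z = D by rewrite /D /orient; ring.
have E1 : z.1 * D = orient b c z * a.1 + orient c a z * b.1 + orient a b z * c.1.
  by rewrite /D /orient; ring.
have E2 : z.2 * D = orient b c z * a.2 + orient c a z * b.2 + orient a b z * c.2.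
  by rewrite /D /orient; ring.
have key (x p q r : R) :
    x * D = orient b c z * p + orient c a z * q + orient a b z * r ->
    `|x| <= `|p| + `|q| + `|r|.
  move: h1 h2 h3 hs; move: (orient a b z) (orient b c z) (orient c a z) => w u v.
  move=> w0 u0 v0 hs E; rewrite -(ler_pM2r (x := - D)); last by rewrite oppr_gt0.
  have -> : `|x| * - D = `|x * D| by rewrite normrM (ltr0_norm D0).
  rewrite E; apply: (le_trans (ler_normD _ _)).
  apply: le_trans (_ : `|u * p| + `|v * q| + `|w * r| <= _).
    by rewrite lerD2r; exact: ler_normD.
  rewrite !normrM (ler0_norm u0) (ler0_norm v0) (ler0_norm w0) -hs.
  move: (normr_ge0 p) (normr_ge0 q) (normr_ge0 r) w0 u0 v0.
  move: `|p| `|q| `|r| => P Q T P0 Q0 T0 w0 u0 v0; rewrite -subr_ge0.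
  have -> : (P + Q + T) * - (w + u + v) - (- u * P + - v * Q + - w * T) =
    (- v) * P + (- w) * P + (- u) * Q + (- w) * Q + (- u) * T + (- v) * T by ring.
  by rewrite !addr_ge0 // mulr_ge0 // oppr_ge0.
by split; apply: key.
Qed.

(** Removing a vertex leaves a smaller polygon and a triangle, both bounded. *)
Lemma polygon_bounded (R : realType) n (v : 'I_n -> R * R) : (2 < n)%N ->
  clockwise v ->
  exists M, forall z, polygon v z -> `|z.1| <= M /\ `|z.2| <= M.
Proof.
elim: n v => // n IH v n3 cv.
have [n2|n2] := ltnP 2 n; last first.
  have n3' : n = 2%N by lia.
  subst n; pose i0 : 'I_3 := ord0; pose i1 := ordS i0; pose i2 := ordS i1.
  have i3 : ordS i2 = i0 by apply/val_inj.
  pose m1 := `|(v i0).1| + `|(v i1).1| + `|(v i2).1|.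
  pose m2 := `|(v i0).2| + `|(v i1).2| + `|(v i2).2|.
  exists (m1 + m2) => z pz.
  have m10 : 0 <= m1 by rewrite !addr_ge0.
  have m20 : 0 <= m2 by rewrite !addr_ge0.
  have [||||h1 h2] := @triangle_bounded R (v i0) (v i1) (v i2) z.
  - by apply: cv.
  - exact: pz.
  - exact: pz.
  - by have := pz i2; rewrite i3.
  by rewrite (le_trans h1) ?lerDl // (le_trans h2) // lerDr.
have [r _] : exists r : 'I_n, True by exists (Ordinal (ltn_trans (isT : (0 < 2)%N) n2)).
set q := v (lift ord0 r); set v' := v \o lift (lift ord0 r).
have vE : v = insert_vertex r q v' := insert_vertexE r v.
have [M HM] := IH v' n2 (clockwise_remove r cv).
pose m1 := `|(v' r).1| + `|q.1| + `|(v' (ordS r)).1|.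
pose m2 := `|(v' r).2| + `|q.2| + `|(v' (ordS r)).2|.
have m10 : 0 <= m1 by rewrite !addr_ge0.
have m20 : 0 <= m2 by rewrite !addr_ge0.
have M0 : 0 <= `|M| := normr_ge0 M.
have cv' := cv; rewrite vE in cv'.
exists (`|M| + m1 + m2) => z pz.
have [h|h] := leP (orient (v' r) (v' (ordS r)) z) 0.
  have [] := HM z; first by apply: (@polygon_of_insert _ _ r q v' z _ h); rewrite -vE.
  by have := ler_norm M; lra.
rewrite vE in pz; have [_ h1 h2] := (polygon_insertP r q v' z).1 pz.
have [||||k1 k2] := @triangle_bounded R (v' r) q (v' (ordS r)) z => //.
- by apply: (insert_new_left cv'); apply: ordS_neq; lia.
- by rewrite orient_swap oppr_le0 ltW.
by rewrite -/m1 -/m2 in k1 k2; split; lra.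
Qed.

Lemma closed_polygon (R : realType) n (v : 'I_n -> R * R) : closed (polygon v).
Proof.
have -> : polygon v = \bigcap_(k in [set: 'I_n]) [set z | orient (v k) (v (ordS k)) z <= 0].
  by apply/seteqP; split=> z pz k => [_|]; [exact: pz|exact: (pz k)].
apply: closed_bigI => k _.
have /continuous_closedP c := @continuous_orient R (v k) (v (ordS k)).
exact: (c _ (@closed_le R 0)).
Qed.

Lemma compact_polygon (R : realType) n (v : 'I_n -> R * R) : (2 < n)%N ->
  clockwise v -> compact (polygon v).
Proof.
move=> n2 cv; have [M HM] := polygon_bounded n2 cv.
apply: (@subclosed_compact _ _ (`[- M, M]%classic `*` `[- M, M]%classic)).
- exact: closed_polygon.
- by apply: compact_setX; exact: segment_compact.
- by move=> z /HM[h1 h2]; split; rewrite /= in_itv /= -ler_norml.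
Qed.

Lemma closed_within (T U : topologicalType) (A : set T) (h : T -> U) (C : set U) :
  closed A -> {within A, continuous h} -> closed C -> closed (A `&` h @^-1` C).
Proof.
move=> cA /continuous_closedP ch cC.
have /closed_subspaceP[V cV VE] := ch _ cC.
by rewrite setIC -VE; apply: closedI.
Qed.

(** A continuous map from a compact space to a Hausdorff one is closed: the preimage of a closed set
    under the descended map is the image under [f] of a compact set. *)
Lemma quotient_continuous (R : realType) n (v : 'I_n -> R * R)
    (S U : topologicalType) (f : R * R -> S) (h : R * R -> U) : (2 < n)%N ->
    hausdorff_space S -> clockwise v ->
    {within polygon v, continuous f} -> {within polygon v, continuous h} ->
    (forall x, exists2 z, polygon v z & f z = x) ->
    (forall z w, polygon v z -> polygon v w -> f z = f w -> h z = h w) ->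
  exists2 H : S -> U, continuous H & forall z, polygon v z -> H (f z) = h z.
Proof.
move=> n2 hS cv cf ch sf fh.
pose l x := projT1 (cid2 (sf x)).
have lP x : polygon v (l x) /\ f (l x) = x by rewrite /l; case: cid2.
exists (h \o l); last first.
  by move=> z pz; have [pl fl] := lP (f z); apply: fh.
apply/continuous_closedP => C cC.
have -> : (h \o l) @^-1` C = f @` (polygon v `&` h @^-1` C).
  apply/seteqP; split=> [x Cx|_ [z [pz Cz] <-]].
    by have [pl fl] := lP x; exists (l x).
  by have [pl fl] := lP (f z); rewrite /= (fh _ z).
apply: compact_closed => //; apply: continuous_compact.
  by apply: continuous_subspaceW cf; exact: subIsetl.
apply: subclosed_compact (compact_polygon n2 cv) _; last exact: subIsetl.
by apply: closed_within => //; exact: closed_polygon.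
Qed.

Lemma loop_class_eq (R : realType) (S : topologicalType) (p : S)
    (f f' : loop (R := R) p) :
  (forall t, t \in `[0, 1] -> f t = f' t) -> pi1_class f = pi1_class f'.
Proof.
move=> ff'; apply/pi1_classP.
apply: (@reparam_homotopic R S p f id id) => //.
- exact: loop_continuous.
- by move=> x; exact: cvg_id.
- by move=> x; exact: cvg_id.
- by move=> t t01; rewrite ff' // in_itv.
Qed.

Lemma convex_homotopic (R : realType) (S : topologicalType) (p : S)
    (A : set (R * R)) (F : R * R -> S) (a b : R -> R * R)
    (f f' : loop (R := R) p) :
    {within A, continuous F} ->
    (forall z w t, A z -> A w -> 0 <= t <= 1 -> A (seg_pt z w t)) ->
    continuous a -> continuous b ->
    (forall t, 0 <= t <= 1 -> [/\ A (a t), A (b t), f t = F (a t) & f' t = F (b t)]) ->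
    a 0 = b 0 -> a 1 = b 1 ->
  homotopic f f'.
Proof.
move=> cF convA ca cb ab e0 e1.
exists (F \o (fun st : R * R => seg_pt (a st.2) (b st.2) st.1)).
have k0 : 0 <= (0 : R) <= 1 by rewrite lexx ler01.
have k1 : 0 <= (1 : R) <= 1 by rewrite lexx ler01.
split=> [|t].
  apply: within_comp cF _ _; last first.
    move=> [s t] []; rewrite /= !in_itv /= => s01 t01.
    by have [? ? _ _] := ab t t01; apply: convA.
  apply: continuous_subspaceT.
  have ca' : continuous (fun st : R * R => a st.2).
    by move=> x; apply: continuous_comp; [exact: cvg_snd|exact: ca].
  have cb' : continuous (fun st : R * R => b st.2).
    by move=> x; apply: continuous_comp; [exact: cvg_snd|exact: cb].
  have c1 (h : R * R -> R * R) : continuous h -> continuous (fun st => (h st).1).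
    by move=> ch x; apply: continuous_comp; [exact: ch|exact: cvg_fst].
  have c2 (h : R * R -> R * R) : continuous h -> continuous (fun st => (h st).2).
    by move=> ch x; apply: continuous_comp; [exact: ch|exact: cvg_snd].
  have cf : continuous (fst : R * R -> R) by move=> x; exact: cvg_fst.
  have cg : continuous (fun st : R * R => 1 - st.1).
    by move=> x; apply: cvgB; [exact: cvg_cst|exact: cvg_fst].
  by apply: continuous_pairing => x; apply: cvgD; apply: cvgM;
    [exact: cg|exact: c1|exact: cf|exact: c1|exact: cg|exact: c2|exact: cf|exact: c2].
rewrite in_itv /= => t01.
have [_ _ ft gt] := ab t t01.
have [_ _ f0 g0] := ab 0 k0; have [_ _ f1 g1] := ab 1 k1.
have seg_id z s : seg_pt z z s = z :> R * R.
  by rewrite /seg_pt [RHS]surjective_pairing; congr pair; ring.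
split => /=.
- by rewrite seg_pt0.
- by rewrite seg_pt1.
- by rewrite e0 seg_id -g0 loop_start.
- by rewrite e1 seg_id -g1 loop_end.
Qed.

Lemma polygon_convex (R : realType) n (v : 'I_n -> R * R) z w t :
  polygon v z -> polygon v w -> 0 <= t <= 1 -> polygon v (seg_pt z w t).
Proof.
move=> pz pw t01 k; rewrite orient_seg; have := pz k; have := pw k.
by rewrite /=; nra.
Qed.

(** * Sides, chords and the boundary relation *)

Section PolygonDomain.
Context {R : realType} {g : nat} {S : surface R g}.
Hypothesis g_gt0 : (0 < g)%N.
Local Notation sides := 'I_(4 * g).+1.
Implicit Types (P : polygon_domain S) (k : sides).

Let n2 : (2 < (4 * g).+1)%N. Proof. lia. Qed.

Lemma pairingK P : involutive (pd_pairing P).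
Proof. by have [] := pq_pairing (pd_quotient P). Qed.

Lemma pairing0 P : pd_pairing P ord0 = ord0.
Proof. by have [] := pq_pairing (pd_quotient P). Qed.

Lemma pairing_neq P k : k != ord0 -> pd_pairing P k != k.
Proof. by have [_ _] := pq_pairing (pd_quotient P); apply. Qed.

Lemma pairing_eq0 P k : (pd_pairing P k == ord0) = (k == ord0).
Proof. by rewrite -{1}(pairing0 P) (inj_eq (inv_inj (@pairingK P))). Qed.

Lemma pd_cw P : clockwise (pd_vertex P).
Proof. exact: pq_clockwise (pd_quotient P). Qed.

Lemma pd_map_pairing P k t : k != ord0 -> t \in `[0, 1] ->
  pd_map P (side_pt (pd_vertex P) k t) =
  pd_map P (side_pt (pd_vertex P) (pd_pairing P k) (1 - t)).
Proof.
move=> k0 t01; apply/(pq_fibers (pd_quotient P)).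
- exact: side_polygon (@pd_cw P) t01.
- apply: side_polygon (@pd_cw P) _; move: t01; rewrite !in_itv /=; lra.
- by apply: Or33; exists k, t.
Qed.

Lemma side_inv P k : k != ord0 -> side P (pd_pairing P k) = (side P k)^-1%g.
Proof.
move=> k0; rewrite -[(_)^-1%g]/(pi1_inv _) /side pi1_invE.
apply: loop_class_eq => t t01 /=.
have t01' : 1 - t \in `[0, 1] by move: t01; rewrite !in_itv /=; lra.
by rewrite [RHS]pd_map_pairing // subKr.
Qed.

Lemma side0_eq P P' : side P ord0 = side P' ord0.
Proof. by apply: loop_class_eq => t t01; rewrite /= !pd_boundary. Qed.

Section Chord.
Variables (P : polygon_domain S) (i j : sides).

Lemma chord_continuous : {within `[0, 1], continuous
  (pd_map P \o seg_pt (pd_vertex P i) (pd_vertex P j))}.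
Proof.
apply: within_comp (pq_continuous (pd_quotient P)) _ _.
  by apply: continuous_subspaceT; exact: continuous_seg_pt.
move=> t; rewrite /= in_itv /= => t01.
by apply: polygon_convex t01; exact: vertex_polygon (@pd_cw P).
Qed.

Lemma chord_start : (pd_map P \o seg_pt (pd_vertex P i) (pd_vertex P j)) 0 = basepoint S.
Proof. by rewrite /= seg_pt0 pd_map_vertex. Qed.

Lemma chord_end : (pd_map P \o seg_pt (pd_vertex P i) (pd_vertex P j)) 1 = basepoint S.
Proof. by rewrite /= seg_pt1 pd_map_vertex. Qed.

Definition chord := pi1_class (Loop chord_continuous chord_start chord_end).

End Chord.

Lemma side_chord P k : side P k = chord P k (ordS k).
Proof. exact: loop_class_eq. Qed.

Lemma chord_id P k : chord P k k = 1%g.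
Proof.
rewrite -[1%g]/(pi1_class _); apply: loop_class_eq => t t01 /=.
rewrite -(pd_map_vertex P k); congr (pd_map P _).
by rewrite /seg_pt [RHS]surjective_pairing; congr pair; ring.
Qed.

(** The polygon is convex, so inside it the broken line through vertex [j] deforms to the straight
    chord. *)
Lemma chord_mul P i j k : (chord P i j * chord P j k)%g = chord P i k.
Proof.
rewrite -[(_ * _)%g]/(pi1_mul _ _) pi1_mulE; apply/pi1_classP.
set vi := pd_vertex P i; set vj := pd_vertex P j; set vk := pd_vertex P k.
(* The truncations by [Num.min] and [Num.max] write the broken line as one formula, whose continuity
   is immediate. *)
pose c (t : R) : R * R :=
  (vi.1 + (vj.1 - vi.1) * Num.min (2 * t) 1 + (vk.1 - vj.1) * Num.max (2 * t - 1) 0,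
   vi.2 + (vj.2 - vi.2) * Num.min (2 * t) 1 + (vk.2 - vj.2) * Num.max (2 * t - 1) 0).
have c_le t : t <= 2^-1 -> c t = seg_pt vi vj (2 * t).
  move=> t2; rewrite /c min_l; last by lra.
  by rewrite max_r; [rewrite /seg_pt; congr pair; ring|lra].
have c_ge t : 2^-1 <= t -> c t = seg_pt vj vk (2 * t - 1).
  move=> t2; rewrite /c min_r; last by lra.
  by rewrite max_l; [rewrite /seg_pt; congr pair; ring|lra].
have pv x : polygon (pd_vertex P) (pd_vertex P x) by exact: vertex_polygon (@pd_cw P).
apply: (@convex_homotopic _ _ _ _ (pd_map P) c (seg_pt vi vk) _ _
  (pq_continuous (pd_quotient P))).
- exact: polygon_convex.
- have c1 : continuous (fun t : R => Num.min (2 * t) 1).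
    apply: continuous_minr => x; last exact: cvg_cst.
    by apply: cvgM; [exact: cvg_cst|exact: cvg_id].
  have c2 : continuous (fun t : R => Num.max (2 * t - 1) 0).
    apply: continuous_maxr => x; last exact: cvg_cst.
    apply: cvgB; last exact: cvg_cst.
    by apply: cvgM; [exact: cvg_cst|exact: cvg_id].
  by apply: continuous_pairing => x; (apply: cvgD; first apply: cvgD);
    try exact: cvg_cst; apply: cvgM; try exact: cvg_cst; [exact: c1|exact: c2|exact: c1|exact: c2].
- exact: continuous_seg_pt.
- move=> t t01; split=> //=.
  + have [t2|t2] := leP t 2^-1.
      by rewrite c_le //; apply: polygon_convex; [exact: pv|exact: pv|lra].
    by rewrite c_ge ?ltW //; apply: polygon_convex; [exact: pv|exact: pv|lra].
  + by apply: polygon_convex t01; exact: pv.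
  + have [t2|t2] := leP t 2^-1; first by rewrite c_le.
    by rewrite (c_ge _ (ltW t2)).
- by rewrite c_le ?invr_ge0 // mulr0 !seg_pt0.
- by rewrite c_ge ?invf_le1 ?ler1n // mulr1 (_ : 2 - 1 = 1 :> R) ?seg_pt1 //; ring.
Qed.

(** The sides 1 to m compose to the chord from vertex 1 to vertex m + 1; for m = 4g it ends at
    vertex 0, and side 0 closes the circuit. *)
Lemma prod_sides P :
  \big[*%g/1%g]_(i < 4 * g) side P (lift ord0 i) = (side P ord0)^-1%g.
Proof.
have key m (mg : (m <= 4 * g)%N) :
    \big[*%g/1%g]_(i < m) side P (lift ord0 (widen_ord mg i)) =
    chord P (ordS ord0) (ordS (widen_ord (mg : (m.+1 <= (4 * g).+1)%N) ord_max)).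
  elim: m mg => [|m IH] mg.
    rewrite big_ord0 (_ : ordS _ = ordS ord0) ?chord_id //.
    by congr ordS; exact: val_inj.
  rewrite big_ord_recr /=.
  have mg' : (m <= 4 * g)%N by exact: ltnW.
  rewrite (eq_bigr (fun i => side P (lift ord0 (widen_ord mg' i)))); last first.
    by move=> i _; congr side; congr lift; exact: val_inj.
  rewrite IH side_chord.
  set a := ordS (widen_ord _ _); set b := lift _ _; set c := widen_ord _ _.
  have -> : a = b by apply: val_inj; rewrite /= modn_small //= ltnS.
  have -> : c = b by apply: val_inj.
  exact: chord_mul.
have := key _ (leqnn _).
rewrite (eq_bigr (fun i => side P (lift ord0 i))); last first.
  by move=> i _; congr side; congr lift; exact: val_inj.
move=> ->.
set z := ordS (widen_ord _ _); have -> : z = ord0.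
  by apply: val_inj; rewrite /= modnn.
apply: (mulgI (side P ord0)).
by rewrite mulgV side_chord chord_mul chord_id.
Qed.

End PolygonDomain.

(** * Bands dual to the arcs *)

Section Hat.
Context {R : realType}.
Implicit Types t : R.

Definition hat t : R := Num.max 0 (Num.min t (1 - t)).
(** Odd under reversal of the side, and zero on it only at the ends and the midpoint: its sign tells
    the two halves of a side apart. *)
Definition signed_hat t : R := hat t * (2^-1 - t).

Lemma hat_out t : t <= 0 \/ 1 <= t -> hat t = 0.
Proof.
by move=> h; apply/max_idPl; rewrite ge_min; apply/orP; case: h => h; [left|right; lra].
Qed.

Lemma hat_in t : 0 <= t <= 1 -> hat t = Num.min t (1 - t).
Proof. by move=> h; apply/max_idPr; rewrite le_min; apply/andP; split; lra. Qed.

Lemma hatC t : hat (1 - t) = hat t.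
Proof. by rewrite /hat subKr minC. Qed.

Lemma signed_hatC t : signed_hat (1 - t) = - signed_hat t.
Proof. by rewrite /signed_hat hatC; field. Qed.

Lemma continuous_hat : continuous hat.
Proof.
apply: continuous_maxr => x; first exact: cvg_cst.
apply: continuous_minr => y; first exact: cvg_id.
by apply: cvgB; [exact: cvg_cst|exact: cvg_id].
Qed.

Lemma continuous_signed_hat : continuous signed_hat.
Proof.
move=> x; apply: cvgM; first exact: continuous_hat.
by apply: cvgB; [exact: cvg_cst|exact: cvg_id].
Qed.

Lemma hat_gt0 t : 0 < hat t -> 0 < t < 1.
Proof.
move=> h; apply/andP; split; rewrite ltNge; apply/negP => k; move: h;
  rewrite hat_out ?ltxx //; by [left|right].
Qed.

Lemma hat_ge0 t : 0 <= hat t.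
Proof. by rewrite le_max lexx. Qed.

End Hat.

Section Bands.
Context {R : realType} {g : nat} {S : surface R g}.
Hypothesis g_gt0 : (0 < g)%N.
Local Notation sides := 'I_(4 * g).+1.
Variable P : polygon_domain S.
Local Notation v := (pd_vertex P).
Local Notation s := (pd_pairing P).

(* Around the middle of side [k] runs a band dual to its arc: [A k] is the
   distance to the boundary of the band, and the sign of [B k] distinguishes
   the two halves of the band. *)
Lemma side_bands : exists A B : sides -> S -> R,
  [/\ forall k, continuous (A k) /\ continuous (B k),
      forall k j t, k != ord0 -> j != ord0 -> t \in `[0, 1] ->
        A k (side_loop P j t) = (if (k == j) || (k == s j) then hat t else 0) /\
        B k (side_loop P j t) = (if k == j then signed_hat t else
          if k == s j then - signed_hat t else 0),
      forall k x, k != ord0 -> A (s k) x = A k x /\ B (s k) x = - B k x,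
      forall k j x, k != ord0 -> j != ord0 ->
        4^-1 < A k x -> 4^-1 < A j x -> j = k \/ j = s k &
      forall k x, k != ord0 -> A k x = 4^-1 -> B k x != 0].
Proof.
have n1 : (1 < 4 * g)%N by lia.
have [u [cu uE]] := side_coordinate n1 (@pd_cw _ _ _ P).
pose bump (phi : R -> R) (k : sides) (z : R * R) := phi (u z - (k%:R - 1)).
have c_bump (phi : R -> R) (k : sides) : continuous phi -> {within polygon v, continuous (bump phi k)}.
  move=> cphi x; apply: (@cvg_comp _ _ _ u (fun t => phi (t - (k%:R - 1)))).
    exact: cu.
  apply: (@cvg_comp _ _ _ (fun t => t - (k%:R - 1)) phi); last exact: cphi.
  by apply: cvgB; [exact: cvg_id|exact: cvg_cst].
have bump_side (phi : R -> R) (k j : sides) t :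
    (forall t, t <= 0 \/ 1 <= t -> phi t = 0) -> j != ord0 -> t \in `[0, 1] ->
    bump phi k (side_pt v j t) = if k == j then phi t else 0.
  move=> phi0 j0 t01; rewrite /bump uE //; case: eqP => [->|/eqP kj].
    by congr phi; ring.
  move: t01; rewrite in_itv /= => /andP[t0 t1]; apply: phi0.
  have [jk|kj'] := ltnP j k; [left|right].
    have : j.+1%:R <= k%:R :> R by rewrite ler_nat.
    by rewrite -natr1; lra.
  have : k.+1%:R <= j%:R :> R.
    by rewrite ler_nat ltn_neqAle kj' andbT; move: kj; rewrite -val_eqE.
  by rewrite -natr1; lra.
have bump_vertex (phi : R -> R) (k i : sides) :
    (forall t, t <= 0 \/ 1 <= t -> phi t = 0) -> bump phi k (v i) = 0.
  move=> phi0; have [->|i0] := eqVneq i ord0.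
    have -> : v ord0 = side_pt v ord_max 1.
      by rewrite side_pt1; congr v; apply: val_inj; rewrite /= modnn.
    rewrite bump_side //; first by case: ifP => // _; apply: phi0; right.
    - by rewrite -val_eqE /=; lia.
    - by rewrite in_itv /= ler01 lexx.
  rewrite -(side_pt0 v) bump_side //; first by case: ifP => // _; apply: phi0; left.
  by rewrite in_itv /= ler01 lexx.
have hat0 t : t <= 0 \/ 1 <= t -> hat t = 0 :> R by exact: hat_out.
have shat0 t : t <= 0 \/ 1 <= t -> signed_hat t = 0 :> R.
  by move=> h; rewrite /signed_hat hat0 // mul0r.
(* Gluing sends [t] to [1 - t], under which [hat] is even and [signed_hat] odd. Hence the sum over
   partner sides descends to the surface, and for the signed version the difference does. *)
pose a k z := bump hat k z + bump hat (s k) z.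
pose b k z := bump signed_hat k z - bump signed_hat (s k) z.
have sK := @pairingK _ _ _ P.
have sN k : k != ord0 -> s k != k by exact: pairing_neq.
have s0 k : (s k == ord0) = (k == ord0) := pairing_eq0 P k.
have a_side (k j : sides) t : k != ord0 -> j != ord0 -> t \in `[0, 1] ->
    a k (side_pt v j t) = if (k == j) || (k == s j) then hat t else 0.
  move=> k0 j0 t01; rewrite /a !bump_side // -[s k == j](inj_eq (inv_inj sK)) sK.
  case: (eqVneq k j) => [->|]; last by rewrite add0r.
  by rewrite eq_sym (negbTE (sN _ j0)) addr0.
have b_side (k j : sides) t : k != ord0 -> j != ord0 -> t \in `[0, 1] ->
    b k (side_pt v j t) = if k == j then signed_hat t else
      if k == s j then - signed_hat t else 0.
  move=> k0 j0 t01; rewrite /b !bump_side // -[s k == j](inj_eq (inv_inj sK)) sK.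
  case: (eqVneq k j) => [->|]; last by rewrite sub0r; case: ifP; rewrite ?oppr0.
  by rewrite eq_sym (negbTE (sN _ j0)) subr0.
have t01' (t : R) : t \in `[0, 1] -> 1 - t \in `[0, 1] by rewrite !in_itv /=; lra.
have a_fib k z w : polygon v z -> polygon v w -> pd_map P z = pd_map P w ->
    k != ord0 -> a k z = a k w.
  move=> pz pw + k0 => /(pq_fibers (pd_quotient P) pz pw)[->//|[i [j [-> ->]]]|].
    by rewrite /a !bump_vertex.
  move=> [j [t [j0 t01 -> ->]]]; rewrite !a_side ?s0 // ?t01' // sK hatC.
  by rewrite orbC.
have b_fib k z w : polygon v z -> polygon v w -> pd_map P z = pd_map P w ->
    k != ord0 -> b k z = b k w.
  move=> pz pw + k0 => /(pq_fibers (pd_quotient P) pz pw)[->//|[i [j [-> ->]]]|].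
    by rewrite /b !bump_vertex.
  move=> [j [t [j0 t01 -> ->]]]; rewrite !b_side ?s0 // ?t01' // sK signed_hatC opprK.
  case: eqVneq => [->|//]; by rewrite eq_sym (negbTE (sN _ j0)).
have cv := @pd_cw _ _ _ P.
have quot (h : sides -> R * R -> R) :
    (forall k, {within polygon v, continuous (h k)}) ->
    (forall k z w, polygon v z -> polygon v w -> pd_map P z = pd_map P w ->
      k != ord0 -> h k z = h k w) ->
    exists H : sides -> S -> R, (forall k, continuous (H k)) /\
      forall k z, k != ord0 -> polygon v z -> H k (pd_map P z) = h k z.
  move=> ch hf; have /choice[H HP] : forall k, exists H : S -> R, continuous H /\
      (k != ord0 -> forall z, polygon v z -> H (pd_map P z) = h k z).
    move=> k; have [->|k0] := eqVneq k ord0.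
      by exists (fun=> 0); split=> // x; exact: cvg_cst.
    have n2 : (2 < (4 * g).+1)%N by lia.
    have [H cH HE] := quotient_continuous n2 (@surface_hausdorff _ _ S) cv
      (pq_continuous (pd_quotient P)) (ch k) (pq_surjective (pd_quotient P))
      (fun z w pz pw fzw => hf k z w pz pw fzw k0).
    by exists H.
  by exists H; split=> [k|k z k0]; [exact: (HP k).1|exact: (HP k).2].
have [A [cA AE]] : exists H : sides -> S -> R, (forall k, continuous (H k)) /\
      forall k z, k != ord0 -> polygon v z -> H k (pd_map P z) = a k z.
  apply: quot a_fib => k; apply: within_continuousD; exact: c_bump continuous_hat.
have [B [cB BE]] : exists H : sides -> S -> R, (forall k, continuous (H k)) /\
      forall k z, k != ord0 -> polygon v z -> H k (pd_map P z) = b k z.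
  apply: quot b_fib => k; apply: within_continuousB; exact: c_bump continuous_signed_hat.
have bump_disj (k j : sides) z : 0 < bump hat k z -> 0 < bump hat j z -> k = j.
  move=> /hat_gt0/andP[k0 k1] /hat_gt0/andP[j0 j1]; apply: val_inj => /=.
  have h1 : k%:R < j.+1%:R :> R by rewrite -natr1; lra.
  have h2 : j%:R < k.+1%:R :> R by rewrite -natr1; lra.
  by move: h1 h2; rewrite !ltr_nat; lia.
exists A, B; split.
- by [].
- move=> k j t k0 j0 t01; have pz : polygon v (side_pt v j t) by exact: side_polygon.
  by rewrite /= AE // BE // a_side // b_side.
- move=> k x k0; have [z pz <-] := pq_surjective (pd_quotient P) x.
  by rewrite !AE ?s0 // !BE ?s0 // /a /b sK addrC opprB.
- move=> k j x k0 j0; have [z pz <-] := pq_surjective (pd_quotient P) x.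
  have pos (i : sides) : 4^-1 < a i z -> exists2 i', i' = i \/ i' = s i & 0 < bump hat i' z.
    rewrite /a; have := hat_ge0 (u z - (i%:R - 1)); rewrite -/(bump hat i z) => hi.
    have [h|h] := ltP 0 (bump hat i z); first by exists i => //; left.
    by move=> h'; exists (s i); [right|lra].
  rewrite !AE // => /pos[k' k'E hk'] /pos[j' j'E hj'].
  have E := bump_disj _ _ _ hk' hj'; move: k'E j'E; rewrite E.
  case=> -> [E'|E']; [by left|by right; rewrite E' sK|by right|].
  by left; apply: (inv_inj sK).
- move=> k x k0; have [z pz <-] := pq_surjective (pd_quotient P) x.
  rewrite AE // BE // /a /b.
  have key (i : sides) : bump hat i z = 4^-1 -> bump signed_hat i z != 0.
    rewrite /bump /signed_hat => h; rewrite mulf_neq0 ?h ?invr_neq0 //.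
    move: h; set t := u z - _ => h; have /andP[t0 t1] : 0 < t < 1.
      by apply: hat_gt0; rewrite h.
    rewrite subr_eq0; apply/eqP => ht; move: h; rewrite hat_in ?ltW // -ht.
    by rewrite minEle; case: ifP => _; lra.
  have zero (i : sides) : bump hat i z = 0 -> bump signed_hat i z = 0.
    by rewrite /bump /signed_hat => ->; rewrite mul0r.
  have nn (i : sides) : 0 <= bump hat i z := hat_ge0 _.
  have [h|h] := ltP 0 (bump hat k z).
    have h0 : bump hat (s k) z = 0.
      apply/le_anti; rewrite nn andbT leNgt; apply/negP => h'.
      by move: (sN k k0); rewrite -(bump_disj _ _ _ h h') eqxx.
    by rewrite h0 (zero _ h0) addr0 subr0; exact: key.
  have h0 : bump hat k z = 0 by apply/le_anti; rewrite nn h.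
  by rewrite h0 (zero _ h0) add0r sub0r oppr_eq0; exact: key.
Qed.

End Bands.

(** * Actions of the fundamental group prescribed on the sides *)

Section SidesAction.
Context {R : realType} {g : nat} {S : surface R g}.
Hypothesis g_gt0 : (0 < g)%N.
Local Notation sides := 'I_(4 * g).+1.
Variable P : polygon_domain S.
Local Notation s := (pd_pairing P).
Local Notation pi := (pi1 (R := R) (basepoint S)).

Section Action.
Variables (T : Type) (push : sides -> T -> T).
Hypothesis pushK : forall k r, k != ord0 -> push (s k) (push k r) = r.

(* Crossing the band dual to side [k] acts by [push]; away from the cores of the
   bands the transition is trivial. *)
Lemma sides_action : exists L : pi -> T -> T,
  [/\ forall r, L 1%g r = r,
      forall (u w : pi) r, L (u * w)%g r = L u (L w r),
      forall k r, k != ord0 -> L (side P k) r = push k r &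
      forall h : T -> T, (forall k r, k != ord0 -> h (push k r) = push k (h r)) ->
        forall u r, L u (h r) = h (L u r)].
Proof.
have [A [B [cAB side_AB pair_AB disj_A edge_A]]] := side_bands g_gt0 P.
have sK := @pairingK _ _ _ P.
have sN k : k != ord0 -> s k != k by exact: pairing_neq.
have s0 k : (s k == ord0) = (k == ord0) := pairing_eq0 P k.
(* [H k] is the half of the open band that meets side [k] in its first half. On the core, where
   [B k] vanishes, the order of the two indices decides, so that the band is the disjoint union of
   [H k] and [H (s k)]. *)
pose H (k : sides) (x : S) : bool := [&& k != ord0, 4^-1 < A k x &
  (0 < B k x) || (B k x == 0) && (s k < k)%N].
have H_pair k x : H k x -> H (s k) x = false.
  move=> /and3P[k0 Ak Bk]; apply/negP => /and3P[_ _].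
  have [_ ->] := pair_AB k x k0; rewrite oppr_gt0 oppr_eq0 sK.
  case/orP: Bk => [Bk|/andP[/eqP -> sk]].
    by rewrite ltNge (ltW Bk) /= gt_eqF.
  by rewrite ltxx eqxx /= ltnNge (ltnW sk).
have H_or k x : k != ord0 -> 4^-1 < A k x -> H k x || H (s k) x.
  move=> k0 Ak; rewrite /H s0 k0; have [-> ->] := pair_AB k x k0.
  rewrite Ak /= oppr_gt0 oppr_eq0 sK; have := sN _ k0; rewrite -val_eqE /=.
  by case: (ltgtP (B k x) 0) => //= _; case: ltngtP.
have H_disj k j x : H k x -> H j x -> j = k.
  move=> hk hj; have [k0 Ak _] := and3P hk; have [j0 Aj _] := and3P hj.
  by have [//|jE] := disj_A _ _ _ k0 j0 Ak Aj; move: hj; rewrite jE H_pair.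
pose cross x y k := H k x && H (s k) y.
pose tr x y r := if [pick k | cross x y k] is Some k then push (s k) r else r.
have trE x y k r : cross x y k -> tr x y r = push (s k) r.
  move=> ck; rewrite /tr; case: pickP => [j cj|/(_ k)]; last by rewrite ck.
  by rewrite (H_disj _ _ _ (andP ck).1 (andP cj).1).
have tr_none x y r : (forall k, cross x y k = false) -> tr x y r = r.
  by move=> nc; rewrite /tr; case: pickP => [j|//]; rewrite nc.
have pushK' k r : k != ord0 -> push k (push (s k) r) = r.
  by move=> k0; rewrite -{1}(sK k) pushK // s0.
have cross_id x y k : H k x -> H k y -> forall j, cross x y j = false.
  move=> hx hy j; apply/negP => /andP[hj hsj].
  by have E := H_disj _ _ _ hx hj; move: hsj; rewrite E H_pair.
have tr_id a r : tr a a r = r.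
  by apply: tr_none => k; apply/negP => /andP[hk]; rewrite H_pair.
have tr_loc (x : S) : exists2 U, nbhs x U & cocycle_on tr U.
  (* In an open band only its own two halves matter. Elsewhere there is a neighbourhood on which,
     for every [k], [A k] stays below 1/4 or [B k] keeps its sign; then no band is crossed from one
     half to the other. *)
  have [[k [k0 Ak]]|noA] := pselect (exists k, k != ord0 /\ 4^-1 < A k x).
    exists [set y | 4^-1 < A k y].
      by have [cA _] := cAB k; apply: (cvgr_gt _ (cA x)).
    move=> a b c r Ua Ub Uc.
    have trab a' b' r' : 4^-1 < A k a' -> 4^-1 < A k b' -> tr a' b' r' =
        if H k a' then (if H k b' then r' else push (s k) r')
        else if H k b' then push k r' else r'.
      move=> A1 A2; have := H_or _ _ k0 A1; have := H_or _ _ k0 A2.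
      case: ifPn => h1 /=; case: ifPn => h2 //= h3 h4.
      - by apply: tr_none; exact: cross_id h1 h2.
      - by apply: trE; rewrite /cross h1 h3.
      - by rewrite (@trE _ _ (s k)) ?sK // /cross h4 sK h2.
      - by apply: tr_none; exact: cross_id h4 h3.
    by rewrite !trab //; case: (H k a); case: (H k b); case: (H k c);
      rewrite ?pushK ?pushK'.
  pose Q k y := if A k x < 4^-1 then A k y < 4^-1 else
    if 0 < B k x then 0 < B k y else B k y < 0.
  exists [set y | forall k, k != ord0 -> Q k y].
    apply: filter_forall => k; have [->|k0] := eqVneq k ord0.
      by apply: nearW => y /eqP[].
    have [cA cB] := cAB k.
    apply: (@filterS _ _ _ [set y | Q k y]); first by move=> y Qy _.
    rewrite /Q; have [Ax|nAx] := ltP (A k x) 4^-1; first exact: (cvgr_lt _ (cA x)).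
    have [Bx|nBx] := ltP 0 (B k x); first exact: (cvgr_gt _ (cB x)).
    apply: (cvgr_lt _ (cB x)); rewrite lt_neqAle nBx andbT.
    apply: edge_A => //; apply/le_anti; rewrite nAx andbT.
    by rewrite leNgt; apply/negP => Ak; apply: noA; exists k.
  have nocross a b : (forall k, k != ord0 -> Q k a) ->
      (forall k, k != ord0 -> Q k b) -> forall k, cross a b k = false.
    move=> Qa Qb k; apply/negP => /andP[/and3P[k0 A1 B1] /and3P[_ A2 B2]].
    have [E1 E2] := pair_AB k b k0; move: (Qa _ k0) (Qb _ k0); rewrite /Q.
    case: ifP => _; first by rewrite ltNge (ltW A1).
    case: ifP => _ h1 h2.
      by move: B2; rewrite E2 oppr_gt0 oppr_eq0 ltNge (ltW h2) /= (gt_eqF h2).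
    by move: B1; rewrite ltNge (ltW h1) /= (lt_eqF h1).
  by move=> a b c r Ua Ub Uc; rewrite !tr_none //; exact: nocross.
have [act [act1 actM act_lift act_nat]] := @monodromy R S T (basepoint S) tr tr_id tr_loc.
have act_side k r : k != ord0 -> act (side P k) r = push (s k) r.
  move=> k0.
  pose before (t : R) : bool := (t < 2^-1) || (t == 2^-1) && (s k < k)%N.
  pose l (t : R) := if before t then r else push (s k) r.
  have -> : r = l 0 by rewrite /l /before invr_gt0 ltr0n.
  have -> : push (s k) (l 0) = l 1.
    have n1 : (1 < 2^-1 :> R) = false by apply/negbTE; rewrite -leNgt invf_le1 ?ler1n.
    have n2 : (1 == 2^-1 :> R) = false by apply/negbTE; rewrite gt_eqF // invf_lt1 ?ltr1n.
    by rewrite /l /before n1 n2 /= invr_gt0 ltr0n.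
  (* The band meets the side in the parameters between 1/4 and 3/4, so a step shorter than 1/8
     across the midpoint has both ends inside it. *)
  apply: act_lift => t t01; exists 8^-1; first by rewrite invr_gt0.
  move=> t' t'01; rewrite ltr_norml => /andP[d1 d2].
  have in01 (x : R) : 0 <= x <= 1 -> x \in `[0, 1] by rewrite in_itv.
  have H_side j (x : R) : 0 <= x <= 1 -> H j (side_loop P k x) ->
      4^-1 < hat x /\ j = if before x then k else s k.
    move=> x01 /and3P[j0]; have [-> ->] := side_AB j k x j0 k0 (in01 _ x01).
    case: (eqVneq j k) => [->|jk] /=.
      move=> hx; rewrite /signed_hat pmulr_rgt0 ?subr_gt0; last by apply: lt_trans hx; rewrite invr_gt0.
      rewrite mulf_eq0 (gt_eqF (lt_trans _ hx)) ?invr_gt0 // subr_eq0 eq_sym -/(before x).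
      by move=> ->.
    case: (eqVneq j (s k)) => [->|jsk] hx; last by move: hx; rewrite ltNge invr_ge0 ler0n.
    rewrite oppr_gt0 oppr_eq0 /signed_hat sK pmulr_rlt0 ?subr_lt0; last by apply: lt_trans hx; rewrite invr_gt0.
    rewrite mulf_eq0 (gt_eqF (lt_trans _ hx)) ?invr_gt0 // subr_eq0 eq_sym.
    move=> bx; split=> //; rewrite /before; case: ifP => //.
    by case/orP: bx => [bx|/andP[/eqP -> sk]];
      [rewrite ltNge (ltW bx) /= gt_eqF|rewrite ltxx eqxx /= ltnNge (ltnW sk)].
  have side_H (x : R) : 4^-1 < x < 1 - 4^-1 -> H (if before x then k else s k) (side_loop P k x).
    move=> /andP[x1 x2].
    have x01 : 0 <= x <= 1 by apply/andP; split; lra.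
    have hx : 4^-1 < hat x by rewrite hat_in // lt_min x1; lra.
    have Ak : 4^-1 < A k (side_loop P k x).
      by have [-> _] := side_AB k k x k0 k0 (in01 _ x01); rewrite eqxx.
    by have /orP[h|h] := H_or _ _ k0 Ak; have [_ <-] := H_side _ _ x01 h.
  have mid (x y : R) : 0 <= x <= 1 -> before x -> ~~ before y -> `|x - y| < 8^-1 ->
      4^-1 < x < 1 - 4^-1 /\ 4^-1 < y < 1 - 4^-1.
    move=> x01; rewrite /before => bx; rewrite negb_or -leNgt => /andP[hy _].
    have hx : x <= 2^-1 by case/orP: bx => [/ltW//|/andP[/eqP -> _]].
    by rewrite ltr_norml => /andP[h1 h2]; split; apply/andP; split; lra.
  rewrite /l; case: ifPn => b'; case: ifPn => b.
  - rewrite tr_none // => j; apply/negP => /andP[/(H_side _ _ t01)[_ h1] /(H_side _ _ t'01)[_ h2]].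
    have := sN k k0; rewrite b b' in h1 h2.
    by rewrite -{2}h2 h1 eqxx.
  - have [|h1 h2] := mid _ _ t'01 b' b; first by rewrite ltr_norml; apply/andP; split.
    rewrite (@trE _ _ (s k)) ?sK ?pushK' // /cross sK.
    by have := side_H _ h1; have := side_H _ h2; rewrite b' (negbTE b) => -> ->.
  - have [|h1 h2] := mid _ _ t01 b b'; first by rewrite ltr_norml; apply/andP; split; lra.
    rewrite (@trE _ _ k) // /cross.
    by have := side_H _ h1; have := side_H _ h2; rewrite b (negbTE b') => -> ->.
  - rewrite tr_none // => j; apply/negP => /andP[/(H_side _ _ t01)[_ h1] /(H_side _ _ t'01)[_ h2]].
    have := sN k k0; rewrite (negbTE b) (negbTE b') in h1 h2.
    by rewrite -{1}h2 h1 sK eqxx.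
(* Inversion turns the right action into a left one, and [push (s k)] into [push k]. *)
exists (fun u => act (u^-1)%g); split.
- by move=> r; rewrite invg1.
- by move=> u w r; rewrite invgM actM.
- by move=> k r k0; rewrite -side_inv // act_side ?s0 // sK.
- move=> h hC u r; apply: act_nat => x y r'; rewrite /tr.
  by case: pickP => // k /andP[/and3P[k0 _ _] _]; rewrite hC ?s0.
Qed.

End Action.

(* When the sides also generate, this says that the group is free on the arcs. *)
Lemma sides_hom (T : Type) (e : T) (op : Monoid.law e) (tau : sides -> T) :
    (forall k, k != ord0 -> op (tau (s k)) (tau k) = e) ->
  exists F : pi -> T,
    [/\ F 1%g = e, forall u w : pi, F (u * w)%g = op (F u) (F w) &
      forall k, k != ord0 -> F (side P k) = tau k].
Proof.
move=> tauK; have [k r k0|L [L1 LM Lside Lnat]] := @sides_action T (fun k r => op (tau k) r).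
  exact: etrans (Monoid.mulmA op _ _ _)
    (etrans (congr1 (fun x => op x r) (tauK k k0)) (Monoid.mul1m op r)).
(* The action commutes with right multiplications, hence [L u] is left multiplication by [L u e]. *)
have LE u r : L u r = op (L u e) r.
  rewrite -[in LHS](Monoid.mul1m op r); apply: (Lnat (fun x => op x r)) => k x _.
  exact: esym (Monoid.mulmA op _ _ _).
exists (fun u => L u e); split=> // [u w|k k0]; first by rewrite LM LE.
by rewrite Lside // Monoid.mulm1.
Qed.

End SidesAction.

(** * Objects and morphisms of the groupoid *)

Section Objects.
Context {R : realType} {g : nat} {S : surface R g}.
Hypothesis g_gt0 : (0 < g)%N.
Local Notation sides := 'I_(4 * g).+1.
Local Notation pi := (pi1 (R := R) (basepoint S)).
Implicit Types (P : polygon_domain S) (k : sides).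

Let n2 : (2 < (4 * g).+1)%N. Proof. lia. Qed.

Lemma first_sidesP P k : (k \in first_sides P) = (k < pd_pairing P k)%N.
Proof. by rewrite mem_filter mem_enum andbT. Qed.

Lemma first_sides_uniq P : uniq (first_sides P).
Proof. by rewrite filter_uniq // enum_uniq. Qed.

Lemma size_first_sides P : size (first_sides P) = (2 * g)%N.
Proof.
set s := pd_pairing P; have sK : involutive s := @pairingK _ _ _ P.
pose A := [pred k : sides | (k < s k)%N]; pose B := [pred k : sides | (s k < k)%N].
have -> : size (first_sides P) = #|A|.
  rewrite -(card_uniqP (first_sides_uniq P)); apply: eq_card => k.
  by rewrite first_sidesP.
have AB : #|A| = #|B|.
  rewrite -(fintype.card_image (inv_inj sK) A); apply: eq_card => k; rewrite [RHS]inE.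
  apply/fintype.imageP/idP => [[j h ->]|h]; first by rewrite sK.
  by exists (s k); rewrite ?inE sK.
have AC : #|[predI A & B]| = 0%N by apply: eq_card0 => k; rewrite !inE; case: ltngtP.
have AUB : #|[predU A & B]| = (4 * g)%N.
  rewrite -[RHS]/((4 * g).+1.-1) -[in RHS](card_ord (4 * g).+1) -(cardC1 ord0).
  apply: eq_card => k; rewrite !inE; have [->|k0] := eqVneq k ord0.
    by rewrite /s pairing0 ltnn.
  by have := pairing_neq P k0; rewrite -val_eqE /= -/s; case: ltngtP.
have := cardUI A B. rewrite AC AUB addn0 -AB addnn => E.
have {}E : (4 * g)%N = (#|A|).*2 by exact: E.
by lia.
Qed.

Lemma arc_side_lt P i : (arc_side P i < pd_pairing P (arc_side P i))%N.
Proof. by rewrite -first_sidesP mem_nth // size_first_sides. Qed.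

Lemma arc_side_neq0 P i : arc_side P i != ord0.
Proof.
by apply/eqP => E; have := arc_side_lt P i; rewrite E pairing0 ltnn.
Qed.

Lemma arc_side_inj P : injective (arc_side P).
Proof.
move=> i j /eqP; rewrite /arc_side nth_uniq ?size_first_sides ?first_sides_uniq //.
by move=> /eqP/val_inj.
Qed.

Lemma arc_side_pairing P i j : (arc_side P i == pd_pairing P (arc_side P j)) = false.
Proof.
apply/eqP => E; have := arc_side_lt P i; have := arc_side_lt P j.
by rewrite E pairingK; case: ltngtP.
Qed.

Lemma arc_side_first P k : (k < pd_pairing P k)%N -> exists i, arc_side P i = k.
Proof.
rewrite -first_sidesP => h.
have lt : (index k (first_sides P) < 2 * g)%N by rewrite -(size_first_sides P) index_mem.
by exists (Ordinal lt); rewrite /arc_side nth_index.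
Qed.

Lemma arc_side_ex P k : k != ord0 ->
  exists i, arc_side P i = k \/ arc_side P i = pd_pairing P k.
Proof.
move=> k0; have := pairing_neq P k0; rewrite -val_eqE /=.
case: ltngtP => // h _.
  by have [|i <-] := @arc_side_first P (pd_pairing P k); [rewrite pairingK|exists i; right].
by have [i <-] := arc_side_first h; exists i; left.
Qed.

Lemma arc_index P : exists arc : sides -> 'I_(2 * g),
  [/\ forall k, k != ord0 -> arc_side P (arc k) = k \/ arc_side P (arc k) = pd_pairing P k,
      forall k, k != ord0 -> arc (pd_pairing P k) = arc k &
      forall i, arc (arc_side P i) = i].
Proof.
have /choice[arc arcP] : forall k : sides, exists i, k != ord0 ->
    arc_side P i = k \/ arc_side P i = pd_pairing P k.
  move=> k; have [->|k0] := eqVneq k ord0.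
    have g2 : (0 < 2 * g)%N by lia.
    by exists (Ordinal g2).
  by have [i iP] := arc_side_ex P k0; exists i.
exists arc; split=> // [k k0|i].
  apply: (@arc_side_inj P).
  have := arcP _ k0; have := arcP (pd_pairing P k); rewrite pairing_eq0 pairingK.
  have := arc_side_lt P (arc k); have := arc_side_lt P (arc (pd_pairing P k)).
  by move=> h1 h2 /(_ k0)[E1|E1] [E2|E2]; move: h1 h2; rewrite E1 E2 ?pairingK //;
    case: ltngtP.
apply: (@arc_side_inj P); have [//|E] := arcP _ (arc_side_neq0 P i).
by have := arc_side_pairing P (arc (arc_side P i)) i; rewrite E eqxx.
Qed.

(** The homomorphism to the integers that counts the arc of [k] with sign takes the value 1 on side
    [k], and -1 or 0 on every other side of an arc. *)
Lemma side_inj P j k : j != ord0 -> k != ord0 -> side P j = side P k -> j = k.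
Proof.
move=> j0 k0 E; set s := pd_pairing P; have sK : involutive s := @pairingK _ _ _ P.
pose tau (i : sides) : int := if i == k then 1 else if i == s k then -1 else 0.
have [i i0|F [_ _ FE]] := @sides_hom _ _ _ g_gt0 P int 0 +%R tau.
  rewrite /tau -/s (inj_eq (inv_inj sK)) -[s i == k](inj_eq (inv_inj sK)) sK.
  case: (eqVneq i k) => [->|ik].
    have -> : (k == s k) = false by rewrite eq_sym; apply/negbTE/pairing_neq.
    by [].
  by case: eqVneq.
have := FE _ j0; rewrite E FE // /tau eqxx.
by case: eqVneq => // _; case: eqVneq.
Qed.

Lemma interior_fiber P k t w : k != ord0 -> 0 < t < 1 ->
    polygon (pd_vertex P) w -> pd_map P (side_pt (pd_vertex P) k t) = pd_map P w ->
  w = side_pt (pd_vertex P) k t \/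
  w = side_pt (pd_vertex P) (pd_pairing P k) (1 - t).
Proof.
move=> k0 /andP[t0 t1] pw; set v := pd_vertex P; have cv : clockwise v := @pd_cw _ _ _ P.
have t01 : t \in `[0, 1] by rewrite in_itv /= !ltW.
have pz : polygon v (side_pt v k t) by exact: side_polygon.
move=> /(pq_fibers (pd_quotient P) pz pw)[->|[i [j [E _]]]|[j [u [j0 u01 E ->]]]].
- by left.
- by exfalso; have := side_pt_vertex cv n2 t01 E; lra.
- right; have [jk|jk] := eqVneq j k.
    by move: E; rewrite jk => /(side_pt_inj cv n2) ->.
  by exfalso; have := side_pt_meet cv n2 jk t01 (esym E); lra.
Qed.

Lemma realized_by_polygon P :
  realized_by (fun i => side_loop P (arc_side P i)) (fun i => side P (arc_side P i)).
Proof.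
set v := pd_vertex P; have cv : clockwise v := @pd_cw _ _ _ P.
have pv k t : 0 <= t <= 1 -> polygon v (side_pt v k t).
  by move=> t01; apply: side_polygon => //; rewrite in_itv.
split=> //.
- move=> i u t; rewrite !in_itv /= => /andP[u0 u1] /andP[t0 t1] E.
  have key a b : 0 <= a < 1 -> 0 <= b < 1 -> 0 < a ->
      pd_map P (side_pt v (arc_side P i) a) = pd_map P (side_pt v (arc_side P i) b) ->
      a = b.
    move=> /andP[_ a1] /andP[b0 b1] a0 Eab.
    have [||||E'|E'] := @interior_fiber P (arc_side P i) a (side_pt v (arc_side P i) b).
    + exact: arc_side_neq0.
    + by rewrite a0.
    + by apply: pv; rewrite b0 ltW.
    + exact: Eab.
    + by apply/esym/(side_pt_inj cv n2 E').
    + have h : 1 - a \in `[0, 1] by rewrite in_itv /=; lra.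
      have /= := side_pt_meet cv n2 _ h E'; rewrite eq_sym.
      by move=> /(_ (pairing_neq P (arc_side_neq0 P i))); lra.
  have [u00|u00] := ltP 0 u; first by apply: key => //; apply/andP.
  have [t00|t00] := ltP 0 t; first by apply/esym/key => //; apply/andP.
  by lra.
- move=> i j u t ij; rewrite !in_itv /= => u01 t01 E.
  have u01' : u \in `[0, 1] by rewrite in_itv.
  have [/andP[u0 u1]|] := boolP (0 < u < 1); last first.
    rewrite negb_and -!leNgt => h.
    have [->|->] : u = 0 \/ u = 1 by move: u01 h => /andP[? ?] /orP[]; lra.
      by rewrite side_pt0 pd_map_vertex.
    by rewrite side_pt1 pd_map_vertex.
  have [||||E'|E'] := @interior_fiber P (arc_side P i) u (side_pt v (arc_side P j) t).
  + exact: arc_side_neq0.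
  + by rewrite u0.
  + exact: pv.
  + exact: E.
  + have := side_pt_meet cv n2 _ u01' E'; rewrite (inj_eq (@arc_side_inj P)) eq_sym.
    by move=> /(_ ij) h; clear E'; exfalso; lra.
  + have h : 1 - u \in `[0, 1] by rewrite in_itv /=; lra.
    have := side_pt_meet cv n2 _ h E'; rewrite arc_side_pairing.
    by move=> /(_ isT) h'; clear E'; exfalso; lra.
Qed.

(** Distinctness and disjointness of the arcs come with the gluing, so that a polygon domain becomes
    an object as soon as its sides are shown to generate. *)
Lemma polygon_CG_set P : generating (fun i => side P (arc_side P i)) ->
  CG_set (fun i => side P (arc_side P i)).
Proof.
move=> gen; split=> //; last by eexists; exact: realized_by_polygon.
move=> i j /side_inj E; apply: (@arc_side_inj P); apply: E; exact: arc_side_neq0.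
Qed.

Lemma polygon_has_polygon P : has_polygon (fun i => side P (arc_side P i)) P.
Proof. by eexists; first exact: realized_by_polygon. Qed.

Definition polygon_object P (gen : generating (fun i => side P (arc_side P i))) :
    cs_object S :=
  CSObject (polygon_CG_set gen) (ex_intro _ P (polygon_has_polygon P)).

Lemma has_polygon_rep (X : cs_object S) P : has_polygon (rep X) P ->
  rep X = fun i => side P (arc_side P i).
Proof.
move=> [a [aX _ _] cut]; apply/funext => i; rewrite -aX.
by apply: loop_class_eq => t t01; exact: cut.
Qed.

Lemma cs_object_eq (X Y : cs_object S) : rep X = rep Y -> X = Y.
Proof.
case: X Y => [x x1 x2] [y y1 y2] /= E; subst y.
by rewrite (Prop_irrelevance x1 y1) (Prop_irrelevance x2 y2).
Qed.

Lemma object_polygon (X : cs_object S) : exists P, 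
  [/\ has_polygon (rep X) P, rep X = (fun i => side P (arc_side P i)) &
    generating (fun i => side P (arc_side P i))].
Proof.
have [P hP] := rep_canonical X; exists P; have E := has_polygon_rep hP.
by split=> //; rewrite -E; have [_] := rep_CG X.
Qed.

Lemma cs_hom_eq (X Y : cs_object S) (f h : cs_hom X Y) : f = h.
Proof.
have hom1 (A B : cs_object S) (k : cs_hom A B) : k 1%g = 1%g.
  by apply: (mulgI (k 1%g)); rewrite -hom_mul !mulg1.
have homV (A B : cs_object S) (k : cs_hom A B) u : k u^-1%g = (k u)^-1%g.
  by apply: (mulgI (k u)); rewrite -hom_mul !mulgV hom1.
have E : hom_fun f = hom_fun h.
  have [_ gen _] := rep_CG X; apply/funext => u; move: u.
  apply: (gen [set u | f u = h u]) => /=.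
  - by rewrite !hom1.
  - by move=> u w fu fw; rewrite !hom_mul fu fw.
  - by move=> u fu; rewrite !homV fu.
  - by move=> i; rewrite !hom_rep.
have E' : hom_inv f = hom_inv h.
  by apply/funext => u; rewrite -{1}(hom_invK h u) -E hom_funK.
case: f h E E' {hom1 homV} => [f1 f2 a b c d] [h1 h2 a' b' c' d'] /= E E'; subst h1 h2.
by rewrite (Prop_irrelevance a a') (Prop_irrelevance b b') (Prop_irrelevance c c')
  (Prop_irrelevance d d').
Qed.

Lemma cs_hom_exists (X Y : cs_object S) : exists f : cs_hom X Y, True.
Proof.
have hom (A B : cs_object S) : exists F : pi -> pi,
    {morph F : u w / (u * w)%g} /\ forall i, F (rep A i) = rep B i.
  have [P [_ -> _]] := object_polygon A.
  have [arc [arcP arc_pair arcK]] := arc_index P.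
  pose tau k := if (k < pd_pairing P k)%N then rep B (arc k) else (rep B (arc k))^-1%g.
  have [k k0|F [_ FM FE]] := @sides_hom _ _ _ g_gt0 P pi 1%g *%g tau.
    rewrite /tau arc_pair // pairingK; have := pairing_neq P k0; rewrite -val_eqE /=.
    by case: ltngtP => // _ _; rewrite ?mulgV ?mulVg.
  exists F; split=> // i; rewrite FE ?arc_side_neq0 // /tau arc_side_lt.
  by rewrite arcK.
have [F [FM FE]] := hom X Y; have [G [GM GE]] := hom Y X.
have FGK (A B : cs_object S) (F' G' : pi -> pi) : {morph F' : u w / (u * w)%g} ->
    {morph G' : u w / (u * w)%g} -> (forall i, F' (rep A i) = rep B i) ->
    (forall i, G' (rep B i) = rep A i) -> cancel F' G'.
  move=> F'M G'M F'E G'E; have [_ gen _] := rep_CG A.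
  have hom1 (k : pi -> pi) : {morph k : u w / (u * w)%g} -> k 1%g = 1%g.
    by move=> kM; apply: (mulgI (k 1%g)); rewrite -kM !mulg1.
  have homV (k : pi -> pi) u : {morph k : u w / (u * w)%g} -> k u^-1%g = (k u)^-1%g.
    by move=> kM; apply: (mulgI (k u)); rewrite -kM !mulgV hom1.
  apply: (gen [set u | G' (F' u) = u]) => /=.
  - by rewrite !hom1.
  - by move=> u w fu fw; rewrite F'M G'M fu fw.
  - by move=> u fu; rewrite !homV ?fu.
  - by move=> i; rewrite F'E G'E.
by exists (CSHom (FGK _ _ _ _ FM GM FE GE) (FGK _ _ _ _ GM FM GE FE) FM FE).
Qed.

End Objects.

(** * Cutting off a triangle and gluing it back *)

Section Triangle.
Context {R : realType}.
Implicit Types a b c d z : R * R.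

Definition in_triangle a b c z : Prop :=
  [/\ orient a b z <= 0, orient b c z <= 0 & orient c a z <= 0].

Lemma in_triangle_rot a b c z : in_triangle a b c z -> in_triangle b c a z.
Proof. by case. Qed.

Lemma triangle_map_in a b c a' b' c' z :
    orient a b c < 0 -> orient a' b' c' < 0 -> in_triangle a b c z ->
  in_triangle a' b' c' (triangle_map a b c a' b' c' z).
Proof.
move=> abc abc' [h1 h2 h3]; have abc0 : orient a b c != 0 by rewrite lt_eqF.
have key x y : orient a b c != 0 ->
    (orient b c z * orient x y a' + orient c a z * orient x y b' +
    orient a b z * orient x y c' >= 0) ->
    orient x y (triangle_map a b c a' b' c' z) <= 0.
  move=> _; rewrite -orient_triangle_map // => h; rewrite leNgt; apply/negP => h'.
  by move: h; rewrite leNgt pmulr_rlt0 // abc.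
have e1 : orient b' c' a' <= 0 by rewrite -orient_rot ltW.
have e2 : orient c' a' b' <= 0 by rewrite -orient_rot -orient_rot ltW.
by split; apply: key => //; rewrite !orient_aba !orient_abb !mulr0 ?addr0 ?add0r mulr_le0 // ltW.
Qed.

Lemma in_triangle_base a b c z : orient a b c < 0 -> in_triangle a b c z ->
  orient c a z = 0 -> exists2 t, t \in `[0, 1] & z = seg_pt a c t.
Proof.
move=> D0 [h1 h2 h3] h.
have hs : orient a b z + orient b c z = orient a b c by move: h; rewrite /orient; lra.
have D0' : orient a b c != 0 by rewrite lt_eqF.
exists (orient a b z / orient a b c).
  rewrite in_itv /=; apply/andP; split.
    by rewrite mulr_le0 // invr_le0 ltW.
  by rewrite ler_ndivrMr // mul1r; lra.
have E1 : (z.1 - a.1) * orient a b c = orient a b z * (c.1 - a.1).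
  suff : (z.1 - a.1) * orient a b c - orient a b z * (c.1 - a.1) = orient c a z * (b.1 - a.1).
    by rewrite h mul0r => /eqP; rewrite subr_eq0 => /eqP.
  by rewrite /orient; ring.
have E2 : (z.2 - a.2) * orient a b c = orient a b z * (c.2 - a.2).
  suff : (z.2 - a.2) * orient a b c - orient a b z * (c.2 - a.2) = orient c a z * (b.2 - a.2).
    by rewrite h mul0r => /eqP; rewrite subr_eq0 => /eqP.
  by rewrite /orient; ring.
rewrite [LHS]surjective_pairing /seg_pt; congr pair; apply: (mulIf D0').
  transitivity ((z.1 - a.1) * orient a b c + a.1 * orient a b c); first by ring.
  by rewrite E1; field.
transitivity ((z.2 - a.2) * orient a b c + a.2 * orient a b c); first by ring.
by rewrite E2; field.
Qed.

Lemma polygon_insert_triangle n (r : 'I_n) q (v : 'I_n -> R * R) z :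
    (2 < n)%N -> clockwise (insert_vertex r q v) ->
  polygon (insert_vertex r q v) z /\ 0 <= orient (v r) (v (ordS r)) z <->
  in_triangle (v r) q (v (ordS r)) z.
Proof.
move=> n2 cV; split=> [[/polygon_insertP[_ h1 h2] h]|[h1 h2 h3]].
  by split=> //; rewrite orient_swap oppr_le0.
have h : 0 <= orient (v r) (v (ordS r)) z by rewrite orient_swap oppr_ge0.
by split=> //; apply: triangle_insert.
Qed.

End Triangle.

Lemma glued_sym (R : realType) g (v : 'I_(4 * g).+1 -> R * R) s z w :
  side_pairing s -> glued v s z w -> glued v s w z.
Proof.
move=> [sK s0 sN] [->|[i [j [-> ->]]]|[k [t [k0 t01 -> ->]]]].
- exact: Or31.
- by apply: Or32; exists j, i.
- apply: Or33; exists (s k), (1 - t); rewrite sK subKr; split=> //.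
    by apply: contra k0 => /eqP h; rewrite -[k]sK h s0.
  by move: t01; rewrite !in_itv /=; lra.
Qed.

Section Slide.
Context {R : realType} {g : nat} {S : surface R g}.
Hypothesis g_gt0 : (0 < g)%N.
Local Notation sides := 'I_(4 * g).+1.
Variables (P : polygon_domain S) (rb : 'I_(4 * g)) (c : bool).
Local Notation v := (pd_vertex P).
Local Notation s := (pd_pairing P).
Local Notation f := (pd_map P).
(* The triangle cut off has its apex at the vertex [b], between the sides [L]
   and [b]; it is reattached along the partner [l] of [k]. The vertices of the
   rest of the polygon are [vq]. *)
Let b : sides := lift ord0 rb.
Let L : sides := lift b rb.
Hypothesis rb_gt0 : (0 < rb)%N.
Hypothesis not_adjacent : s L != b.
Let k : sides := if c then L else b.
(** After the gluing [k] and [l] lie inside the new polygon, while [m] remains on its boundary. *)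
Let m : sides := if c then b else L.
Let l : sides := s k.
Let vq : 'I_(4 * g) -> R * R := v \o lift b.
Local Notation e := (v b).
Local Notation c0 := (vq rb).
Local Notation d := (vq (ordS rb)).

Let n2 : (2 < 4 * g)%N. Proof. lia. Qed.
Let cv : clockwise v := @pd_cw _ _ _ P.
Let vE : v = insert_vertex rb e vq := insert_vertexE rb v.
Let cv' : clockwise (insert_vertex rb e vq). Proof. by rewrite -vE. Qed.
Let cq : clockwise vq := clockwise_remove rb cv.
Let sK : involutive s := @pairingK _ _ _ P.

Let bL : (b == L) = false. Proof. by apply/negbTE; rewrite neq_lift. Qed.
Let b_neq0 : b != ord0. Proof. by []. Qed.
Let L_neq0 : L != ord0.
Proof. by rewrite -val_eqE /= /bump /= add1n ltnn add0n -lt0n. Qed.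
Let k_neq0 : k != ord0. Proof. by rewrite /k; case: c. Qed.
Let l_neq0 : l != ord0. Proof. by rewrite /l pairing_eq0. Qed.
Let lN : (l != L) && (l != b).
Proof.
rewrite /l /k; case: c; rewrite ?not_adjacent ?pairing_neq ?andbT //.
by apply: contra not_adjacent => /eqP <-; rewrite sK.
Qed.
Let km : (k == m) = false. Proof. by rewrite /k /m; case: c; rewrite // eq_sym bL. Qed.
Let lk : (l == k) = false. Proof. exact/negbTE/pairing_neq. Qed.
Let lm : (l == m) = false.
Proof. by have /andP[/negbTE h1 /negbTE h2] := lN; rewrite /m; case: c. Qed.

Let cor (x : sides) : x = L \/ x = b -> x = k \/ x = m.
Proof. by rewrite /k /m; case: c => -[->|->]; [left|right|right|left]. Qed.

Let side_v r t : r != rb -> side_pt v (lift b r) t = side_pt vq r t.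
Proof. by move=> rrb; rewrite {1}vE side_pt_insert. Qed.

Let side_L t : side_pt v L t = seg_pt c0 e t.
Proof. by rewrite {1}vE side_pt_insert_left. Qed.

Let side_b t : side_pt v b t = seg_pt e d t.
Proof. by rewrite {1}vE side_pt_insert_right. Qed.

Let polygon_vq z : polygon vq z -> polygon v z.
Proof. by move=> h; rewrite vE; apply: polygon_insert. Qed.

Let ced : orient c0 e d < 0.
Proof. exact: (insert_new_left cv' (ordS_neq _ (ltnW n2))). Qed.

Let v_in z : polygon v z -> orient c0 d z <= 0 -> polygon vq z.
Proof. by rewrite {1}vE; exact: polygon_of_insert. Qed.

Let v_out z : polygon v z /\ 0 <= orient c0 d z <-> in_triangle c0 e d z.
Proof. by rewrite {1}vE; exact: polygon_insert_triangle. Qed.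

Let vertex_pt (j : sides) (t : R) : t = 0 \/ t = 1 -> exists i, side_pt v j t = v i.
Proof.
by case=> ->; [exists j; rewrite side_pt0|exists (ordS j); rewrite side_pt1].
Qed.

Let vertex_in (i : sides) : orient c0 d (v i) <= 0 -> exists r, v i = vq r.
Proof.
move=> h; case: (unliftP b i) => [r ->|E]; first by exists r.
by have := insert_outside n2 cv'; rewrite ltNge -E h.
Qed.

Let chord_lt (r : 'I_(4 * g)) : r != rb -> r != ordS rb -> orient c0 d (vq r) < 0.
Proof. exact: clockwise_side. Qed.

Let vertex_out (i : sides) : 0 <= orient c0 d (v i) -> [\/ v i = c0, v i = e | v i = d].
Proof.
case: (unliftP b i) => [r ->|->] h; last by apply: Or32.
have [->|h1] := eqVneq r rb; first by apply: Or31.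
have [->|h2] := eqVneq r (ordS rb); first by apply: Or33.
by have := chord_lt h1 h2; rewrite ltNge => /negP[].
Qed.

Let in01 (t : R) : t \in `[0, 1] -> 0 <= t /\ t <= 1.
Proof. by rewrite in_itv /= => /andP. Qed.

Let side_in (j : sides) t : t \in `[0, 1] -> orient c0 d (side_pt v j t) <= 0 ->
  (exists2 r, r != rb & j = lift b r) \/ (t = 0 \/ t = 1).
Proof.
move=> /in01[t0 t1] h; have ed : 0 < orient c0 d e := insert_outside n2 cv'.
case: (unliftP b j) => [r E|E]; last first.
  right; right; move: h; rewrite E side_b orient_seg orient_abb mulr0 addr0.
  by rewrite pmulr_lle0 // subr_le0 => h; apply/le_anti; rewrite t1.
have [rE|rrb] := eqVneq r rb; last by left; exists r.
right; left; move: h; rewrite E rE side_L orient_seg orient_aba mulr0 add0r.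
by rewrite pmulr_lle0 // => h; apply/le_anti; rewrite h.
Qed.

Let side_out (j : sides) t : t \in `[0, 1] -> 0 <= orient c0 d (side_pt v j t) ->
  (j = L \/ j = b) \/ (t = 0 \/ t = 1).
Proof.
move=> /in01[t0 t1] h.
case: (unliftP b j) => [r E|E]; last by left; right.
have [rE|rrb] := eqVneq r rb; first by left; left; rewrite E rE.
right; move: h; rewrite E side_v // side_ptE orient_seg.
have [->|rS] := eqVneq r (ordS rb).
  rewrite orient_abb mulr0 add0r.
  have h : orient c0 d (vq (ordS (ordS rb))) < 0.
    by apply: chord_lt; [exact: ordS2_neq|exact: ordS_neq (ltnW n2)].
  by rewrite nmulr_lge0 // => h'; left; apply/le_anti; rewrite h'.
have h1 := chord_lt rrb rS.
have h2 : orient c0 d (vq (ordS r)) <= 0 := vertex_polygon (ordS r) cq rb.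
have h3 : t * orient c0 d (vq (ordS r)) <= 0 by rewrite mulr_ge0_le0.
move=> h; right; apply/le_anti; rewrite t1 /= -subr_le0.
rewrite -(nmulr_lge0 _ h1); apply: le_trans h _.
by rewrite gerDl.
Qed.

Section Reattach.
Variables (ra : 'I_(4 * g)) (q : R * R).
Hypothesis l_lift : l = lift b ra.
Hypothesis cV : clockwise (insert_vertex ra q vq).
Let a : sides := lift ord0 ra.
Local Notation V := (insert_vertex ra q vq).
Local Notation vl := (vq ra).
Local Notation vl' := (vq (ordS ra)).

Let ra_rb : ra != rb.
Proof.
by apply/eqP => E; have /andP[+ _] := lN; rewrite l_lift E /L eqxx.
Qed.

Let ra_gt0 : (0 < ra)%N.
Proof.
rewrite lt0n; apply: contra l_neq0 => /eqP E; rewrite l_lift -val_eqE /= /bump /= E.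
by rewrite add1n.
Qed.

(** Leads from the new triangle to the old one. The base, which is side [l], goes to side [k]
    reversed, as the old gluing demands; the other two sides go to the diagonal and to [m]. *)
Let tau : R * R -> R * R := if c then triangle_map vl q vl' e d c0
  else triangle_map vl q vl' d c0 e.
Let tau' : R * R -> R * R := if c then triangle_map e d c0 vl q vl'
  else triangle_map d c0 e vl q vl'.

Let lql : orient vl q vl' < 0.
Proof. exact: (insert_new_left cV (ordS_neq _ (ltnW n2))). Qed.

Let edc : orient e d c0 < 0. Proof. by rewrite -orient_rot. Qed.
Let dce : orient d c0 e < 0. Proof. by rewrite -orient_rot. Qed.

Let tau_in z : in_triangle vl q vl' z -> in_triangle c0 e d (tau z).
Proof.
rewrite /tau; case: c => h.
  by apply/in_triangle_rot/in_triangle_rot; apply: triangle_map_in.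
by apply/in_triangle_rot; apply: triangle_map_in.
Qed.

Let tau'_in z : in_triangle c0 e d z -> in_triangle vl q vl' (tau' z).
Proof.
rewrite /tau'; case: c => h; apply: triangle_map_in => //.
  exact: in_triangle_rot.
by do 2! apply: in_triangle_rot.
Qed.

Let tauK : cancel tau tau'.
Proof. by rewrite /tau /tau'; case: c => z; rewrite triangle_mapK // lt_eqF. Qed.

Let tau'K : cancel tau' tau.
Proof. by rewrite /tau /tau'; case: c => z; rewrite triangle_mapK // lt_eqF. Qed.

(** The new side that copies the diagonal; [im] is the one that copies [m]. *)
Let il : sides := if c then a else lift a ra.
Let im : sides := if c then lift a ra else a.

Let tau_l t : tau (side_pt V il t) = seg_pt d c0 t.
Proof.
rewrite /tau /il; case: c; rewrite ?side_pt_insert_left ?side_pt_insert_right.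
  by have [|_ -> _] := @triangle_map_seg R vl q vl' e d c0 t; rewrite ?lt_eqF.
by have [|-> _ _] := @triangle_map_seg R vl q vl' d c0 e t; rewrite ?lt_eqF.
Qed.

Let tau_m t : tau (side_pt V im t) = side_pt v m t.
Proof.
rewrite /tau /im /m; case: c; rewrite ?side_pt_insert_left ?side_pt_insert_right.
  by rewrite side_b; have [|-> _ _] := @triangle_map_seg R vl q vl' e d c0 t; rewrite ?lt_eqF.
by rewrite side_L; have [|_ -> _] := @triangle_map_seg R vl q vl' d c0 e t; rewrite ?lt_eqF.
Qed.

Let tau_base t : tau (seg_pt vl vl' t) = side_pt v k (1 - t).
Proof.
rewrite -[t in LHS](subKr 1) seg_ptC /tau /k; case: c.
  by rewrite side_L; have [|_ _ ->] := @triangle_map_seg R vl q vl' e d c0 (1 - t); rewrite ?lt_eqF.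
by rewrite side_b; have [|_ _ ->] := @triangle_map_seg R vl q vl' d c0 e (1 - t); rewrite ?lt_eqF.
Qed.

(** Each new side inherits the name of an old one: the diagonal on the remaining polygon is called
    [k], its copy on the triangle [l], and all other sides keep their names. The new pairing is then
    the old one conjugated. *)
Let beta : {perm sides} := (lift_perm a b 1 * tperm b (lift b (if c then ra else rb)))%g.

Let beta_other r : r != ra -> r != rb -> beta (lift a r) = lift b r.
Proof.
move=> h1 h2; rewrite permM lift_perm_lift perm1 tpermD ?neq_lift //.
by rewrite (inj_eq lift_inj) eq_sym; case: c.
Qed.

Let beta_k : beta (lift a rb) = k.
Proof.
rewrite permM lift_perm_lift perm1 /k; case: c; last by rewrite tpermR.
by rewrite tpermD ?neq_lift // (inj_eq lift_inj).
Qed.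

Let beta_l : beta il = l.
Proof.
rewrite permM /il l_lift; case: c; first by rewrite lift_perm_id tpermL.
by rewrite lift_perm_lift perm1 tpermD ?neq_lift // (inj_eq lift_inj) eq_sym.
Qed.

Let beta_m : beta im = m.
Proof.
rewrite permM /im /m; case: c; last by rewrite lift_perm_id tpermL.
by rewrite lift_perm_lift perm1 tpermR.
Qed.

Let beta0 : beta ord0 = ord0.
Proof.
have g4 : (0 < 4 * g)%N by apply: leq_ltn_trans n2.
pose o := Ordinal g4.
have la : lift a o = ord0 by apply: val_inj.
have lb : lift b o = ord0 by apply: val_inj.
rewrite -{1}la beta_other ?lb // -val_eqE /= eq_sym -lt0n //.
Qed.

Let s' (i : sides) : sides := (beta^-1)%g (s (beta i)).

Let s'_pairing : side_pairing s'.
Proof.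
split.
- by move=> i; rewrite /s' permKV sK permK.
- by rewrite /s' beta0 pairing0 -{1}beta0 permK.
- move=> i i0; rewrite /s' -(inj_eq (@perm_inj _ beta)) permKV pairing_neq //.
  by rewrite -beta0 (inj_eq (@perm_inj _ beta)).
Qed.

(** The test is whether [z] lies on the inner side of the base; the shift by 1/2 gives it the form
    of [within_if]. *)
Let f' (z : R * R) : S := if orient vl vl' z + 2^-1 <= 2^-1 then f z else f (tau z).

Let f'_in z : orient vl vl' z <= 0 -> f' z = f z.
Proof. by rewrite /f' gerDr => ->. Qed.

Let f'_out z : in_triangle vl q vl' z -> f' z = f (tau z).
Proof.
move=> h; rewrite /f' gerDr; case: ifPn => // h0.
have [_ _ h1] := h; rewrite orient_swap oppr_le0 in h1.
have z0 : orient vl' vl z = 0 by rewrite orient_swap; lra.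
have [t t01 ->] := in_triangle_base lql h z0; rewrite tau_base.
have -> : seg_pt vl vl' t = side_pt v l t by rewrite l_lift side_v.
by rewrite (pd_map_pairing P l_neq0) // /l sK.
Qed.

Let V_in z : polygon V z -> orient vl vl' z <= 0 -> polygon vq z.
Proof. exact: polygon_of_insert. Qed.

Let V_out z : polygon V z /\ 0 <= orient vl vl' z <-> in_triangle vl q vl' z.
Proof. exact: polygon_insert_triangle. Qed.

Let f'_continuous : {within polygon V, continuous f'}.
Proof.
have cf := pq_continuous (pd_quotient P).
apply: (@within_if R _ S (polygon V) (fun z => orient vl vl' z + 2^-1) f (f \o tau)).
- exact: closed_polygon.
- by move=> z; apply: cvgD; [exact: continuous_orient|exact: cvg_cst].
- apply: continuous_subspaceW cf => z [Vz /=]; rewrite gerDr => h.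
  by apply: polygon_vq; apply: V_in.
- apply: within_comp cf _ _.
    by apply: continuous_subspaceT; rewrite /tau; case: c; exact: continuous_triangle_map.
  move=> z [Vz /=]; rewrite lerDr => h.
  have /tau_in/v_out[] // : in_triangle vl q vl' z by apply/V_out.
- move=> z Vz h; have h0 : orient vl vl' z = 0 by lra.
  have ht : in_triangle vl q vl' z by apply/V_out; rewrite h0 lexx.
  by rewrite /= -f'_out // f'_in // h0.
Qed.

Let f'_surjective x : exists2 z, polygon V z & f' z = x.
Proof.
have [y py <-] := pq_surjective (pd_quotient P) x.
have [h|h] := leP (orient c0 d y) 0.
  have pq := v_in py h; exists y; first exact: polygon_insert.
  by rewrite f'_in //; exact: pq.
have /tau'_in ht : in_triangle c0 e d y by apply/v_out; rewrite ltW.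
exists (tau' y); first by have [] := (V_out _).2 ht.
by rewrite f'_out // tau'K.
Qed.

Let f'_vertex i : f' (V i) = basepoint S.
Proof.
case: (unliftP a i) => [r ->|->].
  rewrite insert_vertex_lift f'_in ?pd_map_vertex //.
  exact: (vertex_polygon r cq).
rewrite insert_vertex_new f'_out; last first.
  by split; rewrite ?orient_abb ?orient_aba ?lexx // orient_rot ltW.
have [t t01 {1}<-] : exists2 t, t = 0 \/ t = 1 & side_pt V im t = q.
  rewrite /im; case: c; [exists 1; first by right|exists 0; first by left].
    by rewrite side_pt_insert_left seg_pt1.
  by rewrite side_pt_insert_right seg_pt0.
by rewrite tau_m; have [i' ->] := vertex_pt m t01; rewrite pd_map_vertex.
Qed.

(* The position in the old polygon of the point of parameter [t] on a side of
   the new one. *)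
Let old_pt (i : sides) (t : R) : R * R :=
  if beta i == k then seg_pt c0 d t else
  if beta i == l then seg_pt d c0 t else side_pt v (beta i) t.

Let il_or i : i != il -> i != im -> exists2 r, r != ra & i = lift a r.
Proof.
move=> h1 h2; case: (unliftP a i) => [r E|E].
  exists r => //; apply: contraTneq isT => rE.
  by move: h1 h2; rewrite /il /im E rE; case: c; rewrite eqxx.
by move: h1 h2; rewrite /il /im E; case: c; rewrite eqxx.
Qed.

Let in_new i t : i = il \/ i = im -> t \in `[0, 1] ->
  in_triangle vl q vl' (side_pt V i t).
Proof.
move=> h t01; apply/V_out; split; first exact: side_polygon.
have [t0 t1] := in01 t01.
have q0 := insert_outside n2 cV.
have [->|->] : i = lift a ra \/ i = a.
  by move: h; rewrite /il /im; case: c => -[->|->]; [right|left|left|right].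
  by rewrite side_pt_insert_left orient_seg orient_aba mulr0 add0r mulr_ge0 // ltW.
rewrite side_pt_insert_right orient_seg orient_abb mulr0 addr0 mulr_ge0 //.
  by rewrite subr_ge0.
exact: ltW.
Qed.

Let tau_old i t : i = il \/ i = im -> tau (side_pt V i t) = old_pt i t.
Proof.
case=> ->; rewrite /old_pt ?beta_l ?beta_m ?tau_l ?tau_m.
  by rewrite lk eqxx.
by rewrite eq_sym km eq_sym lm.
Qed.

Let other_old r t : r != ra -> side_pt V (lift a r) t = old_pt (lift a r) t.
Proof.
move=> rra; rewrite side_pt_insert // /old_pt.
have [->|rrb] := eqVneq r rb; first by rewrite beta_k eqxx.
rewrite beta_other // l_lift (inj_eq lift_inj) (negbTE rra) side_v // ifF //.
apply/negbTE; rewrite /k; case: c; first by rewrite (inj_eq lift_inj).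
by rewrite eq_sym neq_lift.
Qed.

Let f'_side i t : t \in `[0, 1] -> f' (side_pt V i t) = f (old_pt i t).
Proof.
move=> t01; have [ii|] := eqVneq i il.
  by rewrite f'_out ?tau_old //; [left|apply: in_new => //; left].
have [ii|im' il'] := eqVneq i im.
  by rewrite f'_out ?tau_old //; [right|apply: in_new => //; right].
have [r rra ->] := il_or il' im'.
rewrite f'_in other_old // -other_old // side_pt_insert //.
exact: (side_polygon r cq t01 ra).
Qed.

Let beta_neq0 i : (beta i != ord0) = (i != ord0).
Proof. by rewrite -{1}beta0 (inj_eq (@perm_inj _ beta)). Qed.

Let beta_s' i : beta (s' i) = s (beta i).
Proof. by rewrite /s' permKV. Qed.

Let glued_f' z w : glued V s' z w -> f' z = f' w.
Proof.
case=> [->//|[i [j [-> ->]]]|[i [t [i0 t01 -> ->]]]]; first by rewrite !f'_vertex.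
have t01' : 1 - t \in `[0, 1] by move: t01; rewrite !in_itv /=; lra.
rewrite !f'_side // /old_pt beta_s'.
have [->|ik] := eqVneq (beta i) k; first by rewrite -/l lk eqxx seg_ptC.
have [->|il'] := eqVneq (beta i) l.
  by rewrite /l sK eqxx seg_ptC.
rewrite [s _ == k](_ : _ = false); last first.
  by apply: contraNF il' => /eqP E; rewrite /l -E sK.
rewrite [s _ == l](_ : _ = false); last first.
  by rewrite /l (inj_eq (inv_inj sK)); apply/negbTE.
by apply: pd_map_pairing; rewrite ?beta_neq0.
Qed.

Let tau_vertex x : [\/ x = c0, x = e | x = d] -> exists i, x = tau (V i).
Proof.
have Vl : V (lift a ra) = vl by rewrite insert_vertex_lift.
have Vl' : V (lift a (ordS ra)) = vl' by rewrite insert_vertex_lift.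
have Vq : V a = q by rewrite insert_vertex_new.
have D0 : orient vl q vl' != 0 by rewrite lt_eqF.
have vals a' b' c' : [/\ triangle_map vl q vl' a' b' c' vl = a',
    triangle_map vl q vl' a' b' c' q = b' & triangle_map vl q vl' a' b' c' vl' = c'].
  by have [] := triangle_map_seg a' b' c' 0 D0; rewrite !seg_pt0.
rewrite /tau; case: c => -[->|->|->].
- by exists (lift a (ordS ra)); rewrite Vl'; have [_ _ ->] := vals e d c0.
- by exists (lift a ra); rewrite Vl; have [-> _ _] := vals e d c0.
- by exists a; rewrite Vq; have [_ -> _] := vals e d c0.
- by exists a; rewrite Vq; have [_ -> _] := vals d c0 e.
- by exists (lift a (ordS ra)); rewrite Vl'; have [_ _ ->] := vals d c0 e.
- by exists (lift a ra); rewrite Vl; have [-> _ _] := vals d c0 e.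
Qed.

Let new_vertex_in z : polygon vq z -> (exists i, z = v i) -> exists i, z = V i.
Proof.
move=> qz [i zE]; have := qz rb; rewrite /= zE => /vertex_in[r ->].
by exists (lift a r); rewrite insert_vertex_lift.
Qed.

Let new_vertex_out z : in_triangle vl q vl' z -> (exists i, tau z = v i) ->
  exists i, z = V i.
Proof.
move=> /tau_in/v_out[_ h] [i zE]; move: h; rewrite zE => /vertex_out.
by rewrite -zE => /tau_vertex[j /(can_inj tauK) ->]; exists j.
Qed.

Let glue_vertices z w : (exists i, z = V i) -> (exists i, w = V i) -> glued V s' z w.
Proof. by move=> [i ->] [j ->]; apply: Or32; exists i, j. Qed.

Let flip (t : R) : t = 0 \/ t = 1 -> 1 - t = 0 \/ 1 - t = 1.
Proof. by case=> ->; [right; rewrite subr0|left; rewrite subrr]. Qed.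

Let flip01 (t : R) : t \in `[0, 1] -> 1 - t \in `[0, 1].
Proof. by rewrite !in_itv /=; lra. Qed.

Let lift_cor r : r != rb -> lift b r = L \/ lift b r = b -> False.
Proof.
move=> rrb; case=> [/lift_inj E|/eqP]; first by rewrite E eqxx in rrb.
by rewrite eq_sym (negbTE (neq_lift _ _)).
Qed.

Let cor_neq : k = L \/ k = b. Proof. by rewrite /k; case: c; [left|right]. Qed.

Let glued_in z w : polygon vq z -> polygon vq w -> glued v s z w -> glued V s' z w.
Proof.
move=> qz qw [->|[i [j [zE wE]]]|[j [t [j0 t01 zE wE]]]]; first exact: Or31.
  by apply: glue_vertices; apply: new_vertex_in => //; [exists i|exists j].
have ends : t = 0 \/ t = 1 -> glued V s' z w.
  move=> h; apply: glue_vertices; apply: new_vertex_in => //.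
    by rewrite zE; exact: vertex_pt.
  by rewrite wE; apply: vertex_pt; exact: flip.
have hz : orient c0 d (side_pt v j t) <= 0 by rewrite -zE; exact: (qz rb).
have hw : orient c0 d (side_pt v (s j) (1 - t)) <= 0 by rewrite -wE; exact: (qw rb).
have [[r rrb jE]|] := side_in t01 hz; last exact: ends.
have [[r' r'rb sjE]|h] := side_in (flip01 t01) hw; last first.
  by apply: ends; have := flip h; rewrite subKr.
have rra : r != ra.
  apply/eqP => rE; have E : s j = k by rewrite jE rE -l_lift /l sK.
  by apply: (lift_cor r'rb); rewrite -sjE E.
have r'ra : r' != ra.
  apply/eqP => rE; have E : j = k by rewrite -[j]sK sjE rE -l_lift /l sK.
  by apply: (lift_cor rrb); rewrite -jE E.
apply: Or33; exists (lift a r), t; split=> //.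
- by rewrite -beta_neq0 beta_other // -jE.
- by rewrite zE jE side_v // side_pt_insert.
- have -> : s' (lift a r) = lift a r'.
    by apply: (@perm_inj _ beta); rewrite beta_s' !beta_other // -jE.
  by rewrite wE sjE side_v // side_pt_insert.
Qed.

(** Away from vertices, two distinct glued points of the triangle would lie on [L] and [b] and make
    these partners, which [not_adjacent] excludes. *)
Let glued_out z w : in_triangle vl q vl' z -> in_triangle vl q vl' w ->
  glued v s (tau z) (tau w) -> glued V s' z w.
Proof.
move=> tz tw [/(can_inj tauK) ->|[i [j [zE wE]]]|[j [t [j0 t01 zE wE]]]]; first exact: Or31.
  by apply: glue_vertices; apply: new_vertex_out => //; [exists i|exists j].
have ends : t = 0 \/ t = 1 -> glued V s' z w.
  move=> h; apply: glue_vertices; apply: new_vertex_out => //.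
    by rewrite zE; exact: vertex_pt.
  by rewrite wE; apply: vertex_pt; exact: flip.
have /tau_in/v_out[_] := tz; rewrite zE => /(side_out t01)[jc|]; last exact: ends.
have /tau_in/v_out[_] := tw; rewrite wE => /(side_out (flip01 t01))[sjc|h]; last first.
  by apply: ends; have := flip h; rewrite subKr.
have sj := pairing_neq P j0; exfalso.
case: jc sjc sj => -> [E|E]; rewrite ?E ?eqxx // => _.
- by move: not_adjacent; rewrite E eqxx.
- by move: not_adjacent; rewrite -E sK eqxx.
Qed.

(** Apart from vertices, a point of the remaining polygon meets one of the triangle in three ways:
    on the diagonal, now a pair of sides; along [l] and [k], now an inner line on which the two
    points coincide; or along [m] and its partner, still a pair. *)
Let glued_mixed z w : polygon vq z -> in_triangle vl q vl' w ->
  glued v s z (tau w) -> glued V s' z w.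
Proof.
move=> qz tw; have [_ hw] := (v_out _).2 (tau_in tw).
have il_ik : s' (lift a rb) = il.
  by apply: (@perm_inj _ beta); rewrite beta_s' beta_k beta_l.
case=> [zE|[i [j [zE wE]]]|[j [t [j0 t01 zE wE]]]].
- have hz : orient d c0 z = 0.
    apply/eqP; rewrite orient_swap oppr_eq0; apply/eqP/le_anti.
    by rewrite {2}zE hw andbT; exact: (qz rb).
  have tz : in_triangle c0 e d z by rewrite zE; exact: tau_in.
  have [t t01 zt] := in_triangle_base ced tz hz.
  apply: Or33; exists (lift a rb), t; split=> //.
  + by rewrite -beta_neq0 beta_k.
  + by rewrite zt side_pt_insert // eq_sym.
  + rewrite il_ik; apply: (can_inj tauK); rewrite -zE tau_l zt.
    by rewrite seg_ptC.
- apply: glue_vertices; first by apply: new_vertex_in => //; exists i.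
  by apply: new_vertex_out => //; exists j.
have ends : t = 0 \/ t = 1 -> glued V s' z w.
  move=> h; apply: glue_vertices.
    by apply: new_vertex_in => //; rewrite zE; exact: vertex_pt.
  by apply: new_vertex_out => //; rewrite wE; apply: vertex_pt; exact: flip.
have hz : orient c0 d (side_pt v j t) <= 0 by rewrite -zE; exact: (qz rb).
have [[r rrb jE]|] := side_in t01 hz; last exact: ends.
rewrite wE in hw; have [|h] := side_out (flip01 t01) hw; last first.
  by apply: ends; have := flip h; rewrite subKr.
move=> /cor[sjE|sjE].
  apply: Or31; apply: (can_inj tauK); rewrite wE sjE.
  have rE : r = ra by apply: (@lift_inj _ b); rewrite -jE -l_lift /l -sjE sK.
  by rewrite zE jE side_v // rE side_ptE tau_base.
have rra : r != ra.
  apply/eqP => rE; have E : s j = k by rewrite jE rE -l_lift /l sK.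
  by have := km; rewrite -E sjE eqxx.
apply: Or33; exists (lift a r), t; split=> //.
- by rewrite -beta_neq0 beta_other // -jE.
- by rewrite zE jE side_v // side_pt_insert.
- have -> : s' (lift a r) = im.
    by apply: (@perm_inj _ beta); rewrite beta_s' beta_other // -jE sjE beta_m.
  by apply: (can_inj tauK); rewrite wE sjE tau_m.
Qed.

Let f'_fibers z w : polygon V z -> polygon V w -> f' z = f' w <-> glued V s' z w.
Proof.
move=> Vz Vw; split; last exact: glued_f'.
have fib := pq_fibers (pd_quotient P).
have in_v x : in_triangle vl q vl' x -> polygon v (tau x).
  by move=> /tau_in/v_out[].
have [hz|hz] := leP (orient vl vl' z) 0; have [hw|hw] := leP (orient vl vl' w) 0.
- have qz := V_in Vz hz; have qw := V_in Vw hw; rewrite !f'_in //.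
  by move=> /(fib _ _ (polygon_vq qz) (polygon_vq qw)); exact: glued_in.
- have qz := V_in Vz hz; have tw := (V_out w).1 (conj Vw (ltW hw)).
  rewrite f'_in // f'_out //.
  by move=> /(fib _ _ (polygon_vq qz) (in_v _ tw)); exact: glued_mixed.
- have qw := V_in Vw hw; have tz := (V_out z).1 (conj Vz (ltW hz)).
  rewrite f'_out // f'_in // => /(fib _ _ (in_v _ tz) (polygon_vq qw)).
  move=> /(glued_sym (pq_pairing (pd_quotient P))) /(glued_mixed qw tz).
  exact: (glued_sym s'_pairing).
- have tz := (V_out z).1 (conj Vz (ltW hz)); have tw := (V_out w).1 (conj Vw (ltW hw)).
  rewrite !f'_out // => /(fib _ _ (in_v _ tz) (in_v _ tw)); exact: glued_out.
Qed.

Let f'_quotient : polygon_quotient V s' f'.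
Proof.
by split.
Qed.

Let f'_boundary t : t \in `[0, 1] -> f' (side_pt V ord0 t) = boundary S t.
Proof.
move=> t01; rewrite f'_side // /old_pt beta0.
by rewrite eq_sym (negbTE k_neq0) eq_sym (negbTE l_neq0) pd_boundary.
Qed.

(** All that is kept of the geometry is the renaming [B]: the side called [k] now runs along the
    diagonal, and its partner runs back. *)
Lemma slide_reattach : exists (P' : polygon_domain S) (B : {perm sides}),
  [/\ B ord0 = ord0, forall i, pd_pairing P' i = (B^-1)%g (s (B i)) &
    forall i, side P' i = if B i == k then chord P L (ordS b) else
      if B i == l then chord P (ordS b) L else side P (B i)].
Proof.
exists (PolygonDomain f'_quotient f'_boundary), beta; split=> // i.
have vd : v (ordS b) = d by rewrite ordS_lift0.
case: ifPn => [/eqP Bk|Bk]; last case: ifPn => [/eqP Bl|Bl].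
- apply: loop_class_eq => t t01 /=; rewrite f'_side // /old_pt Bk eqxx.
  by rewrite vd.
- apply: loop_class_eq => t t01 /=; rewrite f'_side // /old_pt Bl eqxx.
  by rewrite vd lk.
- apply: loop_class_eq => t t01 /=; rewrite f'_side // /old_pt.
  by rewrite (negbTE Bk) (negbTE Bl).
Qed.

End Reattach.

End Slide.

(** * Moves as morphisms of the groupoid *)

Section Move.
Context {R : realType} {g : nat} {S : surface R g}.
Hypothesis g_gt0 : (0 < g)%N.
Local Notation sides := 'I_(4 * g).+1.
Local Notation pi := (pi1 (R := R) (basepoint S)).
Implicit Types (P : polygon_domain S) (i k : sides).

Lemma polygon_slide P i (c : bool) : i != ord0 -> (i < 4 * g)%N ->
    pd_pairing P i != ordS i ->
  let k := if c then i else ordS i in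
  exists (P' : polygon_domain S) (B : {perm sides}),
  [/\ B ord0 = ord0,
      forall j, pd_pairing P' j = (B^-1)%g (pd_pairing P (B j)) &
      forall j, side P' j = if B j == k then (side P i * side P (ordS i))%g else
        if B j == pd_pairing P k then (side P i * side P (ordS i))^-1%g
        else side P (B j)].
Proof.
move=> i0 ig adj k; pose rb := Ordinal ig.
have LE : lift (lift ord0 rb) rb = i.
  by apply: val_inj; rewrite /= /bump /= !add1n ltnn.
have bE : lift ord0 rb = ordS i.
  by apply: val_inj; rewrite /= /bump leq0n add1n modn_small.
have adj' : pd_pairing P (lift (lift ord0 rb) rb) != lift ord0 rb by rewrite LE bE.
have rb0 : (0 < rb)%N by rewrite lt0n.
have b0 : ordS i != ord0 by rewrite -bE.
have [ra raE] : exists ra, pd_pairing P k = lift (ordS i) ra.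
  case: (unliftP (ordS i) (pd_pairing P k)) => [ra ->|E]; first by exists ra.
  exfalso; move: E; rewrite /k; case: (c) => /eqP; first by rewrite (negbTE adj).
  by rewrite (negbTE (pairing_neq P b0)).
have n2 : (2 < 4 * g)%N by lia.
have [q cV] := insert_exists ra n2 (clockwise_remove rb (@pd_cw _ _ _ P)).
have l_lift : pd_pairing P (if c then lift (lift ord0 rb) rb else lift ord0 rb) =
    lift (lift ord0 rb) ra by rewrite LE bE.
have [P' [B [B0 BP BS]]] := slide_reattach g_gt0 rb0 adj' l_lift cV.
exists P', B; split=> // j; rewrite BS LE bE -/k.
have E : chord P i (ordS (ordS i)) = (side P i * side P (ordS i))%g.
  by rewrite !side_chord chord_mul.
rewrite E; case: ifP => // _; case: ifP => // _.
by apply: (mulgI (side P i * side P (ordS i))%g); rewrite mulgV -E chord_mul chord_id.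
Qed.

(** The new arcs still generate, because the replaced factor is recovered from the product and the
    other factor; so the new polygon is again an object. *)
Lemma cs_slide (X : cs_object S) P i (c : bool) : has_polygon (rep X) P ->
    i != ord0 -> (i < 4 * g)%N -> pd_pairing P i != ordS i ->
  let k := if c then i else ordS i in
  exists (Y : cs_object S) (P' : polygon_domain S) (B : {perm sides}),
  [/\ cs_move X Y, has_polygon (rep Y) P', B ord0 = ord0,
      forall j, pd_pairing P' j = (B^-1)%g (pd_pairing P (B j)) &
      forall j, side P' j = if B j == k then (side P i * side P (ordS i))%g else
        if B j == pd_pairing P k then (side P i * side P (ordS i))^-1%g
        else side P (B j)].
Proof.
move=> XP i0 ig adj k; have repX := has_polygon_rep XP.
have [P' [B [B0 BP BS]]] := polygon_slide c i0 ig adj.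
have iS0 : ordS i != ord0 by rewrite -val_eqE /= modn_small.
have iS : i != ordS i by rewrite eq_sym ordS_neq // ltnS; lia.
have sK := @pairingK _ _ _ P; set s := pd_pairing P in sK adj BP BS *.
have k0 : k != ord0 by rewrite /k; case: (c).
have Bs j : B (pd_pairing P' j) = s (B j) by rewrite BP permKV.
have Bneq0 j : (B j != ord0) = (j != ord0) by rewrite -{1}B0 (inj_eq (@perm_inj _ B)).
have gen : generating (fun n => side P' (arc_side P' n)).
  move=> H H1 HM HV HX; have [_ genX _] := rep_CG X; rewrite repX in genX.
  have HP' j : j != ord0 -> H (side P' j).
    move=> j0; have [n [<-|E]] := arc_side_ex g_gt0 P' j0; first exact: HX.
    have := HX n; rewrite E side_inv // => /HV.
    by rewrite invgK.
  have Hd : H (side P i * side P (ordS i))%g.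
    have := HP' ((B^-1)%g k); rewrite BS permKV eqxx; apply.
    by rewrite -Bneq0 permKV.
  have Hother j : j != ord0 -> j != k -> j != s k -> H (side P j).
    move=> j0 jk jl; have := HP' ((B^-1)%g j); rewrite BS permKV (negbTE jk) (negbTE jl).
    by apply; rewrite -Bneq0 permKV.
  have Hm : H (side P (if c then ordS i else i)).
    apply: Hother; rewrite /k; case: (c) => //; first by rewrite eq_sym.
      by rewrite eq_sym.
    by apply: contra adj => /eqP {1}->; rewrite sK.
  have Hk : H (side P k).
    move: Hm; rewrite /k; case: (c) => Hm.
      have -> : side P i = (side P i * side P (ordS i) * (side P (ordS i))^-1)%g.
        by rewrite mulgK.
      by apply: HM => //; exact: HV.
    have -> : side P (ordS i) = ((side P i)^-1 * (side P i * side P (ordS i)))%g.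
      by rewrite mulKg.
    by apply: HM => //; exact: HV.
  apply: genX => // n; have [->//|nk] := eqVneq (arc_side P n) k.
  have [->|nl] := eqVneq (arc_side P n) (s k); first by rewrite side_inv //; exact: HV.
  by apply: Hother => //; exact: arc_side_neq0.
exists (polygon_object g_gt0 gen), P', B; split=> //; last exact: polygon_has_polygon.
have [arc [arcP arc_pair arcK]] := arc_index g_gt0 P.
exists P, i, (ordS i), k, (arc k); split=> //.
- by split; rewrite ?lt0n //= modn_small.
- by rewrite /k; case: (c); [left|right].
- exact: arcP.
have arc_eq j j' : j != ord0 -> j' != ord0 -> arc j = arc j' -> j = j' \/ j = s j'.
  move=> j0 j'0 E; have := arcP _ j0; have := arcP _ j'0; rewrite -E -/s.
  by case=> -> [] => [->|->|->|/(inv_inj sK) ->]; [left|right; rewrite sK|right|left].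
have Barc0 n : B (arc_side P' n) != ord0 by rewrite Bneq0 arc_side_neq0.
have sig_inj : injective (fun n => arc (B (arc_side P' n))).
  move=> n n' /(arc_eq _ _ (Barc0 _) (Barc0 _)) [/perm_inj/(@arc_side_inj _ _ _ g_gt0)//|].
  by rewrite -Bs => /perm_inj /eqP; rewrite arc_side_pairing.
exists (perm sig_inj) => n; rewrite permE /= BS.
have [->|nk] := eqVneq (B (arc_side P' n)) k; first by rewrite eqxx; left.
have [->|nl] := eqVneq (B (arc_side P' n)) (s k).
  by rewrite arc_pair // eqxx; right.
rewrite ifF; last first.
  apply/eqP => /arc_eq[||E|E]; rewrite ?Barc0 //; first by rewrite E eqxx in nk.
  by rewrite E eqxx in nl.
rewrite repX; have [->|->] := arcP _ (Barc0 n); first by left.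
by right; rewrite side_inv // invgK.
Qed.

End Move.

(** * The Heisenberg group and the cycle of corners *)

(** Multiplication of unitriangular matrices of size 3 over the field with two elements, the
    components being the entries (1,2), (2,3) and (1,3). *)
Definition heis_mul (x y : bool * bool * bool) : bool * bool * bool :=
  (x.1.1 (+) y.1.1, x.1.2 (+) y.1.2, x.2 (+) y.2 (+) (x.1.1 && y.1.2)).

Lemma heis_mulA : associative heis_mul.
Proof.
by move=> [[a b] c] [[a' b'] c'] [[a1 b1] c1]; rewrite /heis_mul /=;
  case: a; case: b; case: c; case: a'; case: b'; case: c'; case: a1; case: b1; case: c1.
Qed.

Lemma heis_mul1 : left_id (false, false, false) heis_mul.
Proof. by move=> [[[] []] []]. Qed.

Lemma heis_mulr1 : right_id (false, false, false) heis_mul.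
Proof. by move=> [[[] []] []]. Qed.

HB.instance Definition _ :=
  Monoid.isLaw.Build _ (false, false, false) heis_mul heis_mulA heis_mul1 heis_mulr1.

(** Commutators are central, and the last entry is the determinant formed by the first two
    components of [x] and [y]. *)
Lemma heis_commutator x y x' y' :
    heis_mul x x' = (false, false, false) -> heis_mul y y' = (false, false, false) ->
  heis_mul (heis_mul (heis_mul x y) x') y' =
  (false, false, (x.1.1 && y.1.2) (+) (y.1.1 && x.1.2)).
Proof.
have inv u u' : heis_mul u u' = (false, false, false) ->
    u' = (u.1.1, u.1.2, u.2 (+) (u.1.1 && u.1.2)).
  by move: u u' => [[[] []] []] [[[] []] []].
by move=> /inv -> /inv ->; move: x y => [[[] []] []] [[[] []] []].
Qed.

Section Connected.
Context {R : realType} {g : nat} {S : surface R g}.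
Hypothesis g_gt0 : (0 < g)%N.
Local Notation sides := 'I_(4 * g).+1.
Local Notation pi := (pi1 (R := R) (basepoint S)).
Implicit Types (P Q : polygon_domain S) (k : sides).
Local Notation sides_generate P := (generating (fun i => side P (arc_side P i))).

Lemma bool_hom1 (h : pi -> bool) :
  (forall u w : pi, h (u * w)%g = h u (+) h w) -> h 1%g = false.
Proof. by move=> hM; have := hM 1%g 1%g; rewrite mulg1; case: (h 1%g). Qed.

Lemma bool_homV (h : pi -> bool) (u : pi) :
  (forall u w : pi, h (u * w)%g = h u (+) h w) -> h (u^-1)%g = h u.
Proof.
by move=> hM; have := hM u (u^-1)%g; rewrite mulgV bool_hom1 //; case: (h u); case: (h _).
Qed.

Lemma bool_hom_ext P (h h' : pi -> bool) : sides_generate P ->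
    (forall u w : pi, h (u * w)%g = h u (+) h w) ->
    (forall u w : pi, h' (u * w)%g = h' u (+) h' w) ->
    (forall i, h (side P (arc_side P i)) = h' (side P (arc_side P i))) ->
  forall u, h u = h' u.
Proof.
move=> gen hM h'M hh'; apply: (gen [set u | h u = h' u]) => /=.
- by rewrite !bool_hom1.
- by move=> u w e1 e2; rewrite hM h'M e1 e2.
- by move=> u e; rewrite !bool_homV.
- exact: hh'.
Qed.

Lemma bool_hom_exists P (y : 'I_(2 * g) -> bool) : exists2 h : pi -> bool,
  forall u w : pi, h (u * w)%g = h u (+) h w &
  forall i, h (side P (arc_side P i)) = y i.
Proof.
have [arc [_ arc_pair arcK]] := arc_index g_gt0 P.
have [k k0|h [_ hM hE]] := @sides_hom _ _ _ g_gt0 P bool false addb (fun k => y (arc k)).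
  by rewrite arc_pair //; exact: addbb.
by exists h => // i; rewrite hE ?arc_side_neq0 // arcK.
Qed.

(* Both polygons have the same number of arcs, so that restricting
   homomorphisms to the arcs of [Q], being onto, is also injective. *)
Lemma bool_hom_detect P Q (h : pi -> bool) : sides_generate P ->
    (forall u w : pi, h (u * w)%g = h u (+) h w) ->
    (forall i, h (side Q (arc_side Q i)) = false) ->
  forall u, h u = false.
Proof.
move=> gen hM hQ.
have /choice[H HP] : forall x : {ffun 'I_(2 * g) -> bool}, exists h : pi -> bool,
    (forall u w : pi, h (u * w)%g = h u (+) h w) /\
    forall i, h (side P (arc_side P i)) = x i.
  by move=> x; have [h' h1 h2] := bool_hom_exists P x; exists h'.
pose E (x : {ffun 'I_(2 * g) -> bool}) : {ffun 'I_(2 * g) -> bool} :=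
  [ffun i => H x (side Q (arc_side Q i))].
have E_onto y : exists x, E x = y.
  have [G GM GE] := bool_hom_exists Q y.
  exists [ffun i => G (side P (arc_side P i))]; apply/ffunP => i; rewrite ffunE -GE.
  apply: (bool_hom_ext gen) => //; first exact: (HP _).1.
  by move=> j; rewrite (HP _).2 ffunE.
have E_inj : injective E.
  by have /choice[E' E'K] := E_onto; apply: can_inj (canF_sym E'K).
pose x := [ffun i => h (side P (arc_side P i))].
have hx u : h u = H x u.
  by apply: (bool_hom_ext gen) => //; [exact: (HP _).1|move=> i; rewrite (HP _).2 ffunE].
pose z : {ffun 'I_(2 * g) -> bool} := [ffun i => false].
have hz u : H z u = false.
  by apply: (bool_hom_ext (h' := fun=> false) gen) => //; [exact: (HP _).1|move=> i; rewrite (HP _).2 ffunE].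
suff xz : x = z by move=> u; rewrite hx xz hz.
by apply: E_inj; apply/ffunP => i; rewrite !ffunE -hx hz hQ.
Qed.

Definition std_domain : polygon_domain S :=
  PolygonDomain (std_quotient S) (fun t _ => erefl).

(** The standard boundary word is a product of g commutators, so its image is central, and its last
    entry is the intersection number of the two classes given by the first two components of [F]. *)
Lemma std_prod (F : pi -> bool * bool * bool) :
    F 1%g = (false, false, false) ->
    (forall u w : pi, F (u * w)%g = heis_mul (F u) (F w)) ->
  F ((side std_domain ord0)^-1)%g = (false, false,
    \big[addb/false]_(0 <= m < g)
      ((F (side std_domain (inord (4 * m).+1))).1.1 && (F (side std_domain (inord (4 * m).+2))).1.2 (+)
       (F (side std_domain (inord (4 * m).+2))).1.1 && (F (side std_domain (inord (4 * m).+1))).1.2)).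
Proof.
move=> F1 FM.
pose t (i : nat) := F (side std_domain (inord i.+1)).
have -> : F ((side std_domain ord0)^-1)%g =
    \big[heis_mul/(false, false, false)]_(0 <= i < 4 * g) t i.
  rewrite -prod_sides // (big_morph F FM F1) big_mkord; apply: eq_bigr => i _.
  by rewrite /t; congr (F (side _ _)); apply: val_inj; rewrite /= inordK // ltnS ltn_ord.
have tV i j : (0 < i)%N -> (i <= 4 * g)%N -> (0 < j)%N -> (j <= 4 * g)%N ->
    std_pairing (inord i : sides) = inord j ->
    heis_mul (F (side std_domain (inord i))) (F (side std_domain (inord j))) = (false, false, false).
  move=> i0 ig j0 jg E; rewrite -E -FM.
  have i0' : (inord i : sides) != ord0 by rewrite -val_eqE /= inordK // -lt0n.
  by rewrite -[std_pairing _]/(pd_pairing std_domain _) side_inv // mulgV.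
suff key m : (m <= g)%N -> \big[heis_mul/(false, false, false)]_(0 <= i < 4 * m) t i =
    (false, false, \big[addb/false]_(0 <= i < m)
      ((t (4 * i)%N).1.1 && (t (4 * i).+1).1.2 (+) (t (4 * i).+1).1.1 && (t (4 * i)%N).1.2)).
  exact: key.
elim: m => [|m IH] mg; first by rewrite muln0 !big_geq.
have -> : (4 * m.+1 = (4 * m).+4)%N by lia.
rewrite !big_nat_recr //= IH ?(ltnW mg) //.
have std i : (0 < i)%N -> (i <= 4 * g)%N -> (i.-1 %% 4 < 2)%N ->
    std_pairing (inord i : sides) = inord i.+2.
  move=> i0 ig h; rewrite /std_pairing ifF; last first.
    by rewrite -val_eqE /= inordK // -[i]prednK.
  by rewrite inordK // h.
have m1 : (4 * m %% 4 = 0)%N by rewrite modnMr.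
have m2 : ((4 * m).+1 %% 4 = 1)%N by rewrite -addn1 -modnDml m1.
have e1 : heis_mul (t (4 * m)%N) (t (4 * m).+2) = (false, false, false).
  by apply: tV; rewrite ?std /= ?m1 //; lia.
have e2 : heis_mul (t (4 * m).+1) (t (4 * m).+3) = (false, false, false).
  by apply: tV; rewrite ?std /= ?m2 //; lia.
have := heis_commutator e1 e2; rewrite -!heis_mulA => ->.
by rewrite /heis_mul /= addbF.
Qed.

Section Corners.
Variables (P : polygon_domain S) (A : sides -> bool).
Local Notation s := (pd_pairing P).
Hypothesis gen : sides_generate P.
Hypothesis A0 : A ord0 = false.
(* Corner [i] lies between the sides [i] and [ordS i]; turning around the
   basepoint, it is followed by the corner after the partner of [ordS i]. *)
Hypothesis A_next : forall i, A (s (ordS i)) = A i.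
(** The corners [ord_pred j] and [j] sit at the start and at the end of side [j]. *)
Let h (j : sides) : bool := A (ord_pred j) (+) A j.
Let sK : involutive s := @pairingK _ _ _ P.

Let A_pred j : A (ord_pred j) = A (s j).
Proof. by rewrite -A_next ord_predK. Qed.

Let h_pair j : h (s j) = h j.
Proof. by rewrite /h !A_pred sK addbC. Qed.

Let H_ex : exists2 H : pi -> bool, forall u w : pi, H (u * w)%g = H u (+) H w &
  forall j, j != ord0 -> H (side P j) = h j.
Proof.
have [H HM HE] := bool_hom_exists P (fun i => h (arc_side P i)).
exists H => // j j0; have [i [<-|E]] := arc_side_ex g_gt0 P j0; first exact: HE.
by rewrite -h_pair -E -HE E side_inv // bool_homV.
Qed.

(* The class [h] is a coboundary, hence has intersection number zero with any
   class [K]. *)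
Let intersection_zero (H K : pi -> bool) :
    (forall u w : pi, H (u * w)%g = H u (+) H w) ->
    (forall j, j != ord0 -> H (side P j) = h j) ->
    (forall u w : pi, K (u * w)%g = K u (+) K w) ->
  \big[addb/false]_(0 <= m < g)
    (H (side std_domain (inord (4 * m).+1)) && K (side std_domain (inord (4 * m).+2)) (+)
     H (side std_domain (inord (4 * m).+2)) && K (side std_domain (inord (4 * m).+1))) = false.
Proof.
move=> HM HE KM.
(* A lift of the pair formed by [h] and [K] to the Heisenberg group. The last entry is zero on first
   sides and is forced on their partners, since (a, b, 0) has the inverse (a, b, ab). *)
pose tau (j : sides) := (h j, K (side P j),
  if (j < s j)%N then false else h j && K (side P j)).
have [j j0|F [F1 FM FE]] := @sides_hom _ _ _ g_gt0 P _ (false, false, false) heis_mul tau.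
  rewrite /tau h_pair side_inv // bool_homV // sK.
  have := pairing_neq P j0; rewrite -val_eqE /=; case: ltngtP => // _ _;
    rewrite /heis_mul /=; by case: (h j); case: (K _).
have F11 u : (F u).1.1 = H u.
  apply: (bool_hom_ext (h := fun u => (F u).1.1) gen) => // [u' w'|i]; first by rewrite FM.
  by rewrite FE ?HE ?arc_side_neq0.
have F12 u : (F u).1.2 = K u.
  apply: (bool_hom_ext (h := fun u => (F u).1.2) gen) => // [u' w'|i]; first by rewrite FM.
  by rewrite FE ?arc_side_neq0.
(* [h] telescopes, so the product of the sides before [j] has first entry [A (ord_pred j)], and
   [G j] is what multiplication by [tau j] adds to the last entry. Partners add the same amount,
   hence the total vanishes. *)
pose G j := (tau j).2 (+) (A (ord_pred j) && K (side P j)).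
have G_pair j : j != ord0 -> G (s j) = G j.
  move=> j0; rewrite /G /tau /= h_pair side_inv // bool_homV // sK !A_pred sK.
  have := pairing_neq P j0; rewrite -val_eqE /= /h A_pred; case: ltngtP => // _ _;
    by case: (A j); case: (A (s j)); case: (K _).
have sumG : \big[addb/false]_(j : sides | j != ord0) G j = false.
  rewrite (bigID (fun j : sides => (j < s j)%N)) /= [X in _ (+) X](reindex_inj (inv_inj sK)) /=.
  rewrite [X in _ (+) X](eq_big (fun j : sides => (j != ord0) && (j < s j)%N) G).
  - exact: addbb.
  - move=> j; rewrite sK pairing_eq0; have [//|j0] := eqVneq j ord0.
    by have := pairing_neq P j0; rewrite -val_eqE /=; case: ltngtP.
  - by move=> j /andP[+ _]; rewrite pairing_eq0 => /G_pair.
have key m : (m <= 4 * g)%N ->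
    let W := \big[heis_mul/(false, false, false)]_(0 <= i < m) tau (inord i.+1) in
    W.1.1 = A (inord m) /\ W.2 = \big[addb/false]_(0 <= i < m) G (inord i.+1).
  elim: m => [|m IH] mg /=.
    rewrite !big_geq //= -A0; split=> //; congr A; apply: val_inj.
    by rewrite /= inordK.
  rewrite !big_nat_recr //=; have [e1 e2] := IH (ltnW mg).
  have pE : ord_pred (inord m.+1) = inord m :> sides.
    apply: (can_inj (@ordSK _)); rewrite ord_predK; apply: val_inj => /=.
    by rewrite inordK ?ltnS // inordK ?modn_small ?ltnS // ltnW.
  split; first by rewrite e1 /h pE; case: (A (inord m)); case: (A (inord m.+1)).
  by rewrite e2 e1 /G pE /= addbA.
have := std_prod F1 FM; under eq_bigr do rewrite !F11 !F12.
rewrite (side0_eq std_domain P) -prod_sides // (big_morph F FM F1).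
rewrite (eq_bigr (fun i : 'I_(4 * g) => tau (inord i.+1))); last first.
  move=> i _; rewrite FE //; congr tau; apply: val_inj.
  by rewrite /= inordK // ltnS.
rewrite -(big_mkord xpredT (fun i => tau (inord i.+1))) => E.
have [_] := key _ (leqnn _); rewrite E /= => ->; apply: etrans sumG.
rewrite big_mkord [RHS]big_mkcond big_ord_recl /=; apply: eq_bigr => i _.
by congr G; apply: val_inj; rewrite /= inordK // ltnS.
Qed.

(** Intersecting [H] with the classes dual to the standard arcs shows that it vanishes on these,
    hence everywhere by [bool_hom_detect]; then [A] does not change from one corner to the next. As
    side 0 is its own partner, the turn around the basepoint steps over the boundary, from the last
    corner to corner 0. *)
Lemma corners_connected i : A i = false.
Proof.
have [H HM HE] := H_ex.
have Hz m : (m < g)%N -> H (side std_domain (inord (4 * m).+1)) = false /\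
    H (side std_domain (inord (4 * m).+2)) = false.
  move=> mg.
  have first n : (0 < n)%N -> (n.+2 <= 4 * g)%N -> (n.-1 %% 4 < 2)%N ->
      exists i, arc_side std_domain i = inord n.
    move=> n0 ng n4; apply: arc_side_first => //.
    rewrite /= /std_pairing ifF; last first.
      by rewrite -val_eqE /= inordK; [rewrite -[n]prednK|lia].
    rewrite inordK; last by lia.
    by rewrite n4 inordK ?ltnS //; lia.
  have f1 n : (n < g)%N -> exists i, arc_side std_domain i = inord (4 * n).+1.
    by move=> ng; apply: first; rewrite /= ?modnMr //; lia.
  have f2 n : (n < g)%N -> exists i, arc_side std_domain i = inord (4 * n).+2.
    move=> ng; apply: first; rewrite //=; first by lia.
    by rewrite -[(4 * n).+1]addn1 -modnDml modnMr.
  have dual (i0 : 'I_(2 * g)) : exists2 K : pi -> bool,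
      forall u w : pi, K (u * w)%g = K u (+) K w &
      forall i, K (side std_domain (arc_side std_domain i)) =
        (arc_side std_domain i == arc_side std_domain i0).
    have [K KM KE] := bool_hom_exists std_domain (fun i => i == i0).
    by exists K => // j; rewrite KE (inj_eq (@arc_side_inj _ _ _ g_gt0 _)).
  have K1 (K : pi -> bool) n e0 : (forall i, K (side std_domain (arc_side std_domain i)) =
        (arc_side std_domain i == e0)) -> (n < g)%N ->
      K (side std_domain (inord (4 * n).+1)) = (inord (4 * n).+1 == e0) /\
      K (side std_domain (inord (4 * n).+2)) = (inord (4 * n).+2 == e0).
    by move=> KE ng; have [i1 <-] := f1 _ ng; have [i2 <-] := f2 _ ng; rewrite !KE.
  have inord_eq a b : (a <= 4 * g)%N -> (b <= 4 * g)%N ->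
      (inord a == inord b :> sides) = (a == b).
    by move=> ag bg; rewrite -val_eqE /= !inordK.
  split.
  (* In the intersection form each arc of a handle pairs only with the other one, so the class dual
     to the second arc reads off the value on the first. *)
  - have [i2 E2] := f2 _ mg; have [K KM KE] := dual i2; rewrite E2 in KE.
    have := intersection_zero HM HE KM.
    rewrite big_mkord (bigD1 (Ordinal mg)) //= big1 => [|n nm].
      have [-> ->] := K1 _ _ _ KE mg; rewrite eqxx inord_eq; [|lia..].
      rewrite andbT addbF (_ : (_ == _) = false) ?andbF ?addbF //; lia.
    have ng := ltn_ord n; have [-> ->] := K1 _ _ _ KE ng; rewrite !inord_eq; try lia.
    rewrite (_ : (4 * n).+1 == (4 * m).+2 = false) ?andbF; last lia.
    by rewrite (_ : (4 * n).+2 == (4 * m).+2 = false) ?andbF //; move: nm; rewrite -val_eqE /=; lia.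
  - have [i1 E1] := f1 _ mg; have [K KM KE] := dual i1; rewrite E1 in KE.
    have := intersection_zero HM HE KM.
    rewrite big_mkord (bigD1 (Ordinal mg)) //= big1 => [|n nm].
      have [-> ->] := K1 _ _ _ KE mg; rewrite eqxx inord_eq; [|lia..].
      rewrite andbT addbF (_ : (_ == _) = false) ?andbF ?addbF //; lia.
    have ng := ltn_ord n; have [-> ->] := K1 _ _ _ KE ng; rewrite !inord_eq; try lia.
    rewrite (_ : (4 * n).+2 == (4 * m).+1 = false) ?andbF; last lia.
    by rewrite (_ : (4 * n).+1 == (4 * m).+1 = false) ?andbF //; move: nm; rewrite -val_eqE /=; lia.
have H0 : forall u, H u = false.
  apply: (bool_hom_detect (Q := std_domain) gen HM) => j.
  have := arc_side_lt g_gt0 std_domain j; have := arc_side_neq0 g_gt0 std_domain j.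
  move: (arc_side _ _) => k k0; rewrite /= /std_pairing (negbTE k0).
  have k0' : (0 < k)%N by rewrite lt0n.
  have kg : (k <= 4 * g)%N by rewrite -ltnS.
  case: ifPn => k4.
    move=> _; have [k1|k2] : k = (4 * (k.-1 %/ 4)).+1 :> nat \/ k = (4 * (k.-1 %/ 4)).+2 :> nat.
    - by have := divn_eq k.-1 4; lia.
    - have -> : k = inord (4 * (k.-1 %/ 4)).+1 by rewrite -k1 inord_val.
      by apply: (Hz _ _).1; lia.
    - have -> : k = inord (4 * (k.-1 %/ 4)).+2 by rewrite -k2 inord_val.
      by apply: (Hz _ _).2; lia.
  by rewrite inordK; [case: (nat_of_ord k) => [|[|n]]; lia|lia].
have step n : (n.+1 <= 4 * g)%N -> A (inord n.+1) = A (inord n).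
  move=> ng; have n0 : (inord n.+1 : sides) != ord0.
    by rewrite -val_eqE /= inordK.
  have := HE _ n0; rewrite H0 /h.
  have -> : ord_pred (inord n.+1) = inord n :> sides.
    apply: (can_inj (@ordSK _)); rewrite ord_predK; apply: val_inj => /=.
    by rewrite inordK ?ltnS // inordK ?modn_small ?ltnS // ltnW.
  by case: (A _); case: (A _).
rewrite -(inord_val i); have : (i <= 4 * g)%N by rewrite -ltnS.
elim: (nat_of_ord i) => [_|n IH ng]; last by rewrite step // IH // ltnW.
by rewrite -A0; congr A; apply: val_inj; rewrite /= inordK.
Qed.

End Corners.

End Connected.

(** * Reduced words and their codes *)

Section Words.
Variables (T : eqType) (s : T -> T).
Hypothesis sK : involutive s.
Implicit Types (x y : T) (u v w : seq T).

Definition reduced w := sorted (fun x y => y != s x) w.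

Definition push x w := if w is y :: w' then if y == s x then w' else x :: w else [:: x].

Definition inv_word w := rev (map s w).

Lemma push_reduced x w : reduced w -> reduced (push x w).
Proof.
rewrite /push /reduced; case: w => // y w /= pw; case: eqP => [_|/eqP yx] /=.
  exact: path_sorted pw.
by rewrite yx.
Qed.

Lemma pushK x w : reduced w -> push (s x) (push x w) = w.
Proof.
case: w => [_|y w]; first by rewrite /= sK eqxx.
rewrite /reduced /=; case: eqP => [->|_ _]; last by rewrite /= sK eqxx.
by case: w => [//|z w] /= /andP[zx _]; rewrite (negbTE zx).
Qed.

Lemma push_cons x w : reduced (x :: w) -> push x w = x :: w.
Proof. by case: w => //= y w /andP[/negbTE ->]. Qed.

Lemma size_push x w : (size (push x w) <= (size w).+1)%N.
Proof. by case: w => //= y w; case: ifP => //= _; rewrite ltnW. Qed.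

Lemma size_push_eq x w : size (push x w) = (size w).+1 -> push x w = x :: w.
Proof. by case: w => //= y w; case: ifP => // _ /= E; lia. Qed.

Lemma inv_wordK : involutive inv_word.
Proof. by move=> w; rewrite /inv_word map_rev revK mapK. Qed.

Lemma size_inv_word w : size (inv_word w) = size w.
Proof. by rewrite size_rev size_map. Qed.

Lemma inv_word_cat u w : inv_word (u ++ w) = inv_word w ++ inv_word u.
Proof. by rewrite /inv_word map_cat rev_cat. Qed.

Lemma inv_word_cons x w : inv_word (x :: w) = rcons (inv_word w) (s x).
Proof. by rewrite /inv_word /= rev_cons. Qed.

Lemma inv_word_rcons x w : inv_word (rcons w x) = s x :: inv_word w.
Proof. by rewrite /inv_word map_rcons rev_rcons. Qed.

Lemma reduced_cat u w : reduced u -> reduced w ->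
  (forall u' w' x y, u = rcons u' x -> w = y :: w' -> y != s x) -> reduced (u ++ w).
Proof.
case: u => // z u; case: w => [|y w]; rewrite ?cats0 // => ru rw h.
have -> : reduced ((z :: u) ++ y :: w) =
    reduced (z :: u) && (y != s (last z u)) && reduced (y :: w).
  by rewrite /reduced /= cat_path /= andbA.
by rewrite ru rw (h (belast z u) w) // -lastI.
Qed.

Lemma reduced_catl u w : reduced (u ++ w) -> reduced u.
Proof. by rewrite /reduced; case: u => //= z u; rewrite cat_path => /andP[]. Qed.

Lemma reduced_catr u w : reduced (u ++ w) -> reduced w.
Proof.
by rewrite /reduced; case: u => //= z u; rewrite cat_path => /andP[_ /path_sorted].
Qed.

Lemma reduced_inv w : reduced w -> reduced (inv_word w).
Proof.
rewrite /reduced /inv_word rev_sorted sorted_map; apply: sub_sorted => x y /=.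
by rewrite sK; apply: contra => /eqP ->; rewrite ?sK.
Qed.

Lemma reduced_inv_cat w : reduced (inv_word w ++ w) -> w = [::].
Proof.
case: w => // x w; rewrite inv_word_cons cat_rcons => /reduced_catr.
by rewrite /reduced /= sK eqxx.
Qed.

Fixpoint lcp u w : nat :=
  match u, w with
  | x :: u', y :: w' => if x == y then (lcp u' w').+1 else 0%N
  | _, _ => 0%N
  end.

Lemma lcpC u w : lcp u w = lcp w u.
Proof. by elim: u w => [|x u IH] [|y w] //=; rewrite eq_sym IH. Qed.

Lemma lcp_le u w : (lcp u w <= size u)%N.
Proof. by elim: u w => [|x u IH] [|y w] //=; case: ifP => // _; rewrite ltnS. Qed.

Lemma take_lcp u w : take (lcp u w) u = take (lcp u w) w.
Proof. by elim: u w => [|x u IH] [|y w] //=; case: eqP => //= ->; rewrite IH. Qed.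

Lemma drop_lcp u w x y u' w' : drop (lcp u w) u = x :: u' ->
  drop (lcp u w) w = y :: w' -> x != y.
Proof.
elim: u w => [|a u IH] [|b w] //=; case: eqP => [_|/eqP ab] //=; first exact: IH.
by case=> <- _ [<- _].
Qed.

(** Once the common prefix is removed, the next letters differ, so cancellation stops there. *)
Lemma reduced_quotient u w : reduced u -> reduced w ->
  reduced (inv_word (drop (lcp u w) u) ++ drop (lcp u w) w).
Proof.
move=> ru rw; apply: reduced_cat.
- by apply: reduced_inv; move: ru; rewrite -{1}(cat_take_drop (lcp u w) u) => /reduced_catr.
- by move: rw; rewrite -{1}(cat_take_drop (lcp u w) w) => /reduced_catr.
- move=> u' w' x y E E'; have /(congr1 inv_word) := E; rewrite inv_wordK inv_word_rcons.
  by move=> /drop_lcp/(_ E'); rewrite eq_sym.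
Qed.

Definition half w := take (uphalf (size w)) w.

(** The first half of the inverse does not see a short prefix [u], whereas by [half_cat] the first
    half of [u ++ w] contains it. Replacing [u] by a word of equal length and smaller code thus
    lowers one weight and leaves the other alone. *)
Lemma half_inv_cat u w : (size u <= size w)%N ->
  half (inv_word (u ++ w)) = take (uphalf (size u + size w)) (inv_word w).
Proof.
move=> h; rewrite /half size_inv_word size_cat inv_word_cat takel_cat //.
by rewrite size_inv_word; lia.
Qed.

Lemma half_cat u w : (size u <= size w)%N ->
  half (u ++ w) = u ++ take (uphalf (size u + size w) - size u) w.
Proof.
move=> h; rewrite /half size_cat take_cat ltnNge.
by have -> : (size u <= uphalf (size u + size w))%N by lia.
Qed.

End Words.

Section Code.
Variable b : nat.
Local Notation B := b.+1.
Implicit Types (u w : seq 'I_B) (M : nat).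

(* Words read as numbers in base [B], so that comparing codes of words of the
   same length is comparing them lexicographically. *)
Fixpoint code M w : nat :=
  if w is x :: w' then (x * B ^ M + code M.-1 w')%N else 0%N.

Lemma code_cat M u w : code M (u ++ w) = (code M u + code (M - size u) w)%N.
Proof.
elim: u M => [|x u IH] M /=; first by rewrite subn0.
by rewrite IH addnA; congr (_ + code _ _)%N; lia.
Qed.

Lemma code_lt M w : (size w <= M.+1)%N -> (code M w < B ^ M.+1)%N.
Proof.
elim: w M => [|x w IH] M /=; first by rewrite expn_gt0.
rewrite ltnS => wM.
have c : (code M.-1 w < B ^ M)%N.
  by case: M wM => [|M] wM; [move: wM; case: w {IH}|exact: IH].
have x1 : (x.+1 * B ^ M <= B ^ M.+1)%N by rewrite expnS leq_mul2r (ltn_ord x) orbT.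
by apply: leq_trans x1; rewrite mulSn addnC ltn_add2r.
Qed.

Lemma code_inj M u w : size u = size w -> (size u <= M.+1)%N ->
  code M u = code M w -> u = w.
Proof.
elim: u w M => [|x u IH] [|y w] M //= [uw]; rewrite ltnS => uM E.
have BM : (0 < B ^ M)%N by rewrite expn_gt0.
have c v : (size v <= M)%N -> (code M.-1 v < B ^ M)%N.
  by case: M {uM E BM} => [|M] vM; [move: vM; case: v|exact: code_lt].
have cu := c _ uM; have cw : (code M.-1 w < B ^ M)%N by apply: c; rewrite -uw.
have xy : x = y.
  apply: val_inj; have := congr1 (fun n => n %/ B ^ M)%N E.
  by rewrite !divnMDl // !divn_small // !addn0.
congr cons => //; move: E; rewrite xy => /addnI.
case: M uM {BM c cu cw} => [|M] uM; last exact: IH.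
by move=> _; move: uw uM; case: (u) => //; case: (w).
Qed.

End Code.

(** * Normal forms of group elements *)

Section NormalForm.
Context {R : realType} {g : nat} {S : surface R g}.
Hypothesis g_gt0 : (0 < g)%N.
Local Notation sides := 'I_(4 * g).+1.
Local Notation pi := (pi1 (R := R) (basepoint S)).
Variable P : polygon_domain S.
Local Notation s := (pd_pairing P).
Let sK : involutive s := @pairingK _ _ _ P.

Definition word_value (w : seq sides) : pi := \big[*%g/1%g]_(k <- w) side P k.

(** Side 0 is its own partner, so inverting a word letter by letter agrees with inversion in the
    group only for words that avoid it. *)
Definition letters (w : seq sides) : bool := all (fun k => k != ord0) w.

Lemma word_value_cat u w : word_value (u ++ w) = (word_value u * word_value w)%g.
Proof. by rewrite /word_value big_cat. Qed.

Lemma word_value_nil : word_value [::] = 1%g.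
Proof. by rewrite /word_value big_nil. Qed.

Lemma word_value_cons k w : word_value (k :: w) = (side P k * word_value w)%g.
Proof. by rewrite /word_value big_cons. Qed.

Lemma word_value_seq1 k : word_value [:: k] = side P k.
Proof. by rewrite /word_value big_seq1. Qed.

Lemma letters_inv w : letters w -> letters (inv_word s w).
Proof.
rewrite /letters /inv_word all_rev all_map => h; apply: sub_all h => k /=.
by rewrite pairing_eq0.
Qed.

Lemma word_value_inv w : letters w -> word_value (inv_word s w) = (word_value w)^-1%g.
Proof.
elim: w => [_|k w IH /andP[k0 lw]]; first by rewrite word_value_nil invg1.
rewrite inv_word_cons -cats1 word_value_cat IH // word_value_seq1.
by rewrite word_value_cons invgM side_inv.
Qed.

Hypothesis gen : generating (fun i => side P (arc_side P i)).

Lemma word_ex (u : pi) : exists2 w, letters w & u = word_value w.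
Proof.
pose H : set pi := fun u => exists2 w, letters w & u = word_value w.
move: u; apply: (@gen H).
- by exists [::]; rewrite ?word_value_nil.
- move=> u' v' [w lw ->] [w' lw' ->]; exists (w ++ w'); rewrite ?word_value_cat //.
  by move: lw lw'; rewrite /letters all_cat => -> ->.
- move=> u' [w lw ->]; exists (inv_word s w); first exact: letters_inv.
  by rewrite word_value_inv.
- move=> i; exists [:: arc_side P i]; first by rewrite /= andbT arc_side_neq0.
  by rewrite word_value_seq1.
Qed.

(** Van der Waerden's argument: the group acts on reduced words by pushing letters, and the normal
    form of an element is its effect on the empty word. The last two clauses are meant for words not
    known to be reduced, such as the boundary word. *)
Lemma normal_form : exists N : pi -> seq sides,
  [/\ forall u, reduced s (N u) && letters (N u),
      forall u, word_value (N u) = u,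
      forall w, letters w -> reduced s w -> N (word_value w) = w,
      forall w, letters w -> (size (N (word_value w)) <= size w)%N &
      forall w, letters w -> size (N (word_value w)) = size w -> N (word_value w) = w].
Proof.
pose T := {w : seq sides | reduced s w}.
pose pushT (k : sides) (w : T) : T :=
  exist _ (push s k (val w)) (push_reduced k (valP w)).
have HL := @sides_action R g S g_gt0 P T pushT.
have [k w k0|L [L1 LM LS _]] := HL.
  by apply: val_inj; rewrite /= pushK //; exact: valP.
pose e : T := exist _ [::] (isT : reduced s [::]).
pose N (u : pi) : seq sides := val (L u e).
have N1 : N 1%g = [::] by rewrite /N L1.
have NS k u : k != ord0 -> N (side P k * u)%g = push s k (N u).
  by move=> k0; rewrite /N LM LS.
have Ncons k w : k != ord0 -> N (word_value (k :: w)) = push s k (N (word_value w)).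
  by move=> k0; rewrite word_value_cons NS.
have value_push k w : k != ord0 -> word_value (push s k w) = (side P k * word_value w)%g.
  move=> k0; case: w => [|y w] /=; first by rewrite word_value_cons.
  case: eqP => [->|_]; last by rewrite !word_value_cons.
  by rewrite word_value_cons mulgA side_inv // mulgV mul1g.
have letters_push k w : k != ord0 -> letters w -> letters (push s k w).
  move=> k0; case: w => [|y w] /=; first by rewrite k0.
  by move=> /andP[y0 lw]; case: ifP => //= _; rewrite k0 y0.
exists N; split.
- move=> u; rewrite (valP (L u e)) /=; have [w lw ->] := word_ex u.
  elim: w lw => [_|k w IH /andP[k0 lw]]; first by rewrite word_value_nil N1.
  by rewrite Ncons // letters_push // IH.
- move=> u; have [w lw ->] := word_ex u.
  elim: w lw => [_|k w IH /andP[k0 lw]]; first by rewrite word_value_nil N1 word_value_nil.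
  by rewrite Ncons // value_push // IH // word_value_cons.
- elim=> [_ _|k w IH /andP[k0 lw] rw]; first by rewrite word_value_nil N1.
  rewrite Ncons // IH //; first exact: push_cons.
  by rewrite -(cat1s k) in rw; exact: reduced_catr rw.
- elim=> [_|k w IH /andP[k0 lw]]; first by rewrite word_value_nil N1.
  by rewrite Ncons //; apply: leq_trans (size_push _ _ _) _; rewrite ltnS IH.
- elim=> [_ _|k w IH /andP[k0 lw]]; first by rewrite word_value_nil N1.
  rewrite Ncons // => E; have := size_push s k (N (word_value w)).
  rewrite E /= ltnS => h.
  have sz : (size (N (word_value w)) <= size w)%N.
    elim: (w) lw => [_|k' w' IH' /andP[k'0 lw']]; first by rewrite word_value_nil N1.
    by rewrite Ncons //; apply: leq_trans (size_push _ _ _) _; rewrite ltnS IH'.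
  have sE : size (N (word_value w)) = size w by apply/eqP; rewrite eqn_leq h sz.
  by rewrite size_push_eq ?E ?sE // IH.
Qed.

End NormalForm.

(** * Nielsen reduction by moves *)

Lemma take_inv_word (T : eqType) (s : T -> T) k (w : seq T) :
  take k (inv_word s w) = inv_word s (drop (size w - k) w).
Proof. by rewrite /inv_word take_rev size_map map_drop. Qed.

Lemma drop_inv_word (T : eqType) (s : T -> T) k (w : seq T) :
  drop k (inv_word s w) = inv_word s (take (size w - k) w).
Proof. by rewrite /inv_word drop_rev size_map map_take. Qed.

Lemma sumn_eq1 (f : nat -> nat) n : (forall i, (i < n)%N -> (0 < f i)%N) ->
  (sumn [seq f i | i <- iota 0 n] <= n)%N -> forall i, (i < n)%N -> f i = 1%N.
Proof.
move=> f0; rewrite sumnE big_map => h i ltin.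
have E : (\sum_(j <- iota 0 n) (f j - 1) + n = \sum_(j <- iota 0 n) f j)%N.
  rewrite -{2}(size_iota 0 n) -sum1_size -big_split /=.
  rewrite big_seq [RHS]big_seq; apply: eq_bigr => j; rewrite mem_iota => /andP[_ jn].
  by rewrite subnK // f0.
have /eqP : (\sum_(j <- iota 0 n) (f j - 1) = 0)%N by lia.
rewrite sum_nat_seq_eq0 => /allP /(_ i); rewrite mem_iota /= => /(_ ltin) /eqP.
by have := f0 _ ltin; lia.
Qed.

Section Descent.
Context {R : realType} {g : nat} {S : surface R g}.
Hypothesis g_gt0 : (0 < g)%N.
Local Notation sides := 'I_(4 * g).+1.
Local Notation pi := (pi1 (R := R) (basepoint S)).
Variable P : polygon_domain S.
Local Notation s := (pd_pairing P).
Let sK : involutive s := @pairingK _ _ _ P.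
Variable N : pi -> seq sides.
Hypothesis N_red : forall u, reduced s (N u).
Hypothesis N_letters : forall u, letters (N u).
Hypothesis N_value : forall u, word_value P (N u) = u.
Hypothesis N_id : forall w, letters w -> reduced s w -> N (word_value P w) = w.
Hypothesis N_size : forall w, letters w -> (size (N (word_value P w)) <= size w)%N.
Hypothesis N_size_eq : forall w, letters w ->
  size (N (word_value P w)) = size w -> N (word_value P w) = w.

Let letters_cat (u w : seq sides) : letters (u ++ w) = letters u && letters w.
Proof. exact: all_cat. Qed.

Let letters_drop k (w : seq sides) : letters w -> letters (drop k w).
Proof. by rewrite -{1}(cat_take_drop k w) letters_cat => /andP[]. Qed.

Let letters_take k (w : seq sides) : letters w -> letters (take k w).
Proof. by rewrite -{1}(cat_take_drop k w) letters_cat => /andP[]. Qed.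

Lemma normal_quotient (u v : pi) : let k := lcp (N u) (N v) in
  N (u^-1 * v)%g = inv_word s (drop k (N u)) ++ drop k (N v).
Proof.
move=> k; rewrite -[RHS]N_id; last exact: reduced_quotient.
  congr N; rewrite word_value_cat word_value_inv ?letters_drop //.
  rewrite -{1}(N_value u) -{1}(N_value v).
  rewrite -{1}(cat_take_drop k (N u)) -{1}(cat_take_drop k (N v)) !word_value_cat.
  by rewrite take_lcp invgM mulgA mulgVK.
by rewrite letters_cat letters_inv letters_drop.
Qed.

Lemma normal_inv (u : pi) : N (u^-1)%g = inv_word s (N u).
Proof.
rewrite -[RHS]N_id ?letters_inv ?reduced_inv //.
by rewrite word_value_inv // N_value.
Qed.

(** The empty word at side 0 makes the cancellation vanish at the two corners next to the boundary,
    where no move is available. *)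
Definition side_word (Q : polygon_domain S) (i : sides) : seq sides :=
  if i == ord0 then [::] else N (side Q i).

Section Step.
Variable Q : polygon_domain S.
Hypothesis genQ : generating (fun i => side Q (arc_side Q i)).
Local Notation s' := (pd_pairing Q).
Local Notation w := (side_word Q).
Let s'K : involutive s' := @pairingK _ _ _ Q.

(** Both words are read as leaving the basepoint at the corner between side [i] and the next, so
    that the letters cancelling in the product of these two sides form a common prefix. *)
Definition cancellation (i : sides) : nat := lcp (w (s' i)) (w (ordS i)).
Local Notation kap := cancellation.

Definition outgoing (i x y : sides) : Prop :=
  x = s' i /\ y = ordS i \/ x = ordS i /\ y = s' i.

Let w_pair i : w (s' i) = inv_word s (w i).
Proof.
rewrite /side_word pairing_eq0; case: eqP => // /eqP i0.
by rewrite side_inv // normal_inv.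
Qed.

Let w_red i : reduced s (w i). Proof. by rewrite /side_word; case: eqP. Qed.
Let w_letters i : letters (w i). Proof. by rewrite /side_word; case: eqP. Qed.
Let w_size i : size (w (s' i)) = size (w i). Proof. by rewrite w_pair size_inv_word. Qed.

Let w_gt0 i : i != ord0 -> (0 < size (w i))%N.
Proof.
move=> i0; rewrite lt0n size_eq0 /side_word (negbTE i0); apply/eqP => E.
have E1 : side Q i = 1%g by rewrite -[LHS]N_value E word_value_nil.
have [arc [arcP _ _]] := arc_index g_gt0 Q.
have [h hM hE] := bool_hom_exists g_gt0 Q (fun n => n == arc i).
have := hE (arc i); rewrite eqxx; have [->|->] := arcP _ i0.
  by rewrite E1 bool_hom1.
by rewrite side_inv // E1 invg1 bool_hom1.
Qed.

Let w0 : w ord0 = [::]. Proof. by rewrite /side_word eqxx. Qed.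

Let kap0 : kap ord0 = 0%N.
Proof. by rewrite /cancellation pairing0 w0. Qed.

Let kap_last i : ordS i = ord0 -> kap i = 0%N.
Proof. by rewrite /cancellation => ->; rewrite w0 lcpC. Qed.

(* Replacing [y] by [x^-1 y], where [x] and [y] leave the basepoint at the corner
   [i], shortens [y] if more than half of [x] cancels. If exactly half of [x]
   cancels, it replaces an initial part of [y] by one with a smaller code, which
   is Nielsen's tie-breaking. *)
Definition improves (M : nat) (i x y : sides) : Prop :=
  (size (drop (kap i) (w x)) < kap i)%N \/
  [/\ size (drop (kap i) (w x)) = kap i, (kap i <= size (drop (kap i) (w y)))%N &
    (code M (inv_word s (drop (kap i) (w x))) < code M (take (kap i) (w x)))%N].

Lemma nielsen_step M : (forall i, (size (w i) <= M)%N) ->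
  (exists i x y, outgoing i x y /\ improves M i x y) \/
  (forall i, i != ord0 -> w i = [:: i]).
Proof.
move=> wM; have [|noimp] := pselect (exists i x y, outgoing i x y /\ improves M i x y).
  by left.
right.
have half1 i x y : outgoing i x y -> ((kap i).*2 <= size (w x))%N.
  move=> o; rewrite leqNgt; apply/negP => h; apply: noimp; exists i, x, y; split=> //.
  by left; rewrite size_drop; lia.
have out_sym i x y : outgoing i x y -> outgoing i y x.
  by case; [right|left]; tauto.
have notie i x y : outgoing i x y -> size (w x) = (kap i).*2 ->
    (code M (take (kap i) (w x)) <= code M (inv_word s (drop (kap i) (w x))))%N.
  move=> o E; rewrite leqNgt; apply/negP => h; apply: noimp; exists i, x, y; split=> //.
  right; split=> //; rewrite size_drop ?E; first by lia.
  by have := half1 _ _ _ (out_sym _ _ _ o); lia.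
(* If both halves of the word of [j] cancel, the two possible moves have opposite
   effects on codes, so one of them improves. *)
have notwo j i1 y1 i2 y2 : j != ord0 -> outgoing i1 j y1 -> outgoing i2 (s' j) y2 ->
    size (w j) = (kap i1).*2 -> size (w j) = (kap i2).*2 -> False.
  move=> j0 o1 o2 E1 E2; have h1 := notie _ _ _ o1 E1.
  have h2 := notie _ _ _ o2 (etrans (w_size j) E2).
  have kE : kap i1 = kap i2 by lia.
  have dE : (size (w j) - kap i2 = kap i1)%N by lia.
  rewrite w_pair take_inv_word drop_inv_word dE inv_wordK // in h2.
  have szt : size (take (kap i1) (w j)) = kap i1 by rewrite size_takel //; lia.
  have szd : size (drop (kap i1) (w j)) = kap i1 by rewrite size_drop; lia.
  have E : take (kap i1) (w j) = inv_word s (drop (kap i1) (w j)).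
    apply: (@code_inj _ M); rewrite ?size_inv_word ?szt ?szd //.
      by have := wM j; lia.
    by apply/eqP; rewrite eqn_leq h1 h2.
  have := w_red j; rewrite -(cat_take_drop (kap i1) (w j)) E.
  by move=> /(reduced_inv_cat sK) E'; have := w_gt0 j0; move: szd; rewrite E' /=; lia.
have out_pred j : outgoing (ord_pred j) j (s' (ord_pred j)).
  by right; rewrite ord_predK.
have out_self j : outgoing j (s' j) (ordS j) by left.
have strict j : j != ord0 -> (kap (ord_pred j) + kap j < size (w j))%N.
  move=> j0; rewrite ltnNge; apply/negP => h.
  have h1 := half1 _ _ _ (out_pred j); have h2 := half1 _ _ _ (out_self j).
  rewrite w_size in h2.
  by apply: (notwo j _ _ _ _ j0 (out_pred j) (out_self j)); lia.
(* [a j] is the middle part of the word of [j], which survives the cancellation at both ends; [m j]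
   is the position where the part cancelled at the far end starts. *)
pose m j := (size (w j) - kap j)%N.
pose a j := drop (kap (ord_pred j)) (take (m j) (w j)).
have a_size j : j != ord0 -> size (a j) = (size (w j) - kap j - kap (ord_pred j))%N.
  by move=> j0; rewrite size_drop size_takel // leq_subr.
have a_gt0 j : j != ord0 -> (0 < size (a j))%N.
  by move=> j0; rewrite a_size //; have := strict j j0; lia.
have dropE j : j != ord0 -> drop (kap (ord_pred j)) (w j) = a j ++ drop (m j) (w j).
  move=> j0; rewrite -{1}(cat_take_drop (m j) (w j)) drop_cat size_takel ?leq_subr //.
  by rewrite ifT // /m; have := strict j j0; lia.
have taken j : j != ord0 -> take (m j) (w j) = take (kap (ord_pred j)) (take (m j) (w j)) ++ a j.
  by move=> j0; rewrite cat_take_drop.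
pose J n : sides := inord n.
have J0 n : (n.+1 <= 4 * g)%N -> J n.+1 != ord0.
  by move=> ng; rewrite -val_eqE /= inordK.
have JP n : (n.+1 <= 4 * g)%N -> ord_pred (J n.+1) = J n.
  move=> ng; apply: (can_inj (@ordSK _)); rewrite ord_predK; apply: val_inj => /=.
  by rewrite inordK ?ltnS // inordK ?modn_small ?ltnS // ltnW.
have J00 : J 0%N = ord0 by apply: val_inj; rewrite /= inordK.
pose pref n := flatten [seq a (J i.+1) | i <- iota 0 n].
have prefS n : pref n.+1 = pref n ++ a (J n.+1).
  rewrite /pref (_ : iota 0 n.+1 = iota 0 n ++ [:: n]); last by rewrite -addn1 iotaD.
  by rewrite map_cat flatten_cat /= cats0.
(* A partial product consists of the surviving middles followed by the tail that the next corner
   cancels. Middles do not cancel against each other, because the common prefix removed at each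
   corner was maximal; the third clause supplies the last letter for this comparison. *)
have key n : (n <= 4 * g)%N ->
    [/\ reduced s (pref n), letters (pref n),
      (0 < n)%N -> (0 < size (take (m (J n)) (w (J n))))%N /\
        forall x0, last x0 (pref n) = last x0 (take (m (J n)) (w (J n))) &
      \big[*%g/1%g]_(0 <= i < n) side Q (J i.+1) =
        (word_value P (pref n) * word_value P (drop (m (J n)) (w (J n))))%g].
  elim: n => [|n IH] ng.
    by split=> //; rewrite big_geq // J00 w0 /= !word_value_nil mulg1.
  have [r1 r2 r3 r4] := IH (ltnW ng); have j0 := J0 _ ng; have jP := JP _ ng.
  set j := J n.+1 in j0 jP *; set i := J n in r3 r4 jP.
  have dj := dropE _ j0; rewrite jP in dj.
  have pE : take (kap i) (w j) = inv_word s (drop (m i) (w i)).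
    have -> : j = ordS i by rewrite -jP ord_predK.
    by rewrite /m -take_inv_word -w_pair; exact: esym (take_lcp _ _).
  have a_red : reduced s (a j).
    by apply: reduced_catr (_ : reduced s (take (kap (ord_pred j)) (take (m j) (w j)) ++ a j));
      rewrite -taken //; apply: reduced_catl (_ : reduced s (_ ++ drop (m j) (w j)));
      rewrite cat_take_drop.
  rewrite prefS; split.
  - apply: reduced_cat => // u' v' x y Ex Ey.
    have n0 : (0 < n)%N by rewrite lt0n; apply/eqP => n00; have := congr1 size Ex; rewrite n00 size_rcons.
    have [t0 /(_ x)] := r3 n0; rewrite Ex last_rcons.
    have [t [x' Et]] : exists t x', take (m i) (w i) = rcons t x'.
      by move: t0; case: (lastP (take _ _)) => // t x' _; exists t, x'.
    rewrite Et last_rcons => xE; rewrite -xE in Et; rewrite eq_sym.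
    have h : drop (kap i) (w (s' i)) = s x :: inv_word s t.
      by rewrite w_pair drop_inv_word -/(m i) Et inv_word_rcons.
    have h2 : drop (kap i) (w (ordS i)) = y :: v' ++ drop (m j) (w j).
      have -> : ordS i = j by rewrite -jP ord_predK.
      by rewrite dj Ey.
    exact: drop_lcp h h2.
  - by rewrite letters_cat r2 letters_drop // letters_take.
  - move=> _; split.
      by rewrite taken // size_cat; have := a_gt0 _ j0; lia.
    move=> x0; rewrite taken // !last_cat; have := a_gt0 _ j0.
    by case: (a j).
  - rewrite big_nat_recr //= r4 -/j.
    have -> : side Q j = word_value P (w j) by rewrite /side_word (negbTE j0) N_value.
    rewrite -{1}(cat_take_drop (kap i) (w j)) pE dj !word_value_cat word_value_inv ?letters_drop //.
    by rewrite !mulgA mulgK.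
pose full := [seq J i.+1 | i <- iota 0 (4 * g)].
have full_letters : letters full.
  apply/allP => k /mapP[n]; rewrite mem_iota add0n => /andP[_ ng] ->; exact: J0.
have size_full : size full = (4 * g)%N by rewrite size_map size_iota.
have JE (i : 'I_(4 * g)) : J i.+1 = lift ord0 i.
  by apply: val_inj; rewrite /= inordK // ltnS.
have [r1 r2 _ r4] := key _ (leqnn _).
have J_last : m (J (4 * g)%N) = size (w (J (4 * g)%N)).
  rewrite /m kap_last ?subn0 //; apply: val_inj => /=.
  by rewrite inordK // modnn.
(* Both polygons have the same boundary loop, so the product of the sides of [Q] is also spelled by
   the sides of [P] in order. *)
have W_eq : word_value P (pref (4 * g)%N) = word_value P full.
  have <- : \big[*%g/1%g]_(0 <= i < 4 * g) side Q (J i.+1) = word_value P (pref (4 * g)%N).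
    by rewrite r4 J_last drop_size word_value_nil mulg1.
  rewrite /word_value /full big_map -/(index_iota 0 (4 * g)) ?subn0.
  rewrite (_ : iota 0 (4 * g) = index_iota 0 (4 * g)); last by rewrite /index_iota subn0.
  rewrite !big_mkord.
  rewrite (eq_bigr (fun i => side Q (lift ord0 i))) => [|i _]; last by rewrite JE.
  rewrite [RHS](eq_bigr (fun i => side P (lift ord0 i))) => [|i _]; last by rewrite JE.
  by rewrite !prod_sides // (side0_eq P Q).
have N_pref : N (word_value P full) = pref (4 * g)%N by rewrite -W_eq N_id.
(* 4g nonempty middles make up a normal form of length at most 4g. *)
have a_one n : (n < 4 * g)%N -> size (a (J n.+1)) = 1%N.
  apply: (@sumn_eq1 (fun n => size (a (J n.+1)))) => [i ltig|]; first by rewrite a_gt0 // J0.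
  have := N_size full_letters; rewrite N_pref size_full /pref size_flatten.
  by rewrite /shape -map_comp.
have pref_full : pref (4 * g)%N = full.
  rewrite -N_pref; apply: N_size_eq => //; rewrite N_pref size_full /pref size_flatten.
  rewrite /shape -map_comp.
  have /eq_in_map -> : {in iota 0 (4 * g), size \o (fun i => a (J i.+1)) =1 fun=> 1%N}.
    by move=> n; rewrite mem_iota add0n => /andP[_ ng] /=; exact: a_one.
  by rewrite sumnE big_map sum1_size size_iota.
have a_letter j : j != ord0 -> a j = [:: j].
  move=> j0; have ltj : (j.-1 < 4 * g)%N.
    by rewrite -ltnS prednK ?lt0n.
  have jE : j = J j.-1.+1.
    by rewrite prednK ?lt0n //; apply: val_inj; rewrite /= inordK.
  have : pref (4 * g)%N = [seq head ord0 (a (J i.+1)) | i <- iota 0 (4 * g)].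
    rewrite /pref -[RHS]flatten_map1; congr (flatten _); apply/eq_in_map => n.
    by rewrite mem_iota add0n => /andP[_ /a_one]; case: (a _) => [|x []].
  rewrite pref_full => /eq_in_map/(_ j.-1); rewrite mem_iota add0n ltj -jE => /(_ isT).
  by have := a_one _ ltj; rewrite -jE; case: (a j) => [|x []] //= _ <-.
have w_eq j : j != ord0 -> size (w j) = (kap (ord_pred j) + 1 + kap j)%N.
  by move=> j0; have := a_size _ j0; rewrite a_letter //=; have := strict _ j0; lia.
have [allz|] := boolP [forall i, kap i == 0%N].
  move=> j j0; have z i : kap i = 0%N by apply/eqP; move/forallP: allz; apply.
  by rewrite -[RHS]a_letter // /a /m !z drop0 subn0 take_size.
(* As the corners form a single cycle, cancellation at some corner forces a side
   [j] that starts where there is none while its partner ends where there is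
   some; its word then has length two, and both letters cancel. *)
have [/existsP[i /andP[/eqP iz ip]]|] :=
    boolP [exists i, (kap i == 0%N) && (0 < kap (s' (ordS i)))%N].
  exfalso; pose j := ordS i.
  have j0 : j != ord0.
    by apply: contraTneq ip => j0; rewrite -/j j0 pairing0 kap0.
  have sj0 : s' j != ord0 by rewrite pairing_eq0.
  have e1 := w_eq _ j0; have e2 := w_eq _ sj0; rewrite w_size in e2.
  have h1 := half1 _ _ _ (out_self j); rewrite w_size in h1.
  have jP : ord_pred j = i by rewrite /j ordSK.
  rewrite jP iz in e1; rewrite -/j in ip.
  apply: (notwo j (s' j) (ordS (s' j)) j (ordS j) j0) => //; try lia.
  by left; rewrite s'K.
rewrite negb_exists => /forallP noi; rewrite negb_forall => /existsP[i0 i0P]; exfalso.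
(* Cancellation at a corner now forces cancellation at the corner preceding it in its cycle. The
   successor map permutes the corners, so both counts agree and the implication becomes invariance;
   corner 0 has no cancellation. *)
have le i : ((0 < kap (s' (ordS i)))%N <= (0 < kap i)%N)%N.
  by have := noi i; case: (kap i) => [|n]; case: (kap (s' _)).
have nu_inj : injective (fun i => s' (ordS i)).
  by move=> i j /(inv_inj s'K) /(can_inj (@ordSK _)).
have sumE : (\sum_i (0 < kap (s' (ordS i)))%N = \sum_i (0 < kap i)%N)%N.
  by rewrite [RHS](reindex_inj nu_inj).
have A_next i : (0 < kap (s' (ordS i)))%N = (0 < kap i)%N.
  have : (\sum_i ((0 < kap i)%N - (0 < kap (s' (ordS i)))%N) = 0)%N.
    by rewrite sumnB // sumE subnn.
  move=> /eqP; rewrite sum_nat_eq0 => /forallP/(_ i)/= ; have := le i.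
  by case: (0 < kap i)%N; case: (0 < _)%N.
have := corners_connected g_gt0 genQ (A := fun i => (0 < kap i)%N) _ A_next i0.
by rewrite kap0 => /(_ erefl) h; move: i0P; rewrite -lt0n h.
Qed.

End Step.
(** The corner between two adjacent partners would be a cycle of its own, different from corner
    0. *)
Lemma not_adjacent (Q : polygon_domain S) i :
    generating (fun n => side Q (arc_side Q n)) -> i != ord0 ->
  pd_pairing Q i != ordS i.
Proof.
move=> genQ i0; apply/eqP => E.
have QK := @pairingK _ _ _ Q.
have nu_inj : injective (fun j => pd_pairing Q (ordS j)).
  by move=> j j' /(inv_inj QK) /(can_inj (@ordSK _)).
have fixi : pd_pairing Q (ordS i) = i by rewrite -E QK.
have := @corners_connected _ _ _ g_gt0 Q (fun j => j == i) genQ _ _ i.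
rewrite eqxx eq_sym (negbTE i0) => h; have // := h erefl; move=> {}h.
suff /h : forall j, (pd_pairing Q (ordS j) == i) = (j == i) by [].
by move=> j; rewrite -{1}fixi (inj_eq nu_inj).
Qed.

(** The two cases of [outgoing] are the two ways to reattach the triangle: the product of side [i]
    and the next one replaces the latter, or its inverse replaces the partner of side [i]. *)
Lemma corner_move (Y : cs_object S) (Q : polygon_domain S) i x y :
    has_polygon (rep Y) Q -> i != ord0 -> ordS i != ord0 -> outgoing Q i x y ->
  exists (Y' : cs_object S) (Q' : polygon_domain S) (B : {perm sides}),
    [/\ cs_move Y Y', has_polygon (rep Y') Q', B ord0 = ord0 &
    forall j, side Q' j = if B j == y then ((side Q x)^-1 * side Q y)%g else
      if B j == pd_pairing Q y then ((side Q x)^-1 * side Q y)^-1%g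
      else side Q (B j)].
Proof.
move=> YQ i0 Si0 o; have repY := has_polygon_rep YQ.
have genQ : generating (fun n => side Q (arc_side Q n)).
  by rewrite -repY; have [] := rep_CG Y.
have ig : (i < 4 * g)%N.
  have := ltn_ord i; rewrite ltnS leq_eqVlt => /orP[/eqP E|//].
  by move: Si0; rewrite -val_eqE /= E modnn.
have adj := not_adjacent genQ i0.
have QK := @pairingK _ _ _ Q.
have yN : y != ord0 by case: o => -[_ ->]; rewrite ?pairing_eq0.
have yy : (y == pd_pairing Q y) = false by rewrite eq_sym; apply/negbTE/pairing_neq.
case: o yN yy => -[-> ->] yN yy.
  have [Y' [Q' [B [m h B0 _ BS]]]] := cs_slide g_gt0 false YQ i0 ig adj.
  exists Y', Q', B; split=> // j; rewrite BS side_inv // invgK.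
  by [].
have [Y' [Q' [B [m h B0 _ BS]]]] := cs_slide g_gt0 true YQ i0 ig adj.
exists Y', Q', B; split=> // j; rewrite BS side_inv // QK -invgM invgK.
have [->|//] := eqVneq (B j) i.
by rewrite eq_sym (negbTE (pairing_neq Q i0)).
Qed.

Definition measure (F : seq sides -> nat) (Q : polygon_domain S) : nat :=
  (\sum_i F (side_word Q i))%N.

(** Only the arc of [y] changes; the balance is written with sums on both sides to avoid subtraction
    of natural numbers. *)
Lemma measure_move F (Q Q' : polygon_domain S) (B : {perm sides}) x y :
    y != ord0 -> B ord0 = ord0 ->
    (forall j, side Q' j = if B j == y then ((side Q x)^-1 * side Q y)%g else
      if B j == pd_pairing Q y then ((side Q x)^-1 * side Q y)^-1%g
      else side Q (B j)) ->
  (measure F Q' + (F (side_word Q y) + F (side_word Q (pd_pairing Q y))) =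
  measure F Q + (F (N ((side Q x)^-1 * side Q y)%g) +
    F (inv_word s (N ((side Q x)^-1 * side Q y)%g))))%N.
Proof.
set d := ((side Q x)^-1 * side Q y)%g => y0 B0 BS; set sy := pd_pairing Q y.
have syy : sy != y := pairing_neq Q y0.
have sy0 : sy != ord0 by rewrite /sy pairing_eq0.
pose W b := if b == ord0 then [::] else if b == y then N d else
  if b == sy then inv_word s (N d) else side_word Q b.
have -> : measure F Q' = (\sum_b F (W b))%N.
  rewrite [RHS](reindex_inj (@perm_inj _ B)); apply: eq_bigr => j _; congr F.
  have Bj0 : (B j == ord0) = (j == ord0) by rewrite -{1}B0 (inj_eq (@perm_inj _ B)).
  rewrite /W /side_word Bj0; case: eqP => // _; rewrite BS.
  by case: eqP => // _; case: eqP => // _; exact: normal_inv.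
rewrite /measure (bigD1 y) //= (bigD1 sy) //= [in RHS](bigD1 y) //= [in RHS](bigD1 sy) //=.
have -> : W y = N d by rewrite /W (negbTE y0) eqxx.
have -> : W sy = inv_word s (N d) by rewrite /W (negbTE sy0) (negbTE syy) eqxx.
rewrite (eq_bigr (fun b => F (side_word Q b))); first by lia.
move=> b /andP[by1 bsy]; rewrite /W (negbTE by1) (negbTE bsy).
by case: eqP => // ->; rewrite /side_word eqxx.
Qed.

(** In the word of [y] the move replaces the prefix shared with [x] by the inverse of the rest of
    [x]. Either this is shorter, or it has equal length and smaller code; in the latter case the
    first half of the word of [y] improves and that of its inverse is unchanged. *)
Lemma improvement (Q Q' : polygon_domain S) (B : {perm sides}) M i x y :
    i != ord0 -> ordS i != ord0 -> outgoing Q i x y -> improves Q M i x y ->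
    B ord0 = ord0 ->
    (forall j, side Q' j = if B j == y then ((side Q x)^-1 * side Q y)%g else
      if B j == pd_pairing Q y then ((side Q x)^-1 * side Q y)^-1%g
      else side Q (B j)) ->
  (measure size Q' < measure size Q)%N \/
  measure size Q' = measure size Q /\
  (measure (code M \o @half _) Q' < measure (code M \o @half _) Q)%N.
Proof.
move=> i0 Si0 o imp B0 BS.
have x0 : x != ord0 by case: o => -[-> _]; rewrite ?pairing_eq0.
have y0 : y != ord0 by case: o => -[_ ->]; rewrite ?pairing_eq0.
have wx : side_word Q x = N (side Q x) by rewrite /side_word (negbTE x0).
have wy : side_word Q y = N (side Q y) by rewrite /side_word (negbTE y0).
have wsy : side_word Q (pd_pairing Q y) = inv_word s (side_word Q y).
  by rewrite wy /side_word pairing_eq0 (negbTE y0) side_inv // normal_inv.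
have kE : cancellation Q i = lcp (N (side Q x)) (N (side Q y)).
  by rewrite /cancellation; case: o => -[xE yE]; rewrite -wx -wy xE yE // lcpC.
have Nd := normal_quotient (side Q x) (side Q y); rewrite /= -kE -wx -wy in Nd.
rewrite /improves in imp; set k := cancellation Q i in imp kE Nd.
have tk : take k (side_word Q x) = take k (side_word Q y).
  by rewrite wx wy kE take_lcp.
have yE : side_word Q y = take k (side_word Q x) ++ drop k (side_word Q y).
  by rewrite tk cat_take_drop.
have ksz : size (take k (side_word Q x)) = k by rewrite size_takel // wx kE lcp_le.
have := measure_move size y0 B0 BS.
have := measure_move (code M \o @half _) y0 B0 BS.
move: (drop k (side_word Q y)) yE Nd imp => y' yE Nd imp; rewrite wsy Nd yE.
move: (take k (side_word Q x)) (drop k (side_word Q x)) ksz imp => p x' ksz imp /=.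
rewrite !size_inv_word !size_cat !size_inv_word ksz => E1 E2.
have lt_sum (a b c d : nat) : (a + c = b + d -> d < c -> a < b)%N by lia.
have eq_sum (a b c d : nat) : (a + c = b + d -> d = c -> a = b)%N by lia.
have dbl (a b c : nat) : (a < b -> a + c + (a + c) < b + c + (b + c))%N by lia.
case: imp => [h|[xk ky h]]; first by left; apply: lt_sum E2 _; exact: dbl.
right; split; first by apply: eq_sum E2 _; rewrite xk.
apply: lt_sum E1 _.
have h1 : (size p <= size y')%N by rewrite ksz.
have h2 : (size (inv_word s x') <= size y')%N by rewrite size_inv_word xk.
rewrite !half_inv_cat // !half_cat // !code_cat !size_inv_word xk ksz.
by rewrite !ltn_add2r.
Qed.

(** Induction on the total length and then on the code weight. The bound [M] is the total length
    itself, so codes remain comparable as long as the length does not drop. *)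
Lemma descent (X : cs_object S) : rep X = (fun i => side P (arc_side P i)) ->
  forall (Y : cs_object S) (Q : polygon_domain S), has_polygon (rep Y) Q ->
  exists f : cs_hom Y X, cs_generated f.
Proof.
move=> repX.
suff main n : forall M t (Y : cs_object S) (Q : polygon_domain S), has_polygon (rep Y) Q ->
    measure size Q = n -> M = n -> measure (code M \o @half _) Q = t ->
    exists f : cs_hom Y X, cs_generated f.
  by move=> Y Q YQ; apply: main YQ _ _ _.
elim/ltn_ind: n => n IHn M; elim/ltn_ind => t IHt Y Q YQ Qn Mn Qt.
have repY := has_polygon_rep YQ.
have genQ : generating (fun n => side Q (arc_side Q n)).
  by rewrite -repY; have [] := rep_CG Y.
have wM i : (size (side_word Q i) <= M)%N.
  by rewrite Mn -Qn /measure (bigD1 i) //= leq_addr.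
have [[i [x [y [out imp]]]]|triv] := nielsen_step genQ wM.
  (* An improving corner cancels something, so it is not next to side 0 and a move is available
     there. *)
  have k0 : cancellation Q i != 0%N.
    case: imp => [h|[h1 _]]; first by rewrite -lt0n; apply: leq_ltn_trans h.
    apply: contraTneq => k0; rewrite k0 in h1 *.
    by rewrite take0 drop0 in h1 *; rewrite (size0nil h1).
  have i0 : i != ord0.
    by apply: contraNneq k0 => ->; rewrite /cancellation pairing0 /side_word eqxx.
  have Si0 : ordS i != ord0.
    by apply: contraNneq k0 => E; rewrite /cancellation E lcpC /side_word eqxx.
  have [Y' [Q' [B [mv Y'Q' B0 BS]]]] := corner_move YQ i0 Si0 out.
  have [f' gf'] : exists f : cs_hom Y' X, cs_generated f.
    have [h|[h1 h2]] := improvement i0 Si0 out imp B0 BS.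
      by apply: (IHn (measure size Q') _ _ _ _ Q' Y'Q' erefl erefl erefl); rewrite -Qn.
    by apply: (IHt (measure (code M \o @half _) Q') _ Y' Q' Y'Q' _ Mn erefl);
      rewrite -?Qt // h1.
  have [e _] := cs_hom_exists g_gt0 Y Y'.
  by exists (hom_comp e f'); apply: cs_gen_comp gf'; exact: cs_gen_move.
(* Both polygons now have the same side classes. Their pairings are determined by inversion and
   agree too, which makes the canonical representatives, hence the objects, equal. *)
have sides_eq j : j != ord0 -> side Q j = side P j.
  move=> j0; rewrite -[LHS]N_value.
  have := triv j j0; rewrite /side_word (negbTE j0) => ->.
  exact: word_value_seq1.
have pair_eq j : pd_pairing Q j = pd_pairing P j.
  have [->|j0] := eqVneq j ord0; first by rewrite !pairing0.
  apply: (@side_inj _ _ _ g_gt0 P); rewrite ?pairing_eq0 //.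
  by rewrite -sides_eq ?pairing_eq0 // !side_inv // sides_eq.
have arc_eq n' : arc_side Q n' = arc_side P n'.
  rewrite /arc_side /first_sides; congr nth; apply: eq_filter => k.
  by rewrite pair_eq.
have XY : X = Y.
  apply: cs_object_eq; rewrite repX repY; apply/funext => n'.
  by rewrite arc_eq sides_eq ?arc_side_neq0.
by rewrite XY; exists (hom_id Y); exact: cs_gen_id.
Qed.

End Descent.

Theorem lemma5p1 (R : realType) (g : nat) (g_ge1 : (1 <= g)%N)
    (S : surface R g) (X Y : cs_object S) (f : cs_hom X Y) :
  cs_generated f.
Proof.
have [Q [XQ _ _]] := object_polygon X.
have [P [_ repY genP]] := object_polygon Y.
have [N [N_rl N_value N_id N_size N_size_eq]] := normal_form g_ge1 genP.
have [f' gf'] : exists f' : cs_hom X Y, cs_generated f'.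
  apply: (descent g_ge1 _ _ N_value N_id N_size N_size_eq repY XQ) => u;
  by have /andP[] := N_rl u.
by rewrite (cs_hom_eq f f').
Qed.
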